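(* Suppose that the following two conditions hold. (1) There exist a constant $\kappa>0$ and a nondecreasing, continuously differentiable function $\zeta:[0,\infty)\to[1,\infty)$ with $\int_0^\infty \frac{dr}{r\zeta(r)+1}=\infty$ such that for all $x\in\mathbb R^d$ $$2\langle x,b(x)\rangle+|\sigma(x)|^2+\int_U|c(x,u)|^2\,\nu(du)\le \kappa\,[\,|x|^2\zeta(|x|^2)+1\,].$$ (2) There exist $\delta_0>0$ and a nondecreasing concave function $\varrho:[0,\infty)\to[0,\infty)$ with $0<\varrho(r)\le(1+r)^2\varrho\big(\tfrac{r}{1+r}\big)$ for all $r>0$ and $\int_{0+}\frac{dr}{\varrho(r)}=\infty$ such that for every $R>0$ there is a constant $\kappa_R>0$ such that for all $x,z\in\mathbb R^d$ with $|x|\vee|z|\le R$ and $|x-z|\le\delta_0$, $$2\langle x-z,b(x)-b(z)\rangle+|\sigma(x)-\sigma(z)|^2+\int_U|c(x,u)-c(z,u)|^2\,\nu(du)\le\kappa_R\,\varrho(|x-z|^2).$$ Then pathwise uniqueness holds for the stochastic differential equation $$dX(t)=b(X(t))\,dt+\sigma(X(t))\,dW(t)+\int_U c(X(t-),u)\,\widetilde N(dt,du).$$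
   Context: Let $d\ge2$, $(U,\mathfrak U)$ a measurable space, $\nu$ a $\sigma$-finite measure on $U$. The functions $b:\mathbb R^d\to\mathbb R^d$, $\sigma:\mathbb R^d\to\mathbb R^{d\times d}$, $c:\mathbb R^d\times U\to\mathbb R^d$ are Borel measurable; $b$, $\sigma$ and $c(\cdot,u)$ (for each $u\in U$) are continuous, and $x\mapsto\int_U|c(x,u)|^2\nu(du)$ is continuous. For a matrix or vector $A$, $|A|=\sqrt{\mathrm{tr}(AA^T)}$. On a filtered probability space $(\Omega,\mathcal F,\{\mathcal F_t\},\mathbb P)$ satisfying the usual hypotheses, $W$ is a standard $d$-dimensional $\{\mathcal F_t\}$-Brownian motion, $N$ is the Poisson random measure on $[0,\infty)\times U$ with intensity $dt\,\nu(du)$ associated with an $\{\mathcal F_t\}$-Poisson point process $p$ on $U$ independent of $W$, and $\widetilde N$ is its compensated measure. A (weak) solution up to an explosion time is an $\mathbb R^d$-valued càdlàg $\{\mathcal F_t\}$-adapted process $X$ with $X(0)$ $\mathcal F_0$-measurable such that, with $\tau_n=\inf\{t\ge0:|X(t)|>n\}$, the integral form of the equation holds at time $t\wedge\tau_n$ for all $n\in\mathbb N$ and $t\ge0$ a.s. Pathwise uniqueness holds if any two solutions $X_1,X_2$ (on the same filtered probability space with the same $W$, $N$) with $\mathbb P\{X_1(0)=X_2(0)\}=1$ satisfy $\mathbb P\{X_1(t)=X_2(t)\text{ for all }t\ge0\}=1$. *)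

(* Defs.v *)
From HB Require Import structures.
From mathcomp Require Import all_boot all_order all_algebra.
From mathcomp Require Import all_classical all_reals all_analysis.
From mathcomp Require Import measurable_realfun.

Set Implicit Arguments.
Unset Strict Implicit.
Unset Printing Implicit Defensive.

Import Order.TTheory GRing.Theory Num.Theory.
Import numFieldNormedType.Exports.

Local Open Scope classical_set_scope.
Local Open Scope ring_scope.

(* The library norm on matrices is the sup norm, hence these definitions. *)
Definition frob (R : realType) (m n : nat) (A : 'M[R]_(m, n)) : R :=
  Num.sqrt (\tr (A *m A^T)).

Definition dotp (R : realType) (d : nat) (x y : 'cV[R]_d) : R :=
  (x^T *m y) 0 0.

Definition int_sq (R : realType) (d : nat) (dU : measure_display)
    (U : measurableType dU) (nu : {measure set U -> \bar R})
    (f : U -> 'cV[R]_d) : \bar R :=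
  (\int[nu]_u (frob (f u) ^+ 2)%:E)%E.

(* R^d with its Borel sigma-algebra, as a measurable type. *)
Definition borelRd (R : realType) (d : nat) :=
  g_sigma_algebraType (@open 'cV[R]_d).

(* Derivative within [0, +oo[: one-sided at 0, two-sided elsewhere. *)
Definition is_C1_on_nonneg (R : realType) (f : R -> R) : Prop :=
  exists f' : R -> R,
    {within `[0, +oo[, continuous f'} /\
    forall r, 0 <= r ->
      (f s - f r) / (s - r) @[s --> within (`[0, +oo[%classic `\ r) (nbhs r)]
        --> f' r.

Definition nondecreasing_on_nonneg (R : realType) (f : R -> R) : Prop :=
  forall x y, 0 <= x -> x <= y -> f x <= f y.

Definition concave_on_nonneg (R : realType) (f : R -> R) : Prop :=
  forall x y a, 0 <= x -> 0 <= y -> 0 <= a <= 1 ->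
    a * f x + (1 - a) * f y <= f (a * x + (1 - a) * y).

Section stochastic_basis.
Context (R : realType) (d : nat).
Context (dT : measure_display) (T : measurableType dT) (P : probability T R).
Context (dU : measure_display) (U : measurableType dU).

(* Time is [0, +oo[: processes, filtrations and point functions are indexed by
   R, and only their values at nonnegative times matter. *)

Definition usual_filtration (F : R -> set (set T)) : Prop :=
  [/\ forall t, 0 <= t -> sigma_algebra setT (F t) /\ F t `<=` measurable,
      forall s t, 0 <= s -> s <= t -> F s `<=` F t,
      forall t, 0 <= t -> F t = \bigcap_(s in [set s | t < s]) F s &
      forall A, P.-negligible A -> F 0 A].

Definition measurable_wrt (G : set (set T)) (m n : nat)
    (f : T -> 'M[R]_(m, n)) : Prop :=
  forall O : set 'M[R]_(m, n), open O -> G (f @^-1` O).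

Definition adapted (F : R -> set (set T)) (m n : nat)
    (X : R -> T -> 'M[R]_(m, n)) : Prop :=
  forall t, 0 <= t -> measurable_wrt (F t) (X t).

Definition cadlag (m n : nat) (x : R -> 'M[R]_(m, n)) : Prop :=
  (forall t, 0 <= t -> x @ t^'+ --> x t) /\
  (forall t, 0 < t -> cvg (x @ t^'-)).

Definition left_lim (m n : nat) (x : R -> 'M[R]_(m, n)) (t : R) :
    'M[R]_(m, n) := lim (x @ t^'-).

Definition indep_classes (G H : set (set T)) : Prop :=
  forall A B, G A -> H B -> P (A `&` B) = (P A * P B)%E.

(* The second parameter of normal_prob is the standard deviation. *)
Definition standard_brownian_motion (F : R -> set (set T))
    (W : R -> T -> 'cV[R]_d) : Prop :=
  [/\ adapted F W,
      {ae P, forall w, W 0 w = 0 /\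
         {within `[0, +oo[, continuous (fun t => W t w)}},
      forall s t, 0 <= s -> s < t ->
        indep_classes (F s)
          <<s [set A | exists2 O : set 'cV[R]_d, open O &
                        A = [set w | O (W t w - W s w)]] >> &
      forall s t, 0 <= s -> s < t ->
        forall B : 'I_d -> set R, (forall i, measurable (B i)) ->
        P [set w | forall i, B i ((W t w - W s w) i 0)] =
          (\prod_(i < d) normal_prob 0 (Num.sqrt (t - s)) (B i))%E].

Definition brownian_sigma (W : R -> T -> 'cV[R]_d) : set (set T) :=
  <<s [set A | exists t, exists2 O : set 'cV[R]_d, 0 <= t /\ open O &
                A = W t @^-1` O] >>.

(* A point process is a map p with p w s = Some u when w has the point u at
   time s, and None when s is not in the domain of the point function of w;
   point_count is the random measure N(E) = #{s | (s, p(s)) \in E}. *)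
Definition point_count (p : T -> R -> option U) (w : T)
    (E : set (measurableTypeR R * U)) : \bar R :=
  counting [set s : R | exists2 u, p w s = Some u & E (s, u)].

Definition point_sigma (p : T -> R -> option U) (D : set R) : set (set T) :=
  <<s [set A | exists E : set (measurableTypeR R * U), exists2 x,
                measurable E /\ E `<=` D `*` setT &
                A = [set w | point_count p w E = x]] >>.

(* The Poisson law is written out because the library's poisson_pmf is not the
   Dirac mass at 0 when the rate is 0. *)
Definition poisson_random_measure (nu : {sigma_finite_measure set U -> \bar R})
    (p : T -> R -> option U) : Prop :=
  let intensity : set (measurableTypeR R * U) -> \bar R :=
    (@lebesgue_measure R \x nu)%E in
  let dom : set (measurableTypeR R * U) := `[0, +oo[%classic `*` setT in
  [/\ forall E, measurable E -> E `<=` dom ->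
        measurable_fun [set: T] (point_count p ^~ E : T -> \bar R),
      forall E (lam : R), measurable E -> E `<=` dom ->
        intensity E = lam%:E -> forall n : nat,
        P [set w | point_count p w E = n%:R%:E] =
          (lam ^+ n / n`!%:R * expR (- lam))%:E,
      forall E, measurable E -> E `<=` dom -> intensity E = +oo%E ->
        P [set w | point_count p w E = +oo%E] = 1%E &
      forall (k : nat) (E : 'I_k -> set (measurableTypeR R * U))
        (x : 'I_k -> \bar R),
        (forall i, measurable (E i) /\ E i `<=` dom) -> trivIset setT E ->
        P [set w | forall i, point_count p w (E i) = x i] =
          (\prod_(i < k) P [set w | point_count p w (E i) = x i])%E].

Definition poisson_point_process (F : R -> set (set T))
    (nu : {sigma_finite_measure set U -> \bar R})
    (p : T -> R -> option U) : Prop :=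
  [/\ forall w s u, p w s = Some u -> 0 < s,
      forall w, countable [set s | p w s <> None],
      poisson_random_measure nu p,
      forall t, 0 <= t -> point_sigma p `[0, t] `<=` F t &
      forall s, 0 <= s -> indep_classes (F s) (point_sigma p `]s, +oo[)].

Definition bounded_rv (m n : nat) (f : T -> 'M[R]_(m, n)) : Prop :=
  exists K : R, forall w, frob (f w) <= K.

(* An elementary Brownian integrand is a list of triples (s, t, xi) standing
   for the sum of the xi * 1_{]s, t]}. *)
Definition elemW := seq (R * R * (T -> 'M[R]_d)).

Definition elemW_ok (F : R -> set (set T)) (h : elemW) : Prop :=
  forall k, (k < size h)%N ->
    let: (s, t, xi) := nth (0, 0, fun=> 0) h k in
    [/\ 0 <= s, s <= t, measurable_wrt (F s) xi & bounded_rv xi].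

Definition elemW_val (h : elemW) (r : R) (w : T) : 'M[R]_d :=
  \sum_(a <- h) (a.1.1 < r <= a.1.2)%R%:R *: a.2 w.

Definition elemW_int (W : R -> T -> 'cV[R]_d) (h : elemW) (t : R) (w : T) :
    'cV[R]_d :=
  \sum_(a <- h)
    a.2 w *m (W (Num.min a.1.2 t) w - W (Num.min a.1.1 t) w).

(* The process I is (a cadlag version of) the integral of H with respect to W:
   at each time it is the L^2(P) limit of the integrals of elementary
   integrands converging to H in L^2(P * dr). *)
Definition is_ito_integral (F : R -> set (set T)) (W : R -> T -> 'cV[R]_d)
    (H : R -> T -> 'M[R]_d) (I : R -> T -> 'cV[R]_d) : Prop :=
  [/\ adapted F I,
      {ae P, forall w, cadlag (fun t => I t w)} &
      forall t, 0 <= t -> exists h : nat -> elemW,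
      [/\ forall k, elemW_ok F (h k),
          (fun k => \int[P]_w \int[@lebesgue_measure R]_(r in `]0%R, t])
              (frob (elemW_val (h k) r w - H r w) ^+ 2)%:E)%E
            @ \oo --> 0%E &
          (fun k => \int[P]_w
              (frob (elemW_int W (h k) t w - I t w) ^+ 2)%:E)%E
            @ \oo --> 0%E]].

(* An elementary integrand for the compensated random measure is a list of
   tuples (s, t, B, xi) standing for the sum of the xi * 1_{]s, t] * B}. *)
Definition elemN := seq (R * R * set U * (T -> 'cV[R]_d)).

Definition elemN_ok (F : R -> set (set T)) (nu : {measure set U -> \bar R})
    (h : elemN) : Prop :=
  forall k, (k < size h)%N ->
    let: (s, t, B, xi) := nth (0, 0, set0, fun=> 0) h k in
    [/\ 0 <= s <= t, measurable B, (nu B < +oo)%E, measurable_wrt (F s) xi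
      & bounded_rv xi].

Definition elemN_val (h : elemN) (r : R) (u : U) (w : T) : 'cV[R]_d :=
  \sum_(a <- h)
    ((a.1.1.1 < r <= a.1.1.2)%R%:R * \1_(a.1.2) u) *: a.2 w.

(* fine loses nothing almost surely: only sets of finite intensity occur. *)
Definition compensated_count (nu : {measure set U -> \bar R})
    (p : T -> R -> option U) (s t : R) (B : set U) (w : T) : R :=
  fine (point_count p w (`]s, t]%classic `*` B)) - (t - s) * fine (nu B).

Definition elemN_int (nu : {measure set U -> \bar R})
    (p : T -> R -> option U) (h : elemN) (t : R) (w : T) : 'cV[R]_d :=
  \sum_(a <- h)
    compensated_count nu p (Num.min a.1.1.1 t) (Num.min a.1.1.2 t) a.1.2 w
      *: a.2 w.

Definition is_poisson_integral (F : R -> set (set T))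
    (nu : {measure set U -> \bar R}) (p : T -> R -> option U)
    (H : R -> U -> T -> 'cV[R]_d) (I : R -> T -> 'cV[R]_d) : Prop :=
  [/\ adapted F I,
      {ae P, forall w, cadlag (fun t => I t w)} &
      forall t, 0 <= t -> exists h : nat -> elemN,
      [/\ forall k, elemN_ok F nu (h k),
          (fun k => \int[P]_w \int[@lebesgue_measure R]_(r in `]0%R, t])
              \int[nu]_u (frob (elemN_val (h k) r u w - H r u w) ^+ 2)%:E)%E
            @ \oo --> 0%E &
          (fun k => \int[P]_w
              (frob (elemN_int nu p (h k) t w - I t w) ^+ 2)%:E)%E
            @ \oo --> 0%E]].

Definition exit_time (X : R -> T -> 'cV[R]_d) (n : nat) (w : T) : \bar R :=
  ereal_inf [set t%:E | t in [set t : R | 0 <= t /\ n%:R < frob (X t w)]].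

Definition stopped_at (X : R -> T -> 'cV[R]_d) (n : nat) (t : R) (w : T) : R :=
  fine (Order.min t%:E (exit_time X n w)).

Definition before_exit (X : R -> T -> 'cV[R]_d) (n : nat) (r : R) (w : T) : R :=
  ((r%:E <= exit_time X n w)%E)%:R.

(* The stochastic integrals up to t /\ tau_n are the integrals up to t of the
   integrands multiplied by 1_{r <= tau_n}.  These are jointly measurable,
   paths of X being cadlag, so the iterated integrals above are the usual
   L^2 norms. *)
Definition is_solution (b : 'cV[R]_d -> 'cV[R]_d) (sigma : 'cV[R]_d -> 'M[R]_d)
    (c : 'cV[R]_d -> U -> 'cV[R]_d) (nu : {measure set U -> \bar R})
    (F : R -> set (set T)) (W : R -> T -> 'cV[R]_d) (p : T -> R -> option U)
    (X : R -> T -> 'cV[R]_d) : Prop :=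
  [/\ adapted F X,
      forall w, cadlag (fun t => X t w) &
      exists MW MN : nat -> R -> T -> 'cV[R]_d,
      [/\ forall n, is_ito_integral F W
            (fun r w => before_exit X n r w *: sigma (X r w)) (MW n),
          forall n, is_poisson_integral F nu p
            (fun r u w => before_exit X n r w *:
               c (left_lim (fun s => X s w) r) u) (MN n) &
          {ae P, forall w, forall (n : nat) (t : R), 0 <= t ->
             X (stopped_at X n t w) w =
               X 0 w
               + \col_i (\int[@lebesgue_measure R]_(r in
                           `[0%R, stopped_at X n t w]) (b (X r w) i 0))%R
               + MW n t w + MN n t w}]].

End stochastic_basis.

Definition pathwise_uniqueness (R : realType) (d : nat) (dU : measure_display)
    (U : measurableType dU) (nu : {sigma_finite_measure set U -> \bar R})
    (b : 'cV[R]_d -> 'cV[R]_d) (sigma : 'cV[R]_d -> 'M[R]_d)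
    (c : 'cV[R]_d -> U -> 'cV[R]_d) : Prop :=
  forall (dT : measure_display) (T : measurableType dT) (P : probability T R)
    (F : R -> set (set T)) (W : R -> T -> 'cV[R]_d) (p : T -> R -> option U)
    (X1 X2 : R -> T -> 'cV[R]_d),
    usual_filtration P F ->
    standard_brownian_motion P F W ->
    poisson_point_process P F nu p ->
    indep_classes P (brownian_sigma W) (point_sigma p `[0, +oo[) ->
    is_solution P b sigma c nu F W p X1 ->
    is_solution P b sigma c nu F W p X2 ->
    P [set w | X1 0 w = X2 0 w] = 1%E ->
    P [set w | forall t, 0 <= t -> X1 t w = X2 t w] = 1%E.

(* Main.v *)
(* Let X1, X2 be solutions with the same noise, D = X1 - X2, and let L_r be the
   event that both paths stay in the ball of radius n on [0, r]; put
   f(r) = E[1_{L_r} |D_r|^2].  The components W_j and the compensated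
   counts N~(. x B) are martingales whose mutual brackets are deterministic (that of W_j and N~ vanishes since their product has small
   variance along fine partitions), so that, for
   elementary integrands, the isometry
     E|zeta + beta (M_t - M_s)|^2 = E|zeta|^2 + E[beta^2 int_s^t (rate) dr]
   holds for bounded F_s-measurable zeta, beta; it passes, as an inequality, to the
   stochastic integrals of the solutions.  No Ito formula is needed: applied
   with beta = 1_{L_s}, zeta = 1_{L_s} D_s on the cells of a partition whose mesh
   tends to 0, it yields, by dominated convergence, left limits agreeing with
   values outside a countable set,
     f(t) <= f(s) + E int_s^t 1_{L_r} (2 <D_r, b(X1_r) - b(X2_r)> + rate_r) dr.
   The integrand is at most k rho(|D_r|^2) <= k rho(e) (1 + |D_r|^2 / e) for every
   e > 0 by concavity, and the choice e = sup_{[0, t]} f turns this into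
   sup_{[0, t]} f - sup_{[0, s]} f <= 2 k (t - s) rho(sup_{[0, t]} f), which forces
   f = 0 because 1 / rho is not integrable at 0.  Paths being locally bounded,
   n -> oo concludes. *)
Require Import Defs.
From HB Require Import structures.
From mathcomp Require Import all_boot all_order all_algebra.
From mathcomp Require Import all_classical all_reals all_analysis.
From mathcomp Require Import measurable_realfun.
From mathcomp Require Import ring lra.

Set Implicit Arguments.
Unset Strict Implicit.
Unset Printing Implicit Defensive.

Import Order.TTheory GRing.Theory Num.Theory.
Import numFieldNormedType.Exports.

Local Open Scope classical_set_scope.
Local Open Scope ring_scope.

(** * Square integrable random variables *)

(** The stochastic integrals are given time by time, as L^2 limits along sequences that may change
    with the time. Everything therefore rests on a one-step estimate from s to t. In it the drift
    meets the martingale increment in a cross term, split with a weight eta into eta times a term of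
    order t - s and a term of order (t - s)^2 / eta; the mesh tends to 0 first, eta afterwards. The
    gap is killed rather than stopped: it is multiplied by the indicator that both paths have stayed
    in the ball up to the present time. A jump may carry a path arbitrarily far out of the ball, but
    the killed gap is then 0, so the overshoot never has to be estimated; and while the indicator is
    1, the stopped equations hold at the present time itself. The price is a mismatch: the isometry
    needs the indicator and the gap frozen at the left end of each cell, while the condition on the
    coefficients is used at the running time. The resulting error vanishes because a cadlag path has
    countably many jumps. *)

Section square_integrable.
Context (R : realType) (dT : measure_display) (T : measurableType dT)
  (P : probability T R).
Implicit Types f g : T -> R.

Definition L1 f := P.-integrable setT (EFin \o f).
Definition L2 f := measurable_fun setT f /\ L1 (fun w => f w ^+ 2).
Definition Ex f : R := \int[P]_w f w.

Lemma L1_meas f : L1 f -> measurable_fun setT f.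
Proof. by move=> /integrableP[/measurable_EFinP]. Qed.

Lemma L1_le f g : measurable_fun setT f -> L1 g ->
  (forall w, `|f w| <= g w) -> L1 f.
Proof.
move=> mf ig fg; apply: (le_integrable _ _ _ ig) => //.
- exact/measurable_EFinP.
- by move=> w _ /=; rewrite lee_fin (le_trans (fg w))// ler_norm.
Qed.

Lemma L1_cst (k : R) : L1 (fun=> k).
Proof. by apply: finite_measure_integrable_cst. Qed.

Lemma L1D f g : L1 f -> L1 g -> L1 (fun w => f w + g w).
Proof. by move=> hf hg; have := integrableD measurableT hf hg; congr integrable. Qed.

Lemma L1Z (k : R) f : L1 f -> L1 (fun w => k * f w).
Proof. by move=> hf; have := integrableZl measurableT k hf; congr integrable. Qed.

Lemma L1_sum (I : Type) (s : seq I) (p : pred I) (f : I -> T -> R) :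
  (forall i, p i -> L1 (f i)) -> L1 (fun w => \sum_(i <- s | p i) f i w).
Proof.
move=> hf; elim: s => [|a s ih].
  by under [X in L1 X]eq_fun do rewrite big_nil; exact: L1_cst.
under [X in L1 X]eq_fun do rewrite big_cons.
case pa : (p a) => //; apply: L1D => //; exact: hf.
Qed.

Lemma ExD f g : L1 f -> L1 g -> Ex (fun w => f w + g w) = Ex f + Ex g.
Proof. by move=> ? ?; exact: RintegralD. Qed.

Lemma ExZ (k : R) f : L1 f -> Ex (fun w => k * f w) = k * Ex f.
Proof. by move=> hf; rewrite /Ex (RintegralZl k measurableT hf). Qed.

Lemma ExB f g : L1 f -> L1 g -> Ex (fun w => f w - g w) = Ex f - Ex g.
Proof. by move=> ? ?; exact: RintegralB. Qed.

Lemma Ex_cst (k : R) : Ex (fun=> k) = k.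
Proof. rewrite /Ex Rintegral_cst// -[RHS]mulr1; congr (_ * _); apply: (@congr1 _ _ fine _ 1%E).
exact: probability_setT. Qed.

Lemma Ex_sum (I : Type) (s : seq I) (p : pred I) (f : I -> T -> R) :
  (forall i, p i -> L1 (f i)) ->
  Ex (fun w => \sum_(i <- s | p i) f i w) = \sum_(i <- s | p i) Ex (f i).
Proof.
move=> hf; elim: s => [|a s ih].
  by rewrite big_nil; under [X in Ex X]eq_fun do rewrite big_nil; exact: Ex_cst.
rewrite big_cons; under [X in Ex X]eq_fun do rewrite big_cons.
case pa : (p a) => //; rewrite ExD ?ih//; first exact: hf.
exact: L1_sum.
Qed.

Lemma Ex_le f g : L1 f -> L1 g -> (forall w, f w <= g w) -> Ex f <= Ex g.
Proof. by move=> ? ? fg; apply: le_Rintegral. Qed.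

Lemma Ex_ge0 f : (forall w, 0 <= f w) -> 0 <= Ex f.
Proof. by move=> f0; apply: Rintegral_ge0. Qed.

Lemma L1_ae f g : L1 f -> measurable_fun setT g ->
  {ae P, forall w, f w = g w} -> L1 g.
Proof.
move=> hf mg fg; apply/integrableP; split; first exact/measurable_EFinP.
rewrite (_ : integral _ _ _ = \int[P]_x `|(EFin \o f) x|)%E.
  by case/integrableP: hf.
apply: ae_eq_integral => //.
- by apply: measurableT_comp => //; exact/measurable_EFinP.
- by apply: measurableT_comp => //; exact/measurable_EFinP/L1_meas.
- by apply: filterS fg => w /= -> _.
Qed.

Lemma Ex_ae f g : measurable_fun setT f -> measurable_fun setT g ->
  {ae P, forall w, f w = g w} -> Ex f = Ex g.
Proof.
move=> mf mg fg; rewrite /Ex /Rintegral; congr fine; apply: ae_eq_integral => //;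
  try exact/measurable_EFinP.
by apply: filterS fg => w /= -> _.
Qed.

Lemma Ex_EFin f : L1 f -> (\int[P]_w (f w)%:E)%E = (Ex f)%:E.
Proof. by move=> hf; rewrite /Ex /Rintegral fineK//; exact: integrable_fin_num. Qed.

Lemma L1_ge0_lty f : measurable_fun setT f -> (forall w, 0 <= f w) ->
  (\int[P]_w (f w)%:E < +oo)%E -> L1 f.
Proof.
move=> mf f0 fy; apply/integrableP; split; first exact/measurable_EFinP.
by under eq_integral do rewrite /= ger0_norm//.
Qed.

Lemma L2_mul f g : L2 f -> L2 g -> L1 (fun w => f w * g w).
Proof.
move=> [mf hf] [mg hg]; apply: (@L1_le _ (fun w => f w ^+ 2 + g w ^+ 2)).
- exact: measurable_funM.
- exact: L1D.
- move=> w; rewrite normrM -(real_normK (num_real (f w))) -(real_normK (num_real (g w))).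
  have := sqr_ge0 (`|f w| - `|g w|); rewrite sqrrB.
  by have := mulr_ge0 (normr_ge0 (f w)) (normr_ge0 (g w)); lra.
Qed.

Lemma L2D f g : L2 f -> L2 g -> L2 (fun w => f w + g w).
Proof.
move=> hf hg; have [mf hf'] := hf; have [mg hg'] := hg.
split; first exact: measurable_funD.
have := L1D (L1D hf' hg') (L1Z 2 (L2_mul hf hg)); congr L1.
by apply/funext => w /=; ring.
Qed.

Lemma L2Z (k : R) f : L2 f -> L2 (fun w => k * f w).
Proof.
move=> [mf hf]; split; first exact: measurable_funM.
have := L1Z (k ^+ 2) hf; congr L1.
by apply/funext => w /=; ring.
Qed.

Lemma L2N f : L2 f -> L2 (fun w => - f w).
Proof.
by move=> /(L2Z (-1)); congr L2; apply/funext => w; rewrite mulN1r.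
Qed.

Lemma L2B f g : L2 f -> L2 g -> L2 (fun w => f w - g w).
Proof. by move=> hf hg; apply: L2D => //; exact: L2N. Qed.

Lemma L2_cst (k : R) : L2 (fun=> k).
Proof. by split => //; exact: L1_cst. Qed.

Lemma L2_sum (I : Type) (s : seq I) (p : pred I) (f : I -> T -> R) :
  (forall i, p i -> L2 (f i)) -> L2 (fun w => \sum_(i <- s | p i) f i w).
Proof.
move=> hf; elim: s => [|a s ih].
  by under [X in L2 X]eq_fun do rewrite big_nil; exact: L2_cst.
under [X in L2 X]eq_fun do rewrite big_cons.
case pa : (p a) => //; apply: L2D => //; exact: hf.
Qed.

Lemma L2_L1 f : L2 f -> L1 f.
Proof.
move=> hf; have := L2_mul (L2_cst 1) hf; congr L1.
by apply/funext => w; rewrite mul1r.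
Qed.

Lemma L2_ae f g : L2 f -> measurable_fun setT g ->
  {ae P, forall w, f w = g w} -> L2 g.
Proof.
move=> [mf hf] mg fg; split=> //; apply: (L1_ae hf); first exact: measurable_funX.
by apply: filterS fg => w ->.
Qed.

Definition bdd f := exists K : R, forall w, `|f w| <= K.

Lemma bddM f g : bdd f -> bdd g -> bdd (fun w => f w * g w).
Proof.
move=> [K hK] [M hM]; exists (K * M) => w; rewrite normrM.
by apply: ler_pM.
Qed.

Lemma bdd_L1M f g : measurable_fun setT f -> bdd f -> L1 g ->
  L1 (fun w => f w * g w).
Proof.
move=> mf [K hK] hg; apply: (@L1_le _ (fun w => K * `|g w|)).
- by apply: measurable_funM => //; exact: L1_meas.
- by apply: L1Z; exact: (integrable_abse hg).
- by move=> w; rewrite normrM ler_wpM2r.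
Qed.

Lemma bdd_L1 f : measurable_fun setT f -> bdd f -> L1 f.
Proof.
move=> mf bf; have := bdd_L1M mf bf (L1_cst 1); congr L1.
by apply/funext => w; rewrite mulr1.
Qed.

Lemma bdd_L2M f g : measurable_fun setT f -> bdd f -> L2 g ->
  L2 (fun w => f w * g w).
Proof.
move=> mf bf [mg hg]; split; first exact: measurable_funM.
have := bdd_L1M (measurable_funX 2 mf) _ hg.
rewrite (_ : (fun w => f w ^+ 2 * _) = (fun w => (f w * g w) ^+ 2)); last first.
  by apply/funext => w; rewrite exprMn.
by apply; have := bddM bf bf; congr bdd; apply/funext => w; rewrite expr2.
Qed.

Lemma bdd_L2 f : measurable_fun setT f -> bdd f -> L2 f.
Proof.
move=> mf bf; have := bdd_L2M mf bf (L2_cst 1); congr L2.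
by apply/funext => w; rewrite mulr1.
Qed.

Definition indep_rv f g := forall A B : set R, measurable A -> measurable B ->
  (P ((f @^-1` A) `&` (g @^-1` B)) = P (f @^-1` A) * P (g @^-1` B))%E.

(* Independence makes the law of the pair a product measure, so that Fubini
   applies. *)
Lemma Ex_indep_mfun (f g : {mfun T >-> R}) : indep_rv f g -> L1 f -> L1 g ->
  L1 (fun w => f w * g w) /\ Ex (fun w => f w * g w) = Ex f * Ex g.
Proof.
move=> ifg hf hg; have mf := L1_meas hf; have mg := L1_meas hg.
pose Pf := distribution P f.
pose Pg := distribution P g.
have mh : measurable_fun setT (fun w => (f w, g w)).
  by apply/measurable_fun_pairP; split.
pose Q := pushforward P (fun w => (f w, g w)).
have E : forall X : set (R * R), measurable X -> (Pf \x Pg)%E X = Q X.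
  apply: (@product_measure_unique _ _ _ _ _ Pf Pg Q) => A B mA mB.
  by rewrite /= /Q /pushforward -ifg.
pose phi (z : R * R) := z.1 * z.2.
have mphi : measurable_fun setT (EFin \o phi).
  by apply/measurable_EFinP; apply: measurable_funM.
have mid : measurable_fun setT (EFin \o (idfun : R -> R)).
  by apply/measurable_EFinP; exact: measurable_id.
have mid' : measurable_fun setT (fun x : R => `|x|%:E).
  by apply/measurable_EFinP; exact: normr_measurable.
have iX (X : {mfun T >-> R}) : L1 X ->
    (distribution P X).-integrable setT (EFin \o idfun).
  by move=> hX; apply: integrable_pushforward.
have sg x : (\int[Pg]_y `|(EFin \o phi) (x, y)| = `|x|%:E * \int[Pg]_y `|y|%:E)%E.
  rewrite -ge0_integralZl//; apply: eq_integral => y _.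
  by rewrite /= /phi normrM EFinM.
have iphi : (Pf \x Pg)%E.-integrable setT (EFin \o phi).
  apply/(integrable12ltyP Pf Pg mphi).
  under eq_integral => x _ do rewrite sg.
  rewrite ge0_integralZr//; last exact: integral_ge0.
  apply: lte_mul_pinfty.
  - exact: integral_ge0.
  - rewrite ge0_fin_numE; last exact: integral_ge0.
    by have /integrableP[] := iX f hf.
  - by have /integrableP[] := iX g hg.
have EQ h : (\int[(Pf \x Pg)%E]_z h z = \int[Q]_z h z)%E.
  by apply: eq_measure_integral => A mA _; exact: E.
have ifg' : L1 (fun w => f w * g w).
  apply/integrableP; split; first by apply/measurable_EFinP; exact: measurable_funM.
  case/integrableP: iphi => _; rewrite EQ ge0_integral_pushforward//.
  by apply: measurableT_comp.
split=> //.
rewrite /Ex /Rintegral.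
have -> : (\int[P]_w (f w * g w)%:E = \int[Q]_z (EFin \o phi) z)%E.
  by rewrite integral_pushforward.
have eX (X : {mfun T >-> R}) : L1 X ->
    (\int[distribution P X]_y y%:E = (Ex X)%:E)%E.
  by move=> hX; rewrite -Ex_EFin//; exact: (@integral_distribution _ _ _ _ _ P X (EFin \o idfun)).
rewrite -EQ -integral12_prod_meas1//.
have sg' x : (\int[Pg]_y (EFin \o phi) (x, y) = x%:E * (Ex g)%:E)%E.
  under eq_integral => y _ do rewrite /= /phi EFinM.
  by rewrite integralZl ?eX//; exact: iX.
rewrite (eq_integral (fun x : R => x%:E * (Ex g)%:E)%E); last by move=> x _; exact: sg'.
by rewrite integralZr ?eX//; exact: iX.
Qed.

Lemma Ex_indep f g : indep_rv f g -> L1 f -> L1 g ->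
  L1 (fun w => f w * g w) /\ Ex (fun w => f w * g w) = Ex f * Ex g.
Proof.
move=> ifg hf hg.
pose fm : {mfun T >-> R} := HB.pack f (isMeasurableFun.Build _ _ _ _ f (L1_meas hf)).
pose gm : {mfun T >-> R} := HB.pack g (isMeasurableFun.Build _ _ _ _ g (L1_meas hg)).
exact: (@Ex_indep_mfun fm gm).
Qed.

End square_integrable.

(** * Moments of the normal and Poisson laws *)

Section density.
Context (R : realType) (dT : measure_display) (T : measurableType dT)
  (mu nu : {measure set T -> \bar R}) (g : T -> R).
Hypotheses (mg : measurable_fun setT g) (g0 : forall x, 0 <= g x).
Hypothesis nuE : forall A, measurable A -> nu A = (\int[mu]_(x in A) (g x)%:E)%E.

Import HBNNSimple.

(** True for indicators by [nuE], for simple functions by linearity, and in general by monotone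
    convergence of both sides along the same simple approximation. *)
Lemma ge0_integral_density (f : T -> \bar R) :
  measurable_fun setT f -> (forall x, (0 <= f x)%E) ->
  (\int[nu]_x f x = \int[mu]_x (f x * (g x)%:E))%E.
Proof.
move=> mf f0.
pose h := nnsfun_approx measurableT mf.
have mhg n : measurable_fun setT (fun x => ((EFin \o h n) x * (g x)%:E)%E).
  by apply: emeasurable_funM; exact/measurable_EFinP.
have -> : (\int[nu]_x f x = lim ((\int[nu]_x (EFin \o h n) x) @[n --> \oo]))%E.
  have fE x : f x = lim ((EFin \o h n) x @[n --> \oo]).
    by apply/esym/cvg_lim => //; exact: cvg_nnsfun_approx.
  under eq_integral => x _ do rewrite fE.
  apply: monotone_convergence => //.
  - by move=> n; exact/measurable_EFinP.
  - by move=> n x _ //=; rewrite lee_fin.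
  - by move=> x _ a b ab; rewrite lee_fin; exact/lefP/nd_nnsfun_approx.
have -> : (\int[mu]_x (f x * (g x)%:E) =
    lim ((\int[mu]_x ((EFin \o h n) x * (g x)%:E)) @[n --> \oo]))%E.
  have fg x : (f x * (g x)%:E)%E = lim (((EFin \o h n) x * (g x)%:E)%E @[n --> \oo]).
    apply/esym/cvg_lim => //; apply: cvgeZr => //; exact: cvg_nnsfun_approx.
  under eq_integral => x _ do rewrite fg.
  apply: monotone_convergence => //.
  - by move=> n x _ /=; rewrite mule_ge0 ?lee_fin.
  - by move=> x _ a b ab/=; rewrite lee_wpmul2r ?lee_fin//; exact/lefP/nd_nnsfun_approx.
suff suf n : (\int[mu]_x ((EFin \o h n) x * (g x)%:E) =
    \int[nu]_x (EFin \o h n) x)%E.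
  by congr (lim (_ @ \oo)); apply/funext => n; rewrite suf.
transitivity (\int[nu]_x
   (\sum_(y \in range (h n)) (y * \1_(h n @^-1` [set y]) x)%:E))%E; last first.
  by apply: eq_integral => t tE; rewrite /= fimfunE -fsumEFin.
have indich m r : measurable_fun setT (fun x => (r * \1_(h m @^-1` [set r]) x)%:E).
  by apply: (measurable_comp measurableT) => //; exact: measurable_funM.
rewrite ge0_integral_fsum//; last by move=> m y Ey; exact: nnfun_muleindic_ge0.
transitivity (\int[mu]_x (\sum_(y \in range (h n))
    (y * \1_(h n @^-1` [set y]) x)%:E * (g x)%:E))%E.
  apply: eq_integral => x xE.
  rewrite -ge0_mule_fsuml => [|y]; last exact: nnfun_muleindic_ge0.
  by rewrite fsumEFin // -(fimfunE _ x).
rewrite ge0_integral_fsum//; last 2 first.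
  - by move=> y; apply: emeasurable_funM => //; exact/measurable_EFinP.
  - move=> m y Ey; apply: mule_ge0; last by rewrite lee_fin.
    by rewrite EFinM; exact: nnfun_muleindic_ge0.
apply: eq_fsbigr => r rhn.
under [RHS]eq_integral do rewrite EFinM.
rewrite integralZl_indic_nnsfun => //.
under eq_integral do rewrite EFinM -muleA.
have r0 : (0 <= r%:E)%E by move: rhn; rewrite inE => -[x _ <-]; rewrite lee_fin.
rewrite ge0_integralZl//.
- congr (_ * _)%E; rewrite integral_indic// setIT nuE//.
  under eq_integral do rewrite muleC.
  rewrite (eq_integral ((EFin \o g) \_ (h n @^-1` [set r]))); last first.
    by move=> x xE; rewrite epatch_indic.
  by rewrite -integral_mkcond.
- apply: emeasurable_funM; first exact/measurable_EFinP.
  exact/measurable_EFinP.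
- by move=> x _; rewrite mule_ge0 ?lee_fin.
Qed.

End density.

Section moments.
Context (R : realType) (dT : measure_display) (T : measurableType dT)
  (P : probability T R).

(** The ratio of two normal densities is the exponential of a quadratic polynomial. Hence such an
    exponential has mean s2 / s1 under the centred law of deviation s1, and no Gaussian integral has
    to be computed. *)
Lemma normal_pdf_tilt (m s1 s2 x : R) : 0 < s1 -> 0 < s2 ->
  normal_pdf m s2 x = (s1 / s2) *
   expR ((s1 ^- 2 - s2 ^- 2) / 2 * x ^+ 2 + (x * m *+ 2 - m ^+ 2) / (s2 ^+ 2 *+ 2)) * normal_pdf 0 s1 x.
Proof.
move=> s10 s20; rewrite !normal_pdfE ?gt_eqF//= /normal_fun mulrCA.
rewrite -[LHS]mulrC (_ : normal_peak s2 = normal_peak s1 * (s1 / s2)); last first.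
  rewrite /normal_peak -!mulrnAr (sqrtrM _ (sqr_ge0 s1)) (sqrtrM _ (sqr_ge0 s2)) !sqrtr_sqr !gtr0_norm//.
  have : Num.sqrt (pi *+ 2 : R) != 0 by rewrite gt_eqF// sqrtr_gt0 mulrn_wgt0// pi_gt0.
  by move: (Num.sqrt _) => q q0; field; rewrite ?q0 ?gt_eqF.
have -> : expR (- (x - m) ^+ 2 / (s2 ^+ 2 *+ 2)) =
    expR ((s1 ^- 2 - s2 ^- 2) / 2 * x ^+ 2 + (x * m *+ 2 - m ^+ 2) / (s2 ^+ 2 *+ 2)) *
    expR (- (x - 0) ^+ 2 / (s1 ^+ 2 *+ 2)).
  by rewrite -expRD; congr expR; field; rewrite !lt0r_neq0.
by ring.
Qed.

Section normal.
Variables (s : R) (f : T -> R).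
Hypotheses (s0 : 0 < s) (mf : measurable_fun setT f).
Hypothesis fE : forall B, measurable B -> P (f @^-1` B) = normal_prob 0 s B.

Let normal_law (phi : R -> R) : measurable_fun setT phi -> (forall x, 0 <= phi x) ->
  (\int[P]_w (phi (f w))%:E =
   \int[@lebesgue_measure R]_x (phi x * normal_pdf 0 s x)%:E)%E.
Proof.
move=> mphi phi0.
have mf' : measurable_fun setT (f : T -> measurableTypeR R) := mf.
pose fm : {mfun T >-> measurableTypeR R} :=
  HB.pack (f : T -> measurableTypeR R) (isMeasurableFun.Build _ _ _ _ (f : T -> measurableTypeR R) mf').
have <- := @ge0_integral_distribution _ _ _ _ _ P fm (EFin \o phi).
- transitivity (\int[normal_prob 0 s]_x (EFin \o phi) x)%E.
    by apply: eq_measure_integral => A mA _; exact: fE.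
  rewrite (@ge0_integral_density _ _ _ lebesgue_measure _ (normal_pdf 0 s))//.
  + exact: measurable_normal_pdf.
  + exact: normal_pdf_ge0.
  + exact/measurable_EFinP.
- exact/measurable_EFinP.
- by move=> x /=; rewrite lee_fin.
Qed.

Let normal_tilt (m s2 : R) : 0 < s2 ->
  (\int[P]_w (expR ((s ^- 2 - s2 ^- 2) / 2 * f w ^+ 2 +
       (f w * m *+ 2 - m ^+ 2) / (s2 ^+ 2 *+ 2)))%:E = (s2 / s)%:E)%E.
Proof.
move=> s20.
rewrite (@normal_law (fun x => expR ((s ^- 2 - s2 ^- 2) / 2 * x ^+ 2 +
       (x * m *+ 2 - m ^+ 2) / (s2 ^+ 2 *+ 2)))); last 2 first.
- apply: measurableT_comp => //; apply: measurable_funD.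
    by apply: measurable_funM => //; exact: measurable_funX.
  apply: measurable_funM => //; apply: measurable_funB => //.
  rewrite (_ : (fun _ => _) = (fun x => x * (m *+ 2))); last by apply/funext => x; rewrite mulrnAr.
  exact: measurable_funM.
- by move=> x; exact: expR_ge0.
transitivity (\int[@lebesgue_measure R]_x ((s2 / s)%:E * (normal_pdf m s2 x)%:E))%E.
  apply: eq_integral => x _; rewrite (normal_pdf_tilt m x s0 s20) -EFinM; congr EFin.
  by rewrite !mulrA mulrVK ?unitfE ?gt_eqF// divff ?gt_eqF// mul1r.
rewrite integralZl//; last exact: integrable_normal_pdf.
by rewrite integral_normal_pdf mule1.
Qed.

(* Both moments come from 1 + y <= exp y applied to exponential tilts of the
   density, whose integrals are those of other normal densities. *)
Lemma normal_moments : [/\ L2 P f, Ex P f = 0 & Ex P (fun w => f w ^+ 2) = s ^+ 2].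
Proof.
pose tilt (m s2 : R) w := expR ((s ^- 2 - s2 ^- 2) / 2 * f w ^+ 2 +
       (f w * m *+ 2 - m ^+ 2) / (s2 ^+ 2 *+ 2)).
have tiltM (m s2 : R) : 0 < s2 -> measurable_fun setT (tilt m s2).
  move=> s20; apply: measurableT_comp => //; apply: measurable_funD.
    by apply: measurable_funM => //; exact: measurable_funX.
  apply: measurable_funM => //; apply: measurable_funB => //.
  rewrite (_ : (fun _ => _) = (fun w => f w * (m *+ 2))).
    exact: measurable_funM.
  by apply/funext => x; rewrite mulrnAr.
have tiltL (m s2 : R) : 0 < s2 -> L1 P (tilt m s2).
  move=> s20; apply: L1_ge0_lty; first exact: tiltM.
  - by move=> w; exact: expR_ge0.
  - by rewrite normal_tilt// ltry.
have tiltE (m s2 : R) : 0 < s2 -> Ex P (tilt m s2) = s2 / s.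
  by move=> s20; apply: EFin_inj; rewrite -Ex_EFin ?normal_tilt//; exact: tiltL.
have s2p : 0 < s ^+ 2 by rewrite exprn_gt0.
have tilt0 (s2 : R) w : 0 < s2 -> 1 + (s ^- 2 - s2 ^- 2) / 2 * f w ^+ 2 <= tilt 0 s2 w.
  move=> _; apply: le_trans (expR_ge1Dx _).
  by rewrite mulr0 mul0rn expr0n/= subrr mul0r addr0.
have tilts (m : R) w : 1 - m ^+ 2 / (s ^+ 2 *+ 2) + (m / s ^+ 2) * f w <= tilt m s w.
  apply: le_trans (expR_ge1Dx _); rewrite le_eqVlt; apply/orP; left; apply/eqP.
  by field; exact/lt0r_neq0.
(* Doubling the deviation makes the coefficient of f^2 in the exponent equal to 3 / (8 s^2) > 0, so
   the integrable tilt dominates f^2. *)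
have hf2 : L1 P (fun w => f w ^+ 2).
  have s20 : 0 < s * 2 by rewrite mulr_gt0.
  have h0 : 0 < (s ^- 2 - (s * 2) ^- 2) / 2.
    rewrite (_ : _ / _ = 3 / 8 / s ^+ 2); first by rewrite !divr_gt0.
    by field; exact/lt0r_neq0.
  have := L1Z ((s ^- 2 - (s * 2) ^- 2) / 2)^-1 (tiltL 0 _ s20).
  move=> h; apply: (L1_le _ h); first exact: measurable_funX.
  move=> w; rewrite ger0_norm ?sqr_ge0// mulrC ler_pdivlMr// mulrC.
  by apply: le_trans (tilt0 _ w s20); rewrite lerDr.
have L2f : L2 P f by [].
split => //.
(* A bound of order m^2 on a term linear in m, for m of both signs, forces the mean to be 0. *)
- have key (m : R) : m * Ex P f <= m ^+ 2 / 2.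
    have h1 := L1_cst P (1 - m ^+ 2 / (s ^+ 2 *+ 2)).
    have h2 := L1Z (m / s ^+ 2) (L2_L1 L2f).
    have := Ex_le (L1D h1 h2) (tiltL m s s0) (tilts m).
    rewrite tiltE// ExD// Ex_cst ExZ ?divff ?lt0r_neq0//; last exact: L2_L1.
    move=> h.
    rewrite -(@ler_pM2l _ (s ^- 2)) ?invr_gt0//.
    have -> : s ^- 2 * (m * Ex P f) = m / s ^+ 2 * Ex P f by ring.
    have -> : s ^- 2 * (m ^+ 2 / 2) = m ^+ 2 / (s ^+ 2 *+ 2).
      by field; exact/lt0r_neq0.
    by move: h; lra.
  have h1 (e : R) : 0 < e -> Ex P f <= e.
    move=> e0; have : e * Ex P f <= e * (e / 2) by have := key e; lra.
    by rewrite ler_pM2l//; lra.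
  have h2 (e : R) : 0 < e -> - e <= Ex P f.
    move=> e0; have : e * - Ex P f <= e * (e / 2) by have := key (- e); lra.
    by rewrite ler_pM2l//; lra.
  apply/eqP; rewrite eq_le; apply/andP; split; apply/ler_addgt0Pl => e e0.
    by rewrite addr0 h1.
  by have := h2 e e0; lra.
- set K := Ex P _.
  (* Tilt to the deviation s (1 + e). Dividing by e > 0, then by e < 0, and letting e tend to 0
     bounds K by s^2 from above and from below. *)
  have key (e : R) : -1 < e -> e * (2 + e) * K <= 2 * s ^+ 2 * e * (1 + e) ^+ 2.
    move=> e1; have e2 : 0 < 1 + e by lra.
    have s20 : 0 < s * (1 + e) by rewrite mulr_gt0.
    have := Ex_le (L1D (L1_cst P 1) (L1Z ((s ^- 2 - (s * (1 + e)) ^- 2) / 2) hf2))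
      (tiltL 0 _ s20) (fun w => tilt0 _ w s20).
    rewrite tiltE// ExD ?Ex_cst ?ExZ//; last 2 first.
    - exact: L1_cst.
    - exact: L1Z.
    have n1 : s != 0 by exact: lt0r_neq0.
    have n2 : 1 + e != 0 by exact: lt0r_neq0.
    rewrite -/K (_ : s * (1 + e) / s = 1 + e) ?lerD2l; last by field.
    rewrite -(@ler_pM2r _ (2 * s ^+ 2 * (1 + e) ^+ 2)) ?mulr_gt0 ?exprn_gt0//.
    rewrite (_ : (s ^- 2 - _) / 2 * _ * _ = e * (2 + e) * K); last by field; rewrite n1 n2.
    by move=> /le_trans; apply; rewrite le_eqVlt; apply/orP; left; apply/eqP; ring.
  have K0 : 0 <= K by apply: Ex_ge0 => w; exact: sqr_ge0.
  have key1 (e : R) : 0 < e -> e <= 1 -> 2 * K <= 2 * s ^+ 2 + e * (6 * s ^+ 2).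
    move=> e0 e1; have := key e; rewrite -mulrA [2 * s ^+ 2 * e]mulrC -mulrA ler_pM2l//.
    move=> /(_ _)/le_trans h; apply: le_trans (h _ _ _); [|lra|].
      by rewrite ler_wpM2r//; lra.
    have : 2 * s ^+ 2 * (1 + e) ^+ 2 <= 2 * s ^+ 2 * (1 + 3 * e).
      by apply: ler_wpM2l; [exact: mulr_ge0 _ (ltW s2p)|nra].
    by move/le_trans; apply; lra.
  have key2 (e : R) : 0 < e -> e < 1 -> 2 * s ^+ 2 - e * (4 * s ^+ 2) <= 2 * K.
    move=> e0 e1; have := key (- e).
    rewrite -mulrA [2 * s ^+ 2 * - e]mulrC -mulrA ler_nM2l ?oppr_lt0//.
    move=> h; have {}h := h ltac:(lra).
    have : (2 - e) * K <= 2 * K by rewrite ler_wpM2r//; lra.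
    move/(le_trans h); apply: le_trans.
    have : 2 * s ^+ 2 * (1 - 2 * e) <= 2 * s ^+ 2 * (1 - e) ^+ 2.
      by apply: ler_wpM2l; [exact: mulr_ge0 _ (ltW s2p)|nra].
    by apply: le_trans; lra.
  apply/eqP; rewrite eq_le; apply/andP; split; apply/ler_addgt0Pl => e e0.
  + pose t := Num.min 1 (e / (3 * s ^+ 2)).
    have t0 : 0 < t by rewrite lt_min ltr01 divr_gt0// mulr_gt0.
    have t1 : t <= 1 by rewrite ge_min lexx.
    have te : t * (3 * s ^+ 2) <= e by rewrite -ler_pdivlMr ?mulr_gt0// ge_min lexx orbT.
    by have := key1 t t0 t1; lra.
  + pose t := Num.min 2^-1 (e / (2 * s ^+ 2)).
    have t0 : 0 < t by rewrite lt_min invr_gt0 ltr0n divr_gt0// mulr_gt0.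
    have t1 : t <= 2^-1 by rewrite ge_min lexx.
    have te : t * (2 * s ^+ 2) <= e by rewrite -ler_pdivlMr ?mulr_gt0// ge_min lexx orbT.
    by have := key2 t t0 (le_lt_trans t1 _); rewrite invf_lt1// ltr1n => /(_ isT); lra.
Qed.
End normal.

Section poisson.
Variables (lam : R) (N : T -> \bar R).
Hypotheses (lam0 : 0 <= lam) (mN : measurable_fun setT N).

Let p n : R := lam ^+ n / n`!%:R * expR (- lam).
Hypothesis NE : forall n : nat, P [set w | N w = n%:R%:E] = (p n)%:E.

Let p0 n : 0 <= p n.
Proof. by rewrite mulr_ge0 ?expR_ge0// divr_ge0// exprn_ge0. Qed.

(** Combined with a shift of the index, this recursion reduces the first two moments to the total
    mass. *)
Let pS n : n.+1%:R * p n.+1 = lam * p n.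
Proof.
rewrite /p factS natrM exprS; field.
by rewrite pnatr_eq0 -lt0n fact_gt0/= addrC natr1 pnatr_eq0.
Qed.

Let S n := [set w | N w = n%:R%:E].

Let mS n : measurable (S n).
Proof.
by have := mN measurableT (emeasurable_set1 n%:R%:E); rewrite setTI.
Qed.

Let tS : trivIset setT S.
Proof.
apply/trivIsetP => i j _ _ ij; rewrite -subset0 => w []; rewrite /S/= => -> [] /eqP.
by rewrite eqr_nat => /eqP e; move: ij; rewrite e eqxx.
Qed.

Let sum_p : (\sum_(n <oo) (p n)%:E = 1)%E.
Proof.
transitivity ((expR (- lam))%:E * (expR lam)%:E)%E; last first.
  by rewrite -EFinM expRN mulVf ?gt_eqF ?expR_gt0.
under eq_eseriesr do rewrite /p mulrC EFinM.
rewrite nneseriesZl/=; last first.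
  by move=> n _; rewrite lee_fin divr_ge0// exprn_ge0.
congr *%E; rewrite expRE -EFin_lim; last first.
  rewrite /pseries/=; under eq_fun do rewrite mulrC.
  exact: is_cvg_series_exp_coeff.
apply/congr_lim/funext => n/=; rewrite /pseries/= /series/= -sumEFin//.
by under eq_bigr do rewrite mulrC.
Qed.

Let shift (f : nat -> R) : (forall n, 0 <= f n) -> f 0%N = 0 ->
  (\sum_(n <oo) (f n)%:E = \sum_(n <oo) (f n.+1)%:E)%E.
Proof.
move=> f0 f00; rewrite nneseries_recl//; last by move=> k _; rewrite lee_fin.
rewrite f00 add0e -(@nneseries_addn _ (fun n => (f n)%:E))//.
  by apply: eq_eseriesr => n _; rewrite addn1.
Qed.

Let sum_np : (\sum_(n <oo) (n%:R * p n)%:E = lam%:E)%E.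
Proof.
rewrite (shift (f := fun n => n%:R * p n)) ?mul0r//; last by move=> n; rewrite mulr_ge0.
under eq_eseriesr do rewrite pS EFinM.
by rewrite nneseriesZl ?sum_p ?mule1// => n _; rewrite lee_fin.
Qed.

Let sum_n2p : (\sum_(n <oo) (n%:R ^+ 2 * p n)%:E = (lam ^+ 2 + lam)%:E)%E.
Proof.
rewrite (shift (f := fun n => n%:R ^+ 2 * p n)) ?expr0n ?mul0r//; last first.
  by move=> n; rewrite mulr_ge0 ?sqr_ge0.
transitivity (\sum_(n <oo) (lam%:E * (n%:R * p n)%:E + lam%:E * (p n)%:E))%E.
  apply: eq_eseriesr => n _; rewrite expr2 -mulrA pS -!EFinM -EFinD -natr1.
  by congr EFin; ring.
rewrite nneseriesD; last 2 first.
- by move=> i _ _; rewrite -EFinM lee_fin; apply: mulr_ge0 => //; apply: mulr_ge0.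
- by move=> i _ _; rewrite -EFinM lee_fin; apply: mulr_ge0 => //; apply: mulr_ge0.
rewrite !nneseriesZl ?sum_p ?sum_np ?mule1 -?EFinM//; last 2 first.
- by move=> i _; rewrite lee_fin.
- by move=> i _; rewrite lee_fin mulr_ge0.
Qed.

(** The Poisson weights already sum to 1, so the remaining values, +oo among them, have probability
    0 and [fine] loses nothing almost surely. *)
Let PS : P (~` \bigcup_n S n) = 0%E.
Proof.
rewrite probability_setC; last by apply: bigcup_measurable => n _; exact: mS.
rewrite measure_bigcup//= (_ : limn _ = 1%E) ?subee//.
rewrite -sum_p; apply: congr_lim; apply/funext => n.
by apply: eq_big => [i|i _]; [rewrite in_setT|exact: NE].
Qed.

Let poisson_law (phi : R -> R) : measurable_fun setT phi -> (forall x, 0 <= phi x) ->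
  (\int[P]_w (phi (fine (N w)))%:E = \sum_(n <oo) (phi n%:R * p n)%:E)%E.
Proof.
move=> mphi phi0.
have mf : measurable_fun setT (fun w => (phi (fine (N w)))%:E).
  by apply/measurable_EFinP; apply: measurableT_comp => //; exact: measurableT_comp.
have mUS : measurable (\bigcup_n S n) by apply: bigcup_measurable => n _; exact: mS.
rewrite (@ge0_negligible_integral _ _ _ _ setT (~` \bigcup_n S n))//; last 2 first.
- exact: measurableC.
- by move=> x _; rewrite lee_fin.
rewrite setTD setCK ge0_integral_bigcup//; last 2 first.
- exact: measurable_funTS.
- by move=> x _; rewrite lee_fin.
apply: eq_eseriesr => n _.
transitivity (\int[P]_(x in S n) cst (phi n%:R)%:E x)%E.
  by apply: eq_integral => w; rewrite inE => ->.
by rewrite integral_cst// EFinM; congr (_ * _)%E; exact: NE.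
Qed.

Lemma poisson_moments : [/\ L2 P (fine \o N), Ex P (fine \o N) = lam,
  Ex P (fun w => fine (N w) ^+ 2) = lam ^+ 2 + lam & {ae P, forall w, exists n : nat, N w = n%:R%:E}].
Proof.
have mf : measurable_fun setT (fine \o N) by exact: measurableT_comp.
have e2 : (\int[P]_w (fine (N w) ^+ 2)%:E = (lam ^+ 2 + lam)%:E)%E.
  rewrite (@poisson_law (fun x => x ^+ 2)) ?sum_n2p//; last by move=> x; exact: sqr_ge0.
have hL2 : L2 P (fine \o N).
  split=> //; apply: L1_ge0_lty; first exact: measurable_funX.
  - by move=> w; exact: sqr_ge0.
  - by rewrite e2 ltry.
have ae : {ae P, forall w, exists n : nat, N w = n%:R%:E}.
  exists (~` \bigcup_n S n); split => //.
  - by apply: measurableC; apply: bigcup_measurable => n _; exact: mS.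
  - by move=> w /= h [n _ Sn]; apply: h; exists n.
split => //; last by rewrite /Ex /Rintegral e2.
rewrite (@Ex_ae _ _ _ _ _ (fun w => `|fine (N w)|))//; last 2 first.
- exact: measurableT_comp.
- by apply: filterS ae => w [n] /= ->; rewrite ger0_norm.
rewrite /Ex /Rintegral (@poisson_law (fun x => `|x|))//.
by under eq_eseriesr do rewrite ger0_norm//; rewrite sum_np.
Qed.
End poisson.
End moments.

(** * Brackets of the driving noise *)

Section filtration.
Context (R : realType) (dT : measure_display) (T : measurableType dT)
  (P : probability T R) (F : R -> set (set T)).
Hypothesis FS : forall t : R, 0 <= t -> sigma_algebra setT (F t) /\ F t `<=` measurable.
Hypothesis Fle : forall s t : R, 0 <= s -> s <= t -> F s `<=` F t.
Implicit Types (f g xi eta : T -> R) (s t : R).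

(** Stated on the measurable type generated by [F t], so that the closure lemmas for measurable
    functions apply as they are; [FmP] gives back the meaning in terms of preimages. *)
Definition Fm (t : R) (f : T -> R) :=
  measurable_fun (setT : set (g_sigma_algebraType (F t)))
    (f : g_sigma_algebraType (F t) -> R).

Lemma FmP t f : 0 <= t ->
  Fm t f <-> forall A : set R, measurable A -> F t (f @^-1` A).
Proof.
move=> /FS[sF _]; split => [h A mA|h _ A mA].
  have := h measurableT A mA; rewrite setTI.
  by rewrite measurable_g_measurableTypeE.
by rewrite setTI measurable_g_measurableTypeE//; exact: h.
Qed.

Lemma Fm_meas t f : 0 <= t -> Fm t f -> measurable_fun setT f.
Proof.
move=> t0 /(FmP _ t0) h _ A mA; rewrite setTI.
by have [_] := FS t0; apply; exact: h.
Qed.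

Lemma Fm_le s t f : 0 <= s -> s <= t -> Fm s f -> Fm t f.
Proof.
move=> s0 st /(FmP _ s0) h; apply/FmP; first exact: le_trans st.
by move=> A mA; apply: (Fle s0 st); exact: h.
Qed.

Lemma FmM t f g : Fm t f -> Fm t g -> Fm t (fun w => f w * g w).
Proof. by move=> hf hg; exact: measurable_funM hf hg. Qed.

Lemma FmB t f g : Fm t f -> Fm t g -> Fm t (fun w => f w - g w).
Proof. by move=> hf hg; exact: measurable_funB hf hg. Qed.

Definition inc (X : R -> T -> R) (s t : R) (w : T) := X t w - X s w.

(** The martingale property without conditional expectations: an increment is orthogonal to every
    square integrable variable known at time s. *)
Definition mart (X : R -> T -> R) := forall s t, 0 <= s -> s <= t ->
  [/\ Fm t (inc X s t), L2 P (inc X s t) &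
      forall eta, Fm s eta -> L2 P eta ->
        Ex P (fun w => eta w * inc X s t w) = 0].

(** The predictable bracket of X and Y is c t: given the past of s, the product of the increments
    has mean c (t - s). *)
Definition bracket (X Y : R -> T -> R) (c : R) := forall s t xi,
  0 <= s -> s <= t -> Fm s xi -> bdd xi ->
  Ex P (fun w => xi w * (inc X s t w * inc Y s t w)) = c * (t - s) * Ex P xi.

Lemma bracketC X Y c : bracket X Y c -> bracket Y X c.
Proof.
move=> h s t xi s0 st mx bx; rewrite -h//; congr Ex; apply/funext => w.
by rewrite [inc Y _ _ _ * _]mulrC.
Qed.

Definition overlap (s t s' t' : R) : R :=
  Num.max 0 (Num.min t t' - Num.max s s').

Lemma overlapC s t s' t' : overlap s t s' t' = overlap s' t' s t.
Proof. by rewrite /overlap minC (maxC s). Qed.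

Lemma incD (X : R -> T -> R) s u t w : inc X s t w = inc X s u w + inc X u t w.
Proof. by rewrite /inc; ring. Qed.

(** Cut both increments at the end points of the common interval. A piece outside it is either
    entirely earlier than the other increment or entirely later, and the later factor is orthogonal
    to all the rest; on the common interval the bracket gives the value. *)
Let pair_le (X Y : R -> T -> R) (c : R) s t s' t' xi xi' :
  mart X -> mart Y -> bracket X Y c ->
  0 <= s -> s <= t -> s <= s' -> s' <= t' ->
  Fm s xi -> bdd xi -> Fm s' xi' -> bdd xi' ->
  Ex P (fun w => (xi w * inc X s t w) * (xi' w * inc Y s' t' w)) =
  c * overlap s t s' t' * Ex P (fun w => xi w * xi' w).
Proof.
move=> mX mY bXY s0 st ss' st' mx bx mx' bx'.
have s'0 : 0 <= s' by exact: le_trans ss'.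
have t0 : 0 <= t by exact: le_trans st.
have t'0 : 0 <= t' by exact: le_trans st'.
have mx1 : Fm s' xi by exact: Fm_le ss' mx.
have [ts'|s't] := leP t s'.
  have [_ _ hY] := mY s' t' s'0 st'.
  have [fX lX _] := mX s t s0 st.
  rewrite (_ : overlap _ _ _ _ = 0); last first.
    rewrite /overlap; apply/max_idPl.
    by rewrite (max_idPr ss') subr_le0 (le_trans _ ts')// ge_min lexx.
  rewrite mulr0 mul0r -(hY (fun w => xi w * (xi' w * inc X s t w))).
  - by congr Ex; apply/funext => w; ring.
  - by apply: FmM => //; apply: FmM => //; exact: Fm_le ts' fX.
  - apply: bdd_L2M => //; first exact: Fm_meas mx.
    by apply: bdd_L2M => //; exact: Fm_meas mx'.
have {s't} s't := ltW s't.
have [_ lXs' _] := mX s s' s0 ss'.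
have [fXs' _ _] := mX s s' s0 ss'.
have [fXt lXt _] := mX s' t s'0 s't.
have [fY lY hY] := mY s' t' s'0 st'.
have L2xi f : L2 P f -> L2 P (fun w => xi w * (xi' w * f w)).
  move=> hf; apply: bdd_L2M => //; first exact: Fm_meas mx.
  by apply: bdd_L2M => //; exact: Fm_meas mx'.
transitivity (Ex P (fun w => xi w * (xi' w * inc X s s' w) * inc Y s' t' w) +
              Ex P (fun w => xi w * (xi' w * inc X s' t w) * inc Y s' t' w)).
  rewrite -ExD; last 2 first.
  - by apply: L2_mul => //; exact: L2xi.
  - by apply: L2_mul => //; exact: L2xi.
  by congr Ex; apply/funext => w; rewrite (incD X s s' t); ring.
rewrite hY ?add0r; last 2 first.
- by apply: FmM => //; apply: FmM.
- exact: L2xi.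
have mxx : Fm s' (fun w => xi w * xi' w) by exact: FmM.
have bxx : bdd (fun w => xi w * xi' w) by exact: bddM.
have [tt'|t't] := leP t t'.
  have [_ lYt hYt] := mY t t' t0 tt'.
  have [_ lYs _] := mY s' t s'0 s't.
  transitivity (Ex P (fun w => xi w * (xi' w * inc X s' t w) * inc Y s' t w) +
              Ex P (fun w => xi w * (xi' w * inc X s' t w) * inc Y t t' w)).
    rewrite -ExD; last 2 first.
    - by apply: L2_mul => //; exact: L2xi.
    - by apply: L2_mul => //; exact: L2xi.
    by congr Ex; apply/funext => w; rewrite (incD Y s' t t'); ring.
  rewrite hYt ?addr0; last 2 first.
  - by apply: FmM; [exact: Fm_le mx1|apply: FmM => //; exact: Fm_le mx'].
  - exact: L2xi.
  rewrite (_ : overlap _ _ _ _ = t - s'); last first.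
    by rewrite /overlap (max_idPr ss') (min_idPl tt'); apply/max_idPr; rewrite subr_ge0.
  rewrite -(bXY s' t _ s'0 s't mxx bxx).
  by congr Ex; apply/funext => w; ring.
have {}t't := ltW t't.
have [_ lXt' hXt] := mX t' t t'0 t't.
have [_ lXs _] := mX s' t' s'0 st'.
transitivity (Ex P (fun w => xi w * (xi' w * inc X s' t' w) * inc Y s' t' w) +
            Ex P (fun w => xi w * (xi' w * inc Y s' t' w) * inc X t' t w)).
  rewrite -ExD; last 2 first.
  - by apply: L2_mul => //; exact: L2xi.
  - by apply: L2_mul => //; exact: L2xi.
  by congr Ex; apply/funext => w; rewrite (incD X s' t' t); ring.
rewrite hXt ?addr0; last 2 first.
- by apply: FmM; [exact: Fm_le mx1|apply: FmM => //; exact: Fm_le mx'].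
- exact: L2xi.
rewrite (_ : overlap _ _ _ _ = t' - s'); last first.
  by rewrite /overlap (max_idPr ss') (min_idPr t't); apply/max_idPr; rewrite subr_ge0.
rewrite -(bXY s' t' _ s'0 st' mxx bxx).
by congr Ex; apply/funext => w; ring.
Qed.

Lemma Ex_pair (X Y : R -> T -> R) (c : R) s t s' t' xi xi' :
  mart X -> mart Y -> bracket X Y c ->
  0 <= s -> s <= t -> 0 <= s' -> s' <= t' ->
  Fm s xi -> bdd xi -> Fm s' xi' -> bdd xi' ->
  Ex P (fun w => (xi w * inc X s t w) * (xi' w * inc Y s' t' w)) =
  c * overlap s t s' t' * Ex P (fun w => xi w * xi' w).
Proof.
move=> mX mY b s0 st s'0 st' mx bx mx' bx'.
have [ss'|s's] := leP s s'; first exact: pair_le.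
rewrite overlapC (_ : (fun w => xi w * xi' w) = (fun w => xi' w * xi w)); last first.
  by apply/funext => w; rewrite mulrC.
rewrite -(pair_le mY mX (bracketC b) s'0 st' (ltW s's) st mx' bx' mx bx).
by congr Ex; apply/funext => w; rewrite mulrC.
Qed.

(** Expand the square: zeta is known before every interval begins, so its cross terms vanish, and
    [Ex_pair] evaluates the others. The finite index type with arbitrary bracket constants lets
    Brownian coordinates and Poisson counts enter one and the same sum. *)
Lemma elementary_isometry (I : finType) (X : I -> R -> T -> R) (c : I -> I -> R)
  (s0 : R) (s t : I -> R) (xi : I -> T -> R) (zeta : T -> R) :
  0 <= s0 -> (forall i, mart (X i)) -> (forall i j, bracket (X i) (X j) (c i j)) ->
  (forall i, s0 <= s i /\ s i <= t i) ->
  (forall i, Fm (s i) (xi i) /\ bdd (xi i)) -> Fm s0 zeta -> L2 P zeta ->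
  L2 P (fun w => zeta w + \sum_i xi i w * inc (X i) (s i) (t i) w) /\
  Ex P (fun w => (zeta w + \sum_i xi i w * inc (X i) (s i) (t i) w) ^+ 2) =
  Ex P (fun w => zeta w ^+ 2) +
  Ex P (fun w => \sum_i \sum_j c i j * overlap (s i) (t i) (s j) (t j) * (xi i w * xi j w)).
Proof.
move=> s00 mX bX hst hxi mz lz.
have si0 i : 0 <= s i by case: (hst i) => h _; exact: le_trans h.
have mxi i : measurable_fun setT (xi i).
  by case: (hxi i) => h _; exact: Fm_meas h.
have lt i : L2 P (fun w => xi i w * inc (X i) (s i) (t i) w).
  apply: bdd_L2M => //; first by case: (hxi i).
  by have [] := mX i (s i) (t i) (si0 i) (hst i).2.
have lS : L2 P (fun w => \sum_i xi i w * inc (X i) (s i) (t i) w).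
  by apply: L2_sum => i _; exact: lt.
split; first exact: L2D.
have lxx i j : L1 P (fun w => xi i w * xi j w).
  by have [_ bi] := hxi i; have [_ bj] := hxi j; apply: L2_mul; apply: bdd_L2.
transitivity (Ex P (fun w => zeta w ^+ 2) +
  2 * Ex P (fun w => \sum_i zeta w * (xi i w * inc (X i) (s i) (t i) w)) +
  Ex P (fun w => \sum_i \sum_j (xi i w * inc (X i) (s i) (t i) w) * (xi j w * inc (X j) (s j) (t j) w))).
  rewrite -ExZ; last by apply: L1_sum => i _; exact: L2_mul.
  rewrite -!ExD.
  - congr Ex; apply/funext => w; rewrite -big_distrlr -mulr_sumr/=.
    by move: (\sum_i _) => z; ring.
  - apply: L1D; first by case: lz.
    by apply: L1Z; apply: L1_sum => i _; exact: L2_mul.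
  - by apply: L1_sum => i _; apply: L1_sum => j _; exact: L2_mul.
  - by case: lz.
  - by apply: L1Z; apply: L1_sum => i _; exact: L2_mul.
rewrite [X in 2 * X]Ex_sum; last by move=> i _; exact: L2_mul.
rewrite big1 ?mulr0 ?addr0; last first.
  move=> i _; have [h1 h2] := hst i.
  have [_ _ h] := mX i (s i) (t i) (si0 i) h2.
  rewrite -(h (fun w => zeta w * xi i w)).
  - by congr Ex; apply/funext => w; rewrite mulrA.
  - by apply: FmM; [exact: Fm_le mz|case: (hxi i)].
  - rewrite (_ : (fun w => _) = (fun w => xi i w * zeta w)); last by apply/funext => w; rewrite mulrC.
    by apply: bdd_L2M => //; case: (hxi i).
congr (_ + _).
rewrite !Ex_sum; last 2 first.
- by move=> i _; apply: L1_sum => j _; apply: L1Z.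
- by move=> i _; apply: L1_sum => j _; exact: L2_mul.
apply: eq_bigr => i _; rewrite !Ex_sum; last 2 first.
- by move=> j _; apply: L1Z.
- by move=> j _; exact: L2_mul.
apply: eq_bigr => j _; rewrite ExZ//.
have [_ hi] := hst i; have [_ hj] := hst j.
by have [mi bi] := hxi i; have [mj bj] := hxi j; apply: Ex_pair.
Qed.

End filtration.

Section sub_sigma_algebra.
Context (R : realType) (dT : measure_display) (T : measurableType dT)
  (P : probability T R).
Implicit Types (G H : set (set T)) (f g : T -> R).

(** Besides the [F t], this serves the sigma-algebras generated by the noise, with respect to which
    independence is stated. *)
Definition Gm G f := forall A : set R, measurable A -> G (f @^-1` A).

Lemma GmE G f : sigma_algebra setT G ->
  Gm G f <-> measurable_fun (setT : set (g_sigma_algebraType G))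
    (f : g_sigma_algebraType G -> R).
Proof.
move=> sG; split => [h _ A mA|h A mA].
  by rewrite setTI measurable_g_measurableTypeE//; exact: h.
by have := h measurableT A mA; rewrite setTI measurable_g_measurableTypeE.
Qed.

Lemma GmB G f g : sigma_algebra setT G -> Gm G f -> Gm G g ->
  Gm G (fun w => f w - g w).
Proof.
move=> sG /(GmE _ sG) hf /(GmE _ sG) hg; apply/(GmE _ sG).
exact: measurable_funB hf hg.
Qed.

Lemma GmM G f g : sigma_algebra setT G -> Gm G f -> Gm G g ->
  Gm G (fun w => f w * g w).
Proof.
move=> sG /(GmE _ sG) hf /(GmE _ sG) hg; apply/(GmE _ sG).
exact: measurable_funM hf hg.
Qed.

Lemma Gm_indep G H f g : indep_classes P G H -> Gm G f -> Gm H g ->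
  indep_rv P f g.
Proof. by move=> GH hf hg A B mA mB; apply: GH; [exact: hf|exact: hg]. Qed.

Lemma measurable_wrt_comp G m n (f : T -> 'M[R]_(m, n)) (phi : 'M[R]_(m, n) -> R) :
  sigma_algebra setT G -> (forall O, open O -> G (f @^-1` O)) ->
  continuous phi -> Gm G (fun w => phi (f w)).
Proof.
move=> sG hf cphi; apply/(GmE _ sG).
apply: (measurability (@RGenOInfty.G R)) => [|_ [_ [x ->] <-]].
  exact: RGenOInfty.measurableE.
rewrite setTI measurable_g_measurableTypeE//.
rewrite (_ : _ @^-1` _ = f @^-1` (phi @^-1` `]x, +oo[)) //.
by apply: hf; apply: open_comp => // z _; exact: cphi.
Qed.

Lemma measurable_wrt_coord G m n (f : T -> 'M[R]_(m, n)) i j :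
  sigma_algebra setT G -> (forall O, open O -> G (f @^-1` O)) ->
  Gm G (fun w => f w i j).
Proof.
move=> sG hf; apply: (measurable_wrt_comp (phi := fun M : 'M[R]_(m, n) => M i j)) => //.
exact: coord_continuous.
Qed.

Lemma indep_prod0 f g : indep_rv P f g -> L2 P f -> L2 P g -> Ex P g = 0 ->
  Ex P (fun w => f w * g w) = 0.
Proof.
by move=> i hf hg g0; have [_ ->] := Ex_indep i (L2_L1 hf) (L2_L1 hg); rewrite g0 mulr0.
Qed.

End sub_sigma_algebra.

(** * Martingale property and brackets of the Brownian coordinates *)

Section brownian.
Context (R : realType) (d : nat) (dT : measure_display) (T : measurableType dT)
  (P : probability T R) (F : R -> set (set T)) (W : R -> T -> 'cV[R]_d).
Hypothesis FS : forall t : R, 0 <= t -> sigma_algebra setT (F t) /\ F t `<=` measurable.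
Hypothesis Fle : forall s t : R, 0 <= s -> s <= t -> F s `<=` F t.
Hypothesis BW : standard_brownian_motion P F W.

Definition Wc (j : 'I_d) (t : R) (w : T) : R := W t w j 0.

Lemma Fm_Wc j t : 0 <= t -> Fm F t (Wc j t).
Proof.
move=> t0; have [sF _] := FS t0; apply/(FmP FS _ t0) => A mA.
by have [+ _ _ _] := BW => /(_ t t0) h; exact: (measurable_wrt_coord _ _ sF h).
Qed.

Lemma Fm_incW j s t : 0 <= s -> s <= t -> Fm F t (inc (Wc j) s t).
Proof.
move=> s0 st; have t0 := le_trans s0 st; apply: FmB; first exact: Fm_Wc.
by apply: (Fm_le FS Fle s0 st); exact: Fm_Wc.
Qed.

Let meas_incW j s t : 0 <= s -> s <= t -> measurable_fun setT (inc (Wc j) s t).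
Proof. by move=> s0 st; apply: (Fm_meas FS (le_trans s0 st)); exact: Fm_incW. Qed.

Let Gst s t : set (set T) := <<s [set A | exists2 O : set 'cV[R]_d, open O &
                        A = [set w | O (W t w - W s w)]] >>.

Let GmW j s t : Gm (Gst s t) (inc (Wc j) s t).
Proof.
have h : forall O, open O -> Gst s t ((fun w => W t w - W s w) @^-1` O).
  by move=> O oO; apply: sub_sigma_algebra; exists O.
have := measurable_wrt_coord j 0 (@smallest_sigma_algebra _ setT _) h.
by congr Gm; apply/funext => w; rewrite /inc /Wc !mxE.
Qed.

Let lawW j s t : 0 <= s -> s < t -> forall B, measurable B ->
  P (inc (Wc j) s t @^-1` B) = normal_prob 0 (Num.sqrt (t - s)) B.
Proof.
move=> s0 st B mB; have [_ _ _ h] := BW.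
(* The other coordinates are left free, so their factors in the product law equal 1. *)
have := h s t s0 st (fun i => if i == j then B else setT).
rewrite (bigD1 j)//= eqxx big1 ?mule1; last first.
  by move=> i /negPf ->; exact: probability_setT.
move=> <-; last by move=> i; case: ifP.
congr (P _); apply/seteqP; split => w /=.
  by move=> hw i; case: eqP => // ->; rewrite !mxE.
by move=> /(_ j); rewrite eqxx !mxE.
Qed.

Let indepW j k s t : 0 <= s -> s < t -> j != k ->
  indep_rv P (inc (Wc j) s t) (inc (Wc k) s t).
Proof.
move=> s0 st jk A B mA mB; rewrite !lawW//; have [_ _ _ h] := BW.
have := h s t s0 st (fun i => if i == j then A else if i == k then B else setT).
rewrite (bigD1 j)//= eqxx (bigD1 k)/=; last by rewrite eq_sym.
rewrite [k == j]eq_sym (negPf jk) eqxx big1 ?mule1; last first.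
  by move=> i /andP[/negPf -> /negPf ->]; exact: probability_setT.
move=> <-; last by move=> i; case: ifP => // _; case: ifP.
congr (P _); apply/seteqP; split => w /=.
  move=> [hA hB] i; rewrite !mxE; case: eqP => [->//|_].
  by case: eqP => [->//|].
move=> hw; have := hw j; have := hw k; rewrite !mxE eqxx [k == j]eq_sym (negPf jk) eqxx.
by [].
Qed.

Let momW j s t : 0 <= s -> s <= t ->
  [/\ L2 P (inc (Wc j) s t), Ex P (inc (Wc j) s t) = 0 &
      Ex P (fun w => inc (Wc j) s t w ^+ 2) = t - s].
Proof.
move=> s0; rewrite le_eqVlt => /predU1P[<-|st].
  rewrite (_ : inc _ _ _ = (fun=> 0)); last by apply/funext => w; rewrite /inc subrr.
  by rewrite subrr expr0n Ex_cst; split => //; exact: L2_cst.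
have ts : 0 < Num.sqrt (t - s) by rewrite sqrtr_gt0 subr_gt0.
have [h1 h2 h3] := normal_moments ts (meas_incW j s0 (ltW st)) (lawW j s0 st).
by split => //; rewrite h3 sqr_sqrtr// subr_ge0 ltW.
Qed.

Lemma mart_W j : mart P F (Wc j).
Proof.
move=> s t s0 st; have [h1 h2 h3] := momW j s0 st.
split => //; first exact: Fm_incW.
move=> eta me le; move: st; rewrite le_eqVlt => /predU1P[est|st].
  rewrite -est -[RHS](Ex_cst P); congr Ex; apply/funext => w.
  by rewrite /inc subrr mulr0.
apply: indep_prod0 => //.
have [_ _ h _] := BW; apply: (Gm_indep (h s t s0 st)); last exact: GmW.
exact/(FmP FS).
Qed.

Lemma bracket_W j k : bracket P F (Wc j) (Wc k) (j == k)%:R.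
Proof.
move=> s t xi s0 st mx bx.
have mx' := Fm_meas FS s0 mx.
have [lj ej vj] := momW j s0 st.
have [lk ek vk] := momW k s0 st.
move: (st); rewrite le_eqVlt => /predU1P[est|st'].
  rewrite est subrr mulr0 mul0r -[RHS](Ex_cst P); congr Ex; apply/funext => w.
  by rewrite /inc !subrr; ring.
have [_ _ h _] := BW.
have i : indep_rv P xi (fun w => inc (Wc j) s t w * inc (Wc k) s t w).
  apply: (Gm_indep (h s t s0 st')); first exact/(FmP FS).
  by apply: GmM; [exact: smallest_sigma_algebra|exact: GmW|exact: GmW].
have [_ ->] := Ex_indep i (bdd_L1 _ mx' bx) (L2_mul lj lk).
rewrite mulrC; congr (_ * _); have [<-|jk] := eqVneq j k.
  by rewrite mul1r -vj; congr Ex; apply/funext => w; rewrite expr2.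
by rewrite mul0r indep_prod0//; exact: indepW.
Qed.

Lemma brownian_Gm j s t : 0 <= s -> 0 <= t -> Gm (brownian_sigma W) (inc (Wc j) s t).
Proof.
move=> s0 t0; have sB := @smallest_sigma_algebra _ setT
  [set A | exists t, exists2 O : set 'cV[R]_d, 0 <= t /\ open O & A = W t @^-1` O].
apply: GmB => //.
  by apply: measurable_wrt_coord => // O oO; apply: sub_sigma_algebra; exists t, O.
by apply: measurable_wrt_coord => // O oO; apply: sub_sigma_algebra; exists s, O.
Qed.

End brownian.

(** * Compensated counts of the Poisson point process *)

Section counting.
Context (R : realType).

Lemma countingU (A B : set R) : [disjoint A & B] ->
  (counting (A `|` B) = counting A + counting B :> \bar R)%E.
Proof.
move=> AB; rewrite /counting.
case: (pselect (finite_set A)) => fA; last first.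
  have fU : ~ finite_set (A `|` B) by apply: contra_not fA; apply: sub_finite_set.
  by rewrite (asboolF fA) (asboolF fU) addye//; case: asboolP.
case: (pselect (finite_set B)) => fB; last first.
  have fU : ~ finite_set (A `|` B) by apply: contra_not fB; apply: sub_finite_set.
  by rewrite (asboolF fB) (asboolF fU) addey//; case: asboolP.
rewrite !asboolT// ?finite_setU// fset_setU// -EFinD -natrD; congr (_%:R%:E).
rewrite finmap.cardfsU (_ : finmap.fsetI _ _ = finmap.fset0) ?finmap.cardfs0 ?subn0//.
apply/finmap.fsetP => x; rewrite finmap.in_fsetI !in_fset_set// finmap.in_fset0.
apply/negP => /andP[/set_mem xA /set_mem xB].
by move/disj_setPS: AB => /(_ x (conj xA xB)).
Qed.

Lemma counting_nat (A : set R) :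
  (exists n : nat, counting A = n%:R%:E :> \bar R) \/ counting A = +oo%E :> \bar R.
Proof. by rewrite /counting; case: ifPn => _; [left; eexists|right]. Qed.

End counting.

Section poisson.
Context (R : realType) (dT : measure_display) (T : measurableType dT)
  (P : probability T R) (F : R -> set (set T))
  (dU : measure_display) (U : measurableType dU)
  (nu : {sigma_finite_measure set U -> \bar R}) (p : T -> R -> option U).
Hypothesis FS : forall t : R, 0 <= t -> sigma_algebra setT (F t) /\ F t `<=` measurable.
Hypothesis Fle : forall s t : R, 0 <= s -> s <= t -> F s `<=` F t.
Hypothesis pp : poisson_point_process P F nu p.

Let pc w (E : set (measurableTypeR R * U)) : \bar R := point_count p w E.

Lemma point_countU w E E' : [disjoint E & E'] ->
  (pc w (E `|` E') = pc w E + pc w E')%E.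
Proof.
move=> EE'; rewrite /pc /point_count -countingU.
  congr counting; apply/seteqP; split => s /=.
    by move=> [u ps [Eu|Eu]]; [left|right]; exists u.
  by move=> [[u ps Eu]|[u ps Eu]]; exists u => //; [left|right].
apply/disj_setPS => s [[u ps Eu] [u' ps' Eu']].
move: ps'; rewrite ps => -[uu']; rewrite -uu' in Eu'.
by move/disj_setPS: EE' => /(_ _ (conj Eu Eu')).
Qed.

(** The generators of [point_sigma] fix a count to a single value. This suffices because a count
    takes countably many values, so every preimage is a countable union of generators. *)
Lemma Gm_fine_point_count D E : measurable E -> E `<=` D `*` setT ->
  Gm (point_sigma p D) (fun w => fine (pc w E)).
Proof.
move=> mE ED A mA.
have h x : point_sigma p D [set w | pc w E = x].
  by apply: sub_sigma_algebra; exists E, x.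
have [s0 sC sU] := @smallest_sigma_algebra _ setT
   [set A | exists E : set (measurableTypeR R * U), exists2 x,
                measurable E /\ E `<=` D `*` setT &
                A = [set w | point_count p w E = x]].
(* Index 0 stands for the infinite count, which [fine] sends to 0; index n + 1 stands for the count
   n. *)
rewrite (_ : _ @^-1` _ = \bigcup_n
   (if n is n'.+1 then (if n'%:R \in A then [set w | pc w E = n'%:R%:E] else set0)
    else if 0 \in A then [set w | pc w E = +oo%E] else set0)).
  by apply: sU => -[|n]; case: ifP => _; [exact: h|exact: s0|exact: h|exact: s0].
apply/seteqP; split => w /=.
  have [[n e]|e] := counting_nat [set s | exists2 u, p w s = Some u & E (s, u)].
    rewrite /pc /point_count e /= => An; exists n.+1 => //.
    by rewrite mem_set.
  by rewrite /pc /point_count e /= => A0; exists 0%N => //; rewrite mem_set.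
move=> [[|n] _] /=; case: ifPn => // /set_mem Ax; first by move=> ->.
by move=> ->.
Qed.

Let strip (s t : R) (B : set U) : set (measurableTypeR R * U) := `]s, t]%classic `*` B.

Let mstrip s t B : measurable B -> measurable (strip s t B).
Proof. by move=> mB; apply: measurableX => //; exact: measurable_itv. Qed.

Definition okB (B : set U) := measurable B /\ (nu B < +oo)%E.

Definition cc s t B := compensated_count nu p s t B.

Let lam s t (B : set U) : R := (t - s) * fine (nu B).

Let intensityE s t B : s <= t -> okB B ->
  ((@lebesgue_measure R \x nu)%E (strip s t B) = (lam s t B)%:E)%E.
Proof.
move=> st [mB fB]; rewrite product_measure1E//.
have e : (lebesgue_measure (`]s, t]%classic : set R) = (t - s)%:E)%E.
  rewrite lebesgue_measure_itv/= lte_fin; case: ltP => ts; first by rewrite EFinB.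
  by rewrite (_ : t = s) ?subrr//; apply/eqP; rewrite eq_le ts st.
rewrite [X in (X * _)%E]e /lam EFinM fineK//.
by rewrite ge0_fin_numE.
Qed.

Let strip_dom s t B : 0 <= s -> strip s t B `<=` `[0, +oo[%classic `*` setT.
Proof.
move=> s0 [x u] [/=]; rewrite !in_itv/= andbT => /andP[sx _] _; split => //.
by rewrite (le_trans s0)// ltW.
Qed.

Lemma count_moments s t B : 0 <= s -> s <= t -> okB B ->
  [/\ L2 P (fun w => fine (pc w (strip s t B))),
      Ex P (fun w => fine (pc w (strip s t B))) = lam s t B,
      Ex P (fun w => fine (pc w (strip s t B)) ^+ 2) = lam s t B ^+ 2 + lam s t B &
      {ae P, forall w, pc w (strip s t B) \is a fin_num}].
Proof.
move=> s0 st oB; have [mB fB] := oB.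
have [_ _ [mpc law _ _] _ _] := pp.
have l0 : 0 <= lam s t B by rewrite mulr_ge0 ?subr_ge0// fine_ge0.
have dom := @strip_dom s t B s0.
have ms := mstrip s t mB.
have [h1 h2 h3 h4] := poisson_moments l0 (mpc _ ms dom)
  (law _ _ ms dom (intensityE st oB)).
by split => //; apply: filterS h4 => w [n e]; rewrite /pc e.
Qed.

Lemma cc_moments s t B : 0 <= s -> s <= t -> okB B ->
  [/\ L2 P (cc s t B), Ex P (cc s t B) = 0 &
      Ex P (fun w => cc s t B w ^+ 2) = lam s t B].
Proof.
move=> s0 st oB; have [h1 h2 h3 _] := count_moments s0 st oB.
split.
- by apply: L2B => //; exact: L2_cst.
- rewrite ExB ?Ex_cst ?h2 ?subrr//; first exact: L2_L1.
  exact: L1_cst.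
- transitivity (Ex P (fun w => fine (pc w (strip s t B)) ^+ 2 +
     ((- 2 * lam s t B) * fine (pc w (strip s t B)) + lam s t B ^+ 2))).
    by congr Ex; apply/funext => w; rewrite /cc /compensated_count -/(lam _ _ _); ring.
  rewrite ExD; [|by case: h1|apply: L1D; [apply: L1Z; exact: L2_L1|exact: L1_cst]].
  rewrite ExD; [|by apply: L1Z; exact: L2_L1|exact: L1_cst].
  by rewrite ExZ ?h2 ?h3 ?Ex_cst; [ring|exact: L2_L1].
Qed.

Lemma Gm_cc D s t B : measurable B -> `]s, t]%classic `<=` D ->
  Gm (point_sigma p D) (cc s t B).
Proof.
move=> mB sD; have sP := @smallest_sigma_algebra _ setT
   [set A | exists E : set (measurableTypeR R * U), exists2 x,
                measurable E /\ E `<=` D `*` setT &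
                A = [set w | point_count p w E = x]].
apply: GmB => //.
  by apply: Gm_fine_point_count; [exact: mstrip|move=> [x u] [/= /sD]].
apply/(GmE _ sP); exact: measurable_cst.
Qed.

Lemma cc_meas s t B : 0 <= s -> s <= t -> okB B -> measurable_fun setT (cc s t B).
Proof. by move=> s0 st oB; have [[]] := cc_moments s0 st oB. Qed.

(** Counts are additive everywhere, their real values only almost surely: [fine] respects sums of
    finite terms, and finiteness of the two counts holds off a null set. *)
Let disj_ae s t B s' t' B' : 0 <= s -> s <= t -> okB B -> 0 <= s' -> s' <= t' -> okB B' ->
  [disjoint strip s t B & strip s' t' B'] ->
  {ae P, forall w, fine (pc w (strip s t B `|` strip s' t' B')) =
     fine (pc w (strip s t B)) + fine (pc w (strip s' t' B'))}.
Proof.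
move=> s0 st oB s'0 st' oB' dj.
have [_ _ _ f1] := count_moments s0 st oB.
have [_ _ _ f2] := count_moments s'0 st' oB'.
by apply: filterS2 f1 f2 => w h1 h2; rewrite point_countU// fineD.
Qed.

Lemma cc_time s u t B : 0 <= s -> s <= u -> u <= t -> okB B ->
  {ae P, forall w, cc s t B w = cc s u B w + cc u t B w}.
Proof.
move=> s0 su ut oB.
have u0 := le_trans s0 su.
have dj : [disjoint strip s u B & strip u t B].
  apply/disj_setPS => -[x y] [[/= + _] [/= + _]].
  by rewrite !in_itv/= => /andP[_ xu] /andP[ux _]; move: (lt_le_trans ux xu); rewrite ltxx.
have := disj_ae s0 su oB u0 ut oB dj.
apply: filterS => w; rewrite (_ : _ `|` _ = strip s t B).
  by rewrite /cc /compensated_count -!/(strip _ _ _) -!/(pc _ _) => ->; ring.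
apply/seteqP; split => -[x y]; rewrite /strip /= !in_itv/=.
  move=> [[/andP[a b] c]|[/andP[a b] c]]; split => //.
    by rewrite a (le_trans b).
  by rewrite b (le_lt_trans su).
move=> [/andP[a b] c]; have [xu|ux] := leP x u; [left|right]; split => //.
  by rewrite a.
Qed.

Lemma cc_mark s t B B' : 0 <= s -> s <= t -> okB B -> okB B' -> [disjoint B & B'] ->
  {ae P, forall w, cc s t (B `|` B') w = cc s t B w + cc s t B' w}.
Proof.
move=> s0 st oB oB' dj.
have dj' : [disjoint strip s t B & strip s t B'].
  apply/disj_setPS => -[x y] [[/= _ h] [/= _ h']].
  by move/disj_setPS: dj => /(_ y (conj h h')).
have := disj_ae s0 st oB s0 st oB' dj'.
apply: filterS => w; rewrite (_ : _ `|` _ = strip s t (B `|` B')); last first.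
  apply/seteqP; split => -[x y] /=.
    by move=> [[a b]|[a b]]; split => //=; [left|right].
  by move=> [a [b|b]]; [left|right]; split.
rewrite /cc /compensated_count -!/(strip _ _ _) -!/(pc _ _) => ->.
rewrite measureU//; [|by case: oB|by case: oB'|exact/disj_set2P].
have f1 : nu B \is a fin_num by rewrite ge0_fin_numE//; case: oB.
have f2 : nu B' \is a fin_num by rewrite ge0_fin_numE//; case: oB'.
by rewrite fineD//; ring.
Qed.

Let okB_sub B B' : okB B -> measurable B' -> B' `<=` B -> okB B'.
Proof.
move=> [mB fB] mB' BB; split => //; apply: le_lt_trans fB.
by apply: le_measure; rewrite ?inE.
Qed.

(** Polarization: the counts of B, of B' and of their union are all Poisson, so the variance of the
    union is the sum of the two variances and nothing is left for the covariance. *)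
Let cc_disj s t B B' : 0 <= s -> s <= t -> okB B -> okB B' -> [disjoint B & B'] ->
  Ex P (fun w => cc s t B w * cc s t B' w) = 0.
Proof.
move=> s0 st oB oB' dj.
have oU : okB (B `|` B').
  split; first by apply: measurableU; [case: oB|case: oB'].
  rewrite measureU//; [|by case: oB|by case: oB'|exact/disj_set2P].
  by rewrite lte_add_pinfty//; [case: oB|case: oB'].
have [l1 _ v1] := cc_moments s0 st oB.
have [l2 _ v2] := cc_moments s0 st oB'.
have [lU _ vU] := cc_moments s0 st oU.
have e : Ex P (fun w => cc s t (B `|` B') w ^+ 2) =
   Ex P (fun w => (cc s t B w ^+ 2 + cc s t B' w ^+ 2) + 2 * (cc s t B w * cc s t B' w)).
  apply: Ex_ae.
  - by case: lU => ? ?; apply: measurable_funX.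
  - apply: (@L1_meas _ _ _ P); apply: L1D; last by apply: L1Z; exact: L2_mul.
    by apply: L1D; [case: l1|case: l2].
  - by apply: filterS (cc_mark s0 st oB oB' dj) => w ->; ring.
move: e; rewrite vU ExD; last 2 first.
- by apply: L1D; [case: l1|case: l2].
- by apply: L1Z; exact: L2_mul.
rewrite ExD; [|by case: l1|by case: l2].
rewrite v1 v2 ExZ; last exact: L2_mul.
rewrite /lam measureU//; [|by case: oB|by case: oB'|exact/disj_set2P].
rewrite fineD; [| |]; last 2 first.
- by rewrite ge0_fin_numE//; case: oB.
- by rewrite ge0_fin_numE//; case: oB'.
by rewrite mulrDr => /eqP; rewrite -subr_eq0 => /eqP; lra.
Qed.

(** Split B and B' along their intersection. The three pieces are disjoint, hence uncorrelated, and
    only the square of the common piece survives. *)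
Lemma cc_cov s t B B' : 0 <= s -> s <= t -> okB B -> okB B' ->
  Ex P (fun w => cc s t B w * cc s t B' w) = lam s t (B `&` B').
Proof.
move=> s0 st oB oB'; have [mB _] := oB; have [mB' _] := oB'.
have oI : okB (B `&` B') by apply: (okB_sub oB); [exact: measurableI|exact: subIsetl].
have oD : okB (B `\` B') by apply: (okB_sub oB); [exact: measurableD|exact: subDsetl].
have oE : okB (B' `\` B) by apply: (okB_sub oB'); [exact: measurableD|exact: subDsetl].
have d1 : [disjoint B `&` B' & B `\` B'].
  by apply/disj_setPS => x [[_ h] [_ h']].
have d2 : [disjoint B `&` B' & B' `\` B].
  by apply/disj_setPS => x [[h _] [_ h']].
have d3 : [disjoint B `\` B' & B' `\` B].
  by apply/disj_setPS => x [[h _] [_ h']].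
have [lI _ vI] := cc_moments s0 st oI.
have [lD _ _] := cc_moments s0 st oD.
have [lE _ _] := cc_moments s0 st oE.
transitivity (Ex P (fun w => (cc s t (B `&` B') w ^+ 2 + cc s t (B `&` B') w * cc s t (B' `\` B) w)
   + (cc s t (B `&` B') w * cc s t (B `\` B') w + cc s t (B `\` B') w * cc s t (B' `\` B) w))).
  apply: Ex_ae.
  - by apply: measurable_funM; exact: cc_meas.
  - apply: (@L1_meas _ _ _ P); apply: L1D; apply: L1D; by [exact: L2_mul|case: lI].
  - have h1 := cc_mark s0 st oI oD d1; have h2 := cc_mark s0 st oI oE d2.
    rewrite (_ : _ `|` _ = B) in h1; last by rewrite setUIDK.
    rewrite (_ : _ `|` _ = B') in h2; last by rewrite setIC setUIDK.
    by apply: filterS2 h1 h2 => w -> ->; ring.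
rewrite ExD; last 2 first.
- by apply: L1D; [case: lI|exact: L2_mul].
- by apply: L1D; exact: L2_mul.
rewrite ExD; [|by case: lI|exact: L2_mul].
rewrite ExD; [|exact: L2_mul|exact: L2_mul].
by rewrite (cc_disj s0 st oI oE d2) (cc_disj s0 st oI oD d1) (cc_disj s0 st oD oE d3) vI !addr0.
Qed.

Definition Nc (B : set U) (t : R) (w : T) : R := cc 0 t B w.

Lemma Fm_Nc B t : okB B -> 0 <= t -> Fm F t (Nc B t).
Proof.
move=> oB t0; apply/(FmP FS _ t0) => A mA.
have [_ _ _ pF _] := pp; apply: (pF t t0); apply: Gm_cc => //; first by case: oB.
by move=> x; rewrite /= !in_itv/= => /andP[/ltW -> ->].
Qed.

(** [cc] is what the point process controls after time s, [inc] what the martingale calculus uses;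
    they may differ where a count is infinite. *)
Lemma inc_Nc B s t : 0 <= s -> s <= t -> okB B ->
  {ae P, forall w, inc (Nc B) s t w = cc s t B w}.
Proof.
move=> s0 st oB; apply: filterS (cc_time (lexx 0) s0 st oB) => w.
by rewrite /inc /Nc => ->; rewrite addrC addKr.
Qed.

Lemma Fm_incN B s t : 0 <= s -> s <= t -> okB B -> Fm F t (inc (Nc B) s t).
Proof.
move=> s0 st oB; have t0 := le_trans s0 st; apply: FmB; first exact: Fm_Nc.
by apply: (Fm_le FS Fle s0 st); exact: Fm_Nc.
Qed.

Lemma L2_incN B s t : 0 <= s -> s <= t -> okB B -> L2 P (inc (Nc B) s t).
Proof.
move=> s0 st oB; have [h _ _] := cc_moments s0 st oB.
apply: (L2_ae h).
  by apply: (Fm_meas FS (le_trans s0 st)); exact: Fm_incN.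
by apply: filterS (inc_Nc s0 st oB) => w.
Qed.

Let indepN s eta f : 0 <= s -> Fm F s eta -> Gm (point_sigma p `]s, +oo[) f ->
  indep_rv P eta f.
Proof.
move=> s0 me mf; have [_ _ _ _ h] := pp.
by apply: (Gm_indep (h s s0)) => //; exact/(FmP FS).
Qed.

Let sub_itv (s t : R) : `]s, t]%classic `<=` `]s, +oo[%classic.
Proof. by move=> x; rewrite /= !in_itv/= andbT => /andP[]. Qed.

Lemma mart_N B : okB B -> mart P F (Nc B).
Proof.
move=> oB s t s0 st.
have li := L2_incN s0 st oB.
split => //; first exact: Fm_incN.
move=> eta me le.
have [h1 h2 h3] := cc_moments s0 st oB.
rewrite (@Ex_ae _ _ _ _ _ (fun w => eta w * cc s t B w)).
- apply: indep_prod0 => //; apply: (indepN s0 me).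
  by apply: Gm_cc; [case: oB|exact: sub_itv].
- by apply: measurable_funM; [case: le|case: li].
- by apply: measurable_funM; [case: le|case: h1].
- by apply: filterS (inc_Nc s0 st oB) => w ->.
Qed.

Lemma bracket_N B B' : okB B -> okB B' ->
  bracket P F (Nc B) (Nc B') (fine (nu (B `&` B'))).
Proof.
move=> oB oB' s t xi s0 st mx bx; have mx' := Fm_meas FS s0 mx.
have [h1 _ _] := cc_moments s0 st oB.
have [h2 _ _] := cc_moments s0 st oB'.
rewrite (@Ex_ae _ _ _ _ _ (fun w => xi w * (cc s t B w * cc s t B' w))).
- have i : indep_rv P xi (fun w => cc s t B w * cc s t B' w).
    apply: (indepN s0 mx); apply: GmM; first exact: smallest_sigma_algebra.
      by apply: Gm_cc; [case: oB|exact: sub_itv].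
    by apply: Gm_cc; [case: oB'|exact: sub_itv].
  have [_ ->] := Ex_indep i (bdd_L1 _ mx' bx) (L2_mul h1 h2).
  by rewrite cc_cov// /lam; ring.
- by apply: measurable_funM => //; apply: measurable_funM; [case: (L2_incN s0 st oB)|case: (L2_incN s0 st oB')].
- by apply: measurable_funM => //; apply: measurable_funM; [case: h1|case: h2].
- by apply: filterS2 (inc_Nc s0 st oB) (inc_Nc s0 st oB') => w -> ->.
Qed.

End poisson.

(** * Vanishing bracket between the Brownian motion and the counts *)

Section cross.
Context (R : realType) (d : nat) (dT : measure_display) (T : measurableType dT)
  (P : probability T R) (F : R -> set (set T)) (W : R -> T -> 'cV[R]_d)
  (dU : measure_display) (U : measurableType dU)
  (nu : {sigma_finite_measure set U -> \bar R}) (p : T -> R -> option U).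
Hypothesis FS : forall t : R, 0 <= t -> sigma_algebra setT (F t) /\ F t `<=` measurable.
Hypothesis Fle : forall s t : R, 0 <= s -> s <= t -> F s `<=` F t.
Hypothesis BW : standard_brownian_motion P F W.
Hypothesis pp : poisson_point_process P F nu p.
Hypothesis WN : indep_classes P (brownian_sigma W) (point_sigma p `[0, +oo[).

(* The sum of the products of the increments over the m-th part of ]s, t] has
   second moment O(1/m), because W and p are independent. *)
Lemma bracket_WN j B : okB nu B -> bracket P F (Wc W j) (Nc nu p B) 0.
Proof.
move=> oB s t xi s0 st mx bx; have mx' := Fm_meas FS s0 mx.
set X := Wc W j; set Y := Nc nu p B.
have mX : mart P F X by apply: mart_W.
have mY : mart P F Y by apply: mart_N.
have bX : bracket P F X X 1.
  rewrite (_ : 1 = (j == j)%:R); first by apply: bracket_W.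
  by rewrite eqxx.
have bY : bracket P F Y Y (fine (nu B)).
  by rewrite -[X in nu X]setIid; apply: bracket_N.
(* Independence of W and p factors the fourth-order moments, so that off-diagonal terms in E S^2
   vanish through the Brownian factor alone. *)
have XY s1 t1 s2 t2 s3 t3 s4 t4 :
  0 <= s1 -> s1 <= t1 -> 0 <= s2 -> s2 <= t2 -> 0 <= s3 -> s3 <= t3 -> 0 <= s4 -> s4 <= t4 ->
  L1 P (fun w => (inc X s1 t1 w * inc X s2 t2 w) * (inc Y s3 t3 w * inc Y s4 t4 w)) /\
  Ex P (fun w => (inc X s1 t1 w * inc X s2 t2 w) * (inc Y s3 t3 w * inc Y s4 t4 w)) =
  Ex P (fun w => inc X s1 t1 w * inc X s2 t2 w) * Ex P (fun w => inc Y s3 t3 w * inc Y s4 t4 w).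
  move=> a1 b1 a2 b2 a3 b3 a4 b4; apply: Ex_indep.
  - apply: (Gm_indep WN).
      by apply: GmM; [exact: smallest_sigma_algebra| |]; apply: brownian_Gm => //; exact: le_trans b1 || exact: le_trans b2.
    have gN r : 0 <= r -> Gm (point_sigma p `[0, +oo[) (Y r).
      move=> r0; apply: Gm_cc; first by case: oB.
      by move=> x; rewrite /= !in_itv/= andbT => /andP[/ltW].
    by apply: GmM; [exact: smallest_sigma_algebra| |]; (apply: GmB; [exact: smallest_sigma_algebra| |]); apply: gN => //;
      exact: le_trans b3 || exact: le_trans b4.
  - by apply: L2_mul; [have [] := mX s1 t1 a1 b1|have [] := mX s2 t2 a2 b2].
  - by apply: L2_mul; [have [] := mY s3 t3 a3 b3|have [] := mY s4 t4 a4 b4].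
set psi := Ex P _; rewrite !mul0r.
pose A := Ex P (fun w => xi w ^+ 2).
pose V := fine (nu B) * (t - s) ^+ 2.
have V0 : 0 <= V by rewrite mulr_ge0 ?sqr_ge0// fine_ge0.
(* This is E (xi - th S)^2 >= 0, where S is the sum of the diagonal products over m cells, with E
   (xi S) = psi and E S^2 = V / m. *)
have key (m : nat) (th : R) : (0 < m)%N -> 2 * th * psi <= A + th ^+ 2 * (V / m%:R).
  move=> m0; have m0' : 0 < m%:R :> R by rewrite ltr0n.
  pose h := (t - s) / m%:R.
  have h0 : 0 <= h by rewrite divr_ge0 ?subr_ge0.
  pose r (i : nat) := s + i%:R * h.
  have r0 i : 0 <= r i by rewrite addr_ge0// mulr_ge0.
  have rle i k : (i <= k)%N -> r i <= r k by move=> ik; rewrite lerD2l ler_wpM2r// ler_nat.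
  have rS i : r i <= r i.+1 by exact: rle.
  have rd i : r i.+1 - r i = h by rewrite /r -natr1; ring.
  have rm : r m = t by rewrite /r mulrC divfK ?lt0r_neq0// subrKC.
  have r00 : r 0%N = s by rewrite /r mul0r addr0.
  have tel (Z : R -> T -> R) w : inc Z s t w = \sum_(i < m) inc Z (r i) (r i.+1) w.
    rewrite -(big_mkord xpredT (fun i => Z (r i.+1) w - Z (r i) w)).
    by rewrite (telescope_sumr (fun i => Z (r i) w))// rm r00.
  pose S w := \sum_(i < m) inc X (r i) (r i.+1) w * inc Y (r i) (r i.+1) w.
  have lX i : L2 P (inc X (r i) (r i.+1)) by have [] := mX _ _ (r0 i) (rS i).
  have lY i : L2 P (inc Y (r i) (r i.+1)) by have [] := mY _ _ (r0 i) (rS i).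
  have fX i : Fm F (r i.+1) (inc X (r i) (r i.+1)) by have [] := mX _ _ (r0 i) (rS i).
  have fY i : Fm F (r i.+1) (inc Y (r i) (r i.+1)) by have [] := mY _ _ (r0 i) (rS i).
  have sr i : s <= r i by rewrite lerDl mulr_ge0.
  have fxi i : Fm F (r i) xi by apply: (Fm_le FS Fle s0 (sr i)).
  have exXX i k : Ex P (fun w => inc X (r i) (r i.+1) w * inc X (r k) (r k.+1) w) =
      (i == k)%:R * h.
    wlog ik : i k / (i <= k)%N => [hw|].
      have [ik|ik] := leqP i k; first exact: hw.
      by rewrite eq_sym -hw ?(ltnW ik)//; congr Ex; apply/funext => w; rewrite mulrC.
    have [<-|nik] := eqVneq i k.
      have := bX (r i) (r i.+1) (fun=> 1) (r0 i) (rS i).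
      rewrite Ex_cst rd !mul1r mulr1 => <-; last by exists 1 => w; rewrite normr1.
        by congr Ex; apply/funext => w; rewrite mul1r.
      exact: measurable_cst.
    have [_ _ z] := mX _ _ (r0 k) (rS k).
    rewrite mul0r z//; apply: (Fm_le FS Fle (r0 i.+1) _ (fX i)); apply: rle.
    by rewrite ltn_neqAle nik.
  have exYY i : Ex P (fun w => inc Y (r i) (r i.+1) w * inc Y (r i) (r i.+1) w) = fine (nu B) * h.
    have := bY (r i) (r i.+1) (fun=> 1) (r0 i) (rS i).
    rewrite Ex_cst rd mulr1 => <-; last by exists 1 => w; rewrite normr1.
      by congr Ex; apply/funext => w; rewrite mul1r.
    exact: measurable_cst.
  have SE w : S w ^+ 2 = \sum_(i < m) \sum_(k < m)
     (inc X (r i) (r i.+1) w * inc X (r k) (r k.+1) w) *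
     (inc Y (r i) (r i.+1) w * inc Y (r k) (r k.+1) w).
    rewrite expr2 /S big_distrlr/=; apply: eq_bigr => i _; apply: eq_bigr => k _; ring.
  have lXY i k := XY _ _ _ _ _ _ _ _ (r0 i) (rS i) (r0 k) (rS k) (r0 i) (rS i) (r0 k) (rS k).
  have lS : L2 P S.
    split.
      by apply: measurable_sum => i; apply: measurable_funM; [case: (lX i)|case: (lY i)].
    rewrite (funext SE); apply: L1_sum => i _; apply: L1_sum => k _.
    by case: (lXY i k).
  have exS : Ex P (fun w => S w ^+ 2) = V / m%:R.
    rewrite (funext SE) Ex_sum; last first.
      by move=> i _; apply: L1_sum => k _; case: (lXY i k).
    rewrite (eq_bigr (fun=> fine (nu B) * h ^+ 2)).
      rewrite sumr_const card_ord -mulr_natr /V /h; field.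
      exact: lt0r_neq0.
    move=> i _; rewrite Ex_sum; last by move=> k _; case: (lXY i k).
    rewrite (bigD1 i)//= big1 ?addr0.
      by have [_ ->] := lXY i i; rewrite exXX exYY eqxx mul1r; ring.
    move=> k; rewrite eq_sym => ik; have [_ ->] := lXY i k.
    by rewrite exXX -[(i : nat) == k]/(i == k) (negPf ik) !mul0r.
  (* On different cells, the later increment is orthogonal to xi times the earlier one, whichever of
     the two processes comes last. *)
  have off i k : i != k -> Ex P (fun w => xi w * inc X (r i) (r i.+1) w * inc Y (r k) (r k.+1) w) = 0.
    move=> nik; have [ik|ki] := ltnP i k.
      have [_ _ z] := mY _ _ (r0 k) (rS k); rewrite z//.
        apply: FmM => //; apply: (Fm_le FS Fle (r0 i.+1) _ (fX i)); exact: rle.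
      exact: bdd_L2M.
    have {}ki : (k < i)%N by rewrite ltn_neqAle eq_sym nik.
    have [_ _ z] := mX _ _ (r0 i) (rS i).
    rewrite -(z (fun w => xi w * inc Y (r k) (r k.+1) w)).
    - by congr Ex; apply/funext => w; ring.
    - by apply: FmM => //; apply: (Fm_le FS Fle (r0 k.+1) _ (fY k)); exact: rle.
    - exact: bdd_L2M.
  have l3 i k : L1 P (fun w => xi w * inc X (r i) (r i.+1) w * inc Y (r k) (r k.+1) w).
    by apply: L2_mul => //; exact: bdd_L2M.
  have psiE : psi = Ex P (fun w => xi w * S w).
    transitivity (Ex P (fun w => \sum_(i < m) \sum_(k < m)
        xi w * inc X (r i) (r i.+1) w * inc Y (r k) (r k.+1) w)).
      congr Ex; apply/funext => w; rewrite (tel X) (tel Y) big_distrlr mulr_sumr/=.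
      by apply: eq_bigr => i _; rewrite mulr_sumr; apply: eq_bigr => k _; rewrite mulrA.
    rewrite Ex_sum; last by move=> i _; apply: L1_sum => k _.
    rewrite (_ : (fun w => xi w * S w) = fun w => \sum_(i < m) xi w * inc X (r i) (r i.+1) w * inc Y (r i) (r i.+1) w); last first.
      by apply/funext => w; rewrite mulr_sumr; apply: eq_bigr => i _; rewrite mulrA.
    rewrite Ex_sum//; apply: eq_bigr => i _; rewrite Ex_sum// (bigD1 i)//= big1 ?addr0//.
    by move=> k ki; apply: off; rewrite eq_sym.
  have lxi : L2 P xi by exact: bdd_L2.
  have : 0 <= Ex P (fun w => (xi w - th * S w) ^+ 2) by apply: Ex_ge0 => w; exact: sqr_ge0.
  rewrite (_ : (fun w => _) = fun w => xi w ^+ 2 + ((- 2 * th) * (xi w * S w) + th ^+ 2 * S w ^+ 2)); last first.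
    by apply/funext => w; ring.
  have i1 : L1 P (fun w => xi w * S w) by exact: L2_mul.
  have i2 : L1 P (fun w => S w ^+ 2) by case: lS.
  have i3 : L1 P (fun w => xi w ^+ 2) by case: lxi.
  rewrite ExD//; last by apply: L1D; exact: L1Z.
  rewrite ExD; [|exact: L1Z|exact: L1Z].
  rewrite ExZ// ExZ// exS -psiE -/A; lra.
have A0 : 0 <= A by apply: Ex_ge0 => w; exact: sqr_ge0.
apply/eqP/negPn/negP => psi0.
(* With this th the left side of [key] becomes 2 (A + 1), and m is large enough for the last term on
   the right to be less than 1, which contradicts A >= 0. *)
pose th := (A + 1) / psi.
pose m := Num.bound (th ^+ 2 * V).
have mlt : th ^+ 2 * V < m.+1%:R.
  have h : 0 <= th ^+ 2 * V by rewrite mulr_ge0 ?sqr_ge0.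
  by apply: lt_trans (archi_boundP h) _; rewrite ltr_nat.
have := key m.+1 th isT.
have -> : 2 * th * psi = 2 * (A + 1) by rewrite /th; field.
have : th ^+ 2 * (V / m.+1%:R) < 1 by rewrite mulrA ltr_pdivrMr// mul1r.
have fin (a z : R) : 0 <= a -> z < 1 -> 2 * (a + 1) <= a + z -> False by lra.
exact: fin A0.
Qed.

End cross.

(** * Isometry for elementary integrands *)

Section frobenius.
Context (R : realType).

Lemma frob_sqr m n (A : 'M[R]_(m, n)) : frob A ^+ 2 = \sum_i \sum_j A i j ^+ 2.
Proof.
have e : \tr (A *m A^T) = \sum_i \sum_j A i j ^+ 2.
  apply: eq_bigr => i _; rewrite mxE; apply: eq_bigr => j _.
  by rewrite mxE expr2.
rewrite /frob sqr_sqrtr e//; apply: sumr_ge0 => i _; apply: sumr_ge0 => j _.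
exact: sqr_ge0.
Qed.

Lemma frob_ge0 m n (A : 'M[R]_(m, n)) : 0 <= frob A.
Proof. exact: sqrtr_ge0. Qed.

Lemma frob_sqr_col n (x : 'cV[R]_n) : frob x ^+ 2 = \sum_i x i 0 ^+ 2.
Proof. by rewrite frob_sqr; apply: eq_bigr => i _; rewrite big_ord1. Qed.

Lemma frob_coord m n (A : 'M[R]_(m, n)) i j : `|A i j| <= frob A.
Proof.
rewrite -(@ler_pXn2r _ 2) ?nnegrE ?frob_ge0// real_normK ?num_real// frob_sqr.
rewrite (bigD1 i)//= (bigD1 j)//= -addrA lerDl addr_ge0// sumr_ge0// => k _.
  exact: sqr_ge0.
by apply: sumr_ge0 => l _; exact: sqr_ge0.
Qed.

End frobenius.

Section quadratic_integrals.
Context (R : realType) (dS : measure_display) (S : measurableType dS)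
  (mu : {measure set S -> \bar R}).

(** Squares of elementary integrands are quadratic forms in indicators; this one formula integrates
    them both in time and over the marks. *)
Lemma integral_indic_quad (I : finType) (D : set S) (A : I -> set S) (c : I -> I -> R) :
  measurable D -> (forall i, measurable (A i)) -> (forall i, (mu (D `&` A i) < +oo)%E) ->
  (\int[mu]_(x in D) (\sum_i \sum_j c i j * (\1_(A i) x * \1_(A j) x))%:E =
   (\sum_i \sum_j c i j * fine (mu (D `&` (A i `&` A j))))%:E)%E.
Proof.
move=> mD mA fA.
have fAA i j : (mu (D `&` (A i `&` A j)) < +oo)%E.
  apply: le_lt_trans (fA i); apply: le_measure; rewrite ?inE.
  - by apply: measurableI => //; exact: measurableI.
  - exact: measurableI.
  - by apply: setIS; exact: subIsetl.
have ii i j : mu.-integrable D (fun x => (\1_(A i `&` A j) x)%:E).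
  apply/integrableP; split.
    by apply/measurable_EFinP; apply: measurable_funTS; apply: measurable_indic; exact: measurableI.
  under eq_integral do rewrite /= ger0_norm//.
  rewrite integral_indic//; last exact: measurableI.
  by rewrite setIC.
have iic i j : mu.-integrable D (fun x => (c i j * (\1_(A i) x * \1_(A j) x))%:E).
  have := integrableZl mD (c i j) (ii i j); congr integrable.
  by apply/funext => x; rewrite /= -EFinM indicI.
have isum (r : seq I) (i : I) :
    mu.-integrable D (fun x => (\sum_(j <- r) c i j * (\1_(A i) x * \1_(A j) x))%:E).
  under eq_fun do rewrite -sumEFin; apply: (@integrable_sum _ _ _ mu D mD).
  by move=> j _; exact: iic.
transitivity (\int[mu]_(x in D) (\sum_i (\sum_j c i j * (\1_(A i) x * \1_(A j) x))%:E))%E.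
  by apply: eq_integral => x _; rewrite sumEFin.
rewrite integral_sum//.
rewrite -sumEFin; apply: eq_bigr => i _.
transitivity (\int[mu]_(x in D) (\sum_j (c i j * (\1_(A i) x * \1_(A j) x))%:E))%E.
  by apply: eq_integral => x _; rewrite sumEFin.
rewrite integral_sum//.
rewrite -sumEFin; apply: eq_bigr => j _.
under eq_integral do rewrite EFinM.
rewrite integralZl//; last first.
  by have := ii i j; congr integrable; apply/funext => x; rewrite indicI.
rewrite EFinM; congr (_ * _)%E.
rewrite (eq_integral (fun x => (\1_(A i `&` A j) x)%:E)); last by move=> x _; rewrite indicI.
rewrite integral_indic//; last exact: measurableI.
rewrite [X in mu X]setIC.
by rewrite fineK// ge0_fin_numE.
Qed.

End quadratic_integrals.

Lemma exchange_big4 (V : nmodType) (I J K L : finType) (f : I -> J -> K -> L -> V) :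
  \sum_i \sum_j \sum_k \sum_l f i j k l = \sum_k \sum_l \sum_i \sum_j f i j k l.
Proof.
under eq_bigr do rewrite exchange_big/=.
rewrite exchange_big/=; apply: eq_bigr => k _.
under eq_bigr do rewrite exchange_big/=.
by rewrite exchange_big.
Qed.

Section elementary.
Context (R : realType).
Notation lam := (@lebesgue_measure R).
Implicit Types s t : R.

(** For s <= t, the projection onto [s, t]. What an integrand carried by ]a, b] contributes between
    the times s and t is its contribution over ]clip a, clip b]. *)
Definition clip s t x : R := Num.max s (Num.min x t).

Lemma clip_le s t x y : x <= y -> clip s t x <= clip s t y.
Proof.
by move=> xy; rewrite /clip ge_max !le_max lexx/= [X in _ || X]le_min !ge_min xy lexx !orbT.
Qed.

Lemma clip_ge s t x : s <= clip s t x.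
Proof. by rewrite /clip le_max lexx. Qed.

Lemma clip_outside s t x y : s <= t -> t < x -> x <= y -> clip s t x = clip s t y.
Proof.
move=> st tx xy; rewrite /clip (min_idPr (ltW tx)) (min_idPr _)//.
exact: le_trans (ltW tx) xy.
Qed.

Lemma clip_id s t x : x <= t -> x <= clip s t x.
Proof. by move=> xt; rewrite /clip (min_idPl xt) le_max lexx orbT. Qed.

Lemma clip_min s t x y : clip s t (Num.min x y) = Num.min (clip s t x) (clip s t y).
Proof.
have [xy|/ltW yx] := leP x y; apply/esym; first by apply/min_idPl; exact: clip_le.
by apply/min_idPr; exact: clip_le.
Qed.

Lemma clip_max s t x y : clip s t (Num.max x y) = Num.max (clip s t x) (clip s t y).
Proof.
have [xy|/ltW yx] := leP x y; apply/esym; first by apply/max_idPr; exact: clip_le.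
by apply/max_idPl; exact: clip_le.
Qed.

Lemma lebesgue_overlap s t a b a' b' : s <= t ->
  fine (lam (`]s, t]%classic `&` (`]a, b]%classic `&` `]a', b']%classic))) =
  overlap (clip s t a) (clip s t b) (clip s t a') (clip s t b').
Proof.
move=> st.
rewrite (_ : _ `&` _ = `]Num.max s (Num.max a a'), Num.min t (Num.min b b')]%classic); last first.
  apply/seteqP; split => x /=; rewrite !in_itv/= !gt_max !le_min.
    by move=> [/andP[-> ->] [/andP[-> ->] /andP[-> ->]]].
  by move=> /andP[/and3P[-> -> ->] /and3P[-> -> ->]].
rewrite lebesgue_measure_itv/= lte_fin /overlap /clip.
(* Clipping is monotone, hence commutes with min and max, and only the single interval ]A, B]
   remains to be compared with [s, t]. *)
rewrite -clip_min -clip_max; move: (Num.min b b') (Num.max a a') => B A.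
rewrite /clip; case: (ltP (Num.max s A)) => h/=.
  apply/esym; move: h; rewrite gt_max !lt_min => /andP[/andP[s_t sB] /andP[At AB]].
  have e : Num.max s (Num.min B t) = Num.min t B.
    by rewrite minC; apply/max_idPr; rewrite le_min st ltW.
  rewrite (min_idPl (ltW At)) e; apply/max_idPr.
  by rewrite subr_ge0 ge_max !le_min st (ltW sB) (ltW AB) (ltW At).
apply/esym/max_idPl; rewrite subr_le0; move: h; rewrite ge_min !le_max => /orP[/orP[ts|tA]|/orP[Bs|BA]].
- have -> : t = s by apply/eqP; rewrite eq_le ts st.
  by rewrite ge_max lexx/= ge_min lexx orbT.
- by rewrite (min_idPr tA); apply/orP; right; rewrite ge_max st ge_min lexx orbT.
- by apply/orP; left; rewrite ge_max lexx ge_min Bs.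
- by rewrite -le_max; exact: clip_le.
Qed.

(** Written with the overlaps of the clipped intervals because this is the form in which
    [elementary_isometry] delivers the second moment. *)
Lemma frob_int_W (I : finType) m n (s t : R) (a b : I -> R) (x : I -> 'M[R]_(m, n)) :
  s <= t ->
  (\int[lam]_(r in `]s, t]) (frob (\sum_k (a k < r <= b k)%R%:R *: x k) ^+ 2)%:E =
   (\sum_i \sum_j \sum_k \sum_l (overlap (clip s t (a k)) (clip s t (b k)) (clip s t (a l)) (clip s t (b l)) *
      (x k i j * x l i j)))%:E)%E.
Proof.
move=> st; pose A k : set (measurableTypeR R) := `]a k, b k]%classic.
have mI (k : I) : measurable (A k) by exact: measurable_itv.
have E1 r : frob (\sum_k (a k < r <= b k)%R%:R *: x k) ^+ 2 =
    \sum_k \sum_l (\sum_i \sum_j x k i j * x l i j) * (\1_(A k) r * \1_(A l) r).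
  have ind k : (\1_(A k) r : R) = (a k < r <= b k)%R%:R.
    by rewrite indicE /A mem_setE in_itv.
  rewrite frob_sqr.
  transitivity (\sum_i \sum_j \sum_k \sum_l (x k i j * x l i j) * (\1_(A k) r * \1_(A l) r)).
    apply: eq_bigr => i _; apply: eq_bigr => j _.
    rewrite summxE expr2 big_distrlr/=; apply: eq_bigr => k _; apply: eq_bigr => l _.
    by rewrite !ind !mxE; ring.
  under eq_bigr do rewrite exchange_big/=.
  rewrite exchange_big/=; apply: eq_bigr => k _.
  under eq_bigr do rewrite exchange_big/=.
  rewrite exchange_big/=; apply: eq_bigr => l _.
  by rewrite mulr_suml; apply: eq_bigr => i _; rewrite mulr_suml.
under eq_integral do rewrite E1.
rewrite integral_indic_quad//; last first.
  move=> k; apply: (@le_lt_trans _ _ (lam (`]s, t]%classic : set (measurableTypeR R)))).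
    by apply: le_measure; rewrite ?inE; [apply: measurableI => //| |]; exact: measurable_itv || exact: subIsetl.
  by rewrite lebesgue_measure_itv/=; case: ifP => _; rewrite ?ltry// -EFinB ltry.
congr EFin; under eq_bigr do under eq_bigr do rewrite lebesgue_overlap//.
rewrite [RHS](exchange_big4); apply: eq_bigr => k _; apply: eq_bigr => l _.
by rewrite mulr_suml; apply: eq_bigr => i _; rewrite mulr_suml; apply: eq_bigr => j _; rewrite mulrC.
Qed.

Lemma frob_int_N (dU : measure_display) (U : measurableType dU)
    (nu : {measure set U -> \bar R}) (I : finType) n (s t : R) (a b : I -> R)
    (B : I -> set U) (x : I -> 'cV[R]_n) :
  s <= t -> (forall k, measurable (B k)) -> (forall k, (nu (B k) < +oo)%E) ->
  (\int[lam]_(r in `]s, t]) \int[nu]_u (frob (\sum_k ((a k < r <= b k)%R%:R * \1_(B k) u) *: x k) ^+ 2)%:E =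
   (\sum_i \sum_k \sum_l (fine (nu (B k `&` B l)) *
      overlap (clip s t (a k)) (clip s t (b k)) (clip s t (a l)) (clip s t (b l)) *
      (x k i 0 * x l i 0)))%:E)%E.
Proof.
move=> st mB fB; pose A k : set (measurableTypeR R) := `]a k, b k]%classic.
have mI (k : I) : measurable (A k) by exact: measurable_itv.
have ind k r : (\1_(A k) r : R) = (a k < r <= b k)%R%:R.
  by rewrite indicE /A mem_setE in_itv.
have E1 r u : frob (\sum_k ((a k < r <= b k)%R%:R * \1_(B k) u) *: x k) ^+ 2 =
    \sum_k \sum_l ((\sum_i x k i 0 * x l i 0) * (\1_(A k) r * \1_(A l) r)) * (\1_(B k) u * \1_(B l) u).
  rewrite frob_sqr_col.
  transitivity (\sum_i \sum_k \sum_l (x k i 0 * x l i 0) * (\1_(A k) r * \1_(A l) r) * (\1_(B k) u * \1_(B l) u)).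
    apply: eq_bigr => i _.
    rewrite summxE expr2 big_distrlr/=; apply: eq_bigr => k _; apply: eq_bigr => l _.
    by rewrite !ind !mxE; ring.
  rewrite exchange_big/=; apply: eq_bigr => k _.
  rewrite exchange_big/=; apply: eq_bigr => l _.
  by rewrite !mulr_suml.
transitivity (\int[lam]_(r in `]s, t]) (\sum_k \sum_l ((\sum_i x k i 0 * x l i 0) * fine (nu (B k `&` B l))) *
    (\1_(A k) r * \1_(A l) r))%:E)%E.
  apply: eq_integral => r _; under eq_integral do rewrite E1.
  rewrite integral_indic_quad//; last by move=> k; rewrite setTI.
  congr EFin; apply: eq_bigr => k _; apply: eq_bigr => l _; rewrite setTI; ring.
rewrite integral_indic_quad//; last first.
  move=> k; apply: (@le_lt_trans _ _ (lam (`]s, t]%classic : set (measurableTypeR R)))).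
    by apply: le_measure; rewrite ?inE; [apply: measurableI => //| |]; exact: measurable_itv || exact: subIsetl.
  by rewrite lebesgue_measure_itv/=; case: ifP => _; rewrite ?ltry// -EFinB ltry.
congr EFin; under eq_bigr do under eq_bigr do rewrite lebesgue_overlap//.
apply/esym; rewrite exchange_big/=; apply: eq_bigr => k _.
rewrite exchange_big/=; apply: eq_bigr => l _.
by rewrite !mulr_suml; apply: eq_bigr => i _; ring.
Qed.

End elementary.

Section isometry.
Context (R : realType) (d : nat) (dT : measure_display) (T : measurableType dT)
  (P : probability T R) (F : R -> set (set T)) (W : R -> T -> 'cV[R]_d)
  (dU : measure_display) (U : measurableType dU)
  (nu : {sigma_finite_measure set U -> \bar R}) (p : T -> R -> option U).
Hypothesis FS : forall t : R, 0 <= t -> sigma_algebra setT (F t) /\ F t `<=` measurable.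
Hypothesis Fle : forall s t : R, 0 <= s -> s <= t -> F s `<=` F t.
Hypothesis BW : standard_brownian_motion P F W.
Hypothesis pp : poisson_point_process P F nu p.
Hypothesis WN : indep_classes P (brownian_sigma W) (point_sigma p `[0, +oo[).
Notation lam := (@lebesgue_measure R).

Lemma overlap_degenerate (x y z : R) : overlap x x y z = 0.
Proof.
apply/max_idPl; rewrite subr_le0; apply: (@le_trans _ _ x).
  by rewrite ge_min lexx.
by rewrite le_max lexx.
Qed.

Lemma inc_clip (X : R -> T -> R) (s t a b : R) w : s <= t ->
  (X (Num.min b t) w - X (Num.min a t) w) - (X (Num.min b s) w - X (Num.min a s) w) =
  inc X (clip s t a) (clip s t b) w.
Proof.
move=> st.
have h x : X (Num.min x t) w - X (Num.min x s) w = X (clip s t x) w - X s w.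
  rewrite /clip; have [xs|/ltW sx] := leP x s.
    by rewrite (min_idPl (le_trans xs st)) (max_idPl xs) !subrr.
  by rewrite (max_idPr _)// le_min sx st.
by rewrite /inc; have := h a; have := h b; lra.
Qed.

Section fixed.
Variables (hW : elemW R d T) (hN : elemN R d T U).
Hypotheses (okW : elemW_ok F hW) (okN : elemN_ok F nu hN).

Let eW k := nth (0, 0, fun=> 0) hW k.
Let eN k := nth (0, 0, set0, fun=> 0) hN k.
Let IW := 'I_(size hW).
Let IN := 'I_(size hN).
(** One index for each Brownian triple and coordinate of W, one for each Poisson tuple: a component
    of the total integral is then a single sum of scalar coefficients times scalar increments. *)
Let I : finType := ((IW * 'I_d) + IN)%type.

Let okW' (k : IW) : [/\ 0 <= (eW k).1.1, (eW k).1.1 <= (eW k).1.2,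
   measurable_wrt (F (eW k).1.1) (eW k).2 & bounded_rv (eW k).2].
Proof. by have := okW (ltn_ord k); rewrite /eW; case: nth => -[a b] x. Qed.

Let okN' (k : IN) : [/\ 0 <= (eN k).1.1.1 <= (eN k).1.1.2, measurable (eN k).1.2,
   (nu (eN k).1.2 < +oo)%E, measurable_wrt (F (eN k).1.1.1) (eN k).2 & bounded_rv (eN k).2].
Proof. by have := okN (ltn_ord k); rewrite /eN; case: nth => -[[a b] B] x. Qed.

Let X (z : I) : R -> T -> R :=
  match z with inl kj => Wc W kj.2 | inr k => Nc nu p (eN k).1.2 end.
Let a (z : I) : R := match z with inl kj => (eW kj.1).1.1 | inr k => (eN k).1.1.1 end.
Let b (z : I) : R := match z with inl kj => (eW kj.1).1.2 | inr k => (eN k).1.1.2 end.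
Let x (i : 'I_d) (z : I) (w : T) : R :=
  match z with inl kj => (eW kj.1).2 w i kj.2 | inr k => (eN k).2 w i 0 end.
Let c (z z' : I) : R := match z, z' with
  | inl kj, inl lj => (kj.2 == lj.2)%:R
  | inr k, inr l => fine (nu ((eN k).1.2 `&` (eN l).1.2))
  | _, _ => 0 end.

Let okBN k : okB nu (eN (k : IN)).1.2.
Proof. by case: (okN' k). Qed.

Let mX z : mart P F (X z).
Proof.
by case: z => [[k j]|k]; [apply: mart_W|apply: mart_N => //; exact: okBN].
Qed.

Let bX z z' : bracket P F (X z) (X z') (c z z').
Proof.
case: z => [[k j]|k]; case: z' => [[l j']|l] /=.
- by apply: bracket_W.
- by apply: bracket_WN => //; exact: okBN.
- by apply: bracketC; apply: bracket_WN => //; exact: okBN.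
- by apply: bracket_N => //; exact: okBN.
Qed.

Let ab z : 0 <= a z /\ a z <= b z.
Proof.
by case: z => [[k j]|k] /=; [case: (okW' k)|case: (okN' k) => /andP[]].
Qed.

Let xF i z : Fm F (a z) (x i z) /\ bdd (x i z).
Proof.
case: z => [[k j]|k] /=.
  have [a0 _ mx [K xK]] := okW' k; split.
    apply/(FmP FS _ a0) => A mA; have [sF _] := FS a0.
    by apply: (measurable_wrt_coord i j sF mx).
  by exists K => w; apply: le_trans (xK w); exact: frob_coord.
have [/andP[a0 _] _ _ mx [K xK]] := okN' k; split.
  apply/(FmP FS _ a0) => A mA; have [sF _] := FS a0.
  by apply: (measurable_wrt_coord i 0 sF mx).
by exists K => w; apply: le_trans (xK w); exact: frob_coord.
Qed.

Variables (s t : R) (beta : T -> R) (zeta : T -> 'cV[R]_d).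
Hypotheses (s0 : 0 <= s) (st : s <= t) (mb : Fm F s beta) (bb : bdd beta).
Hypotheses (mz : forall i, Fm F s (fun w => zeta w i 0)).
Hypotheses (lz : forall i, L2 P (fun w => zeta w i 0)).

Let A z := clip s t (a z).
Let B z := clip s t (b z).
(** The coefficient is known at time [a z], and must be known at the clipped time [A z]. When [a z]
    exceeds t the latter is too early, but the clipped interval is then empty and the coefficient
    may be set to 0. *)
Let xi i z w := beta w * ((a z <= t)%R%:R * x i z w).

Let xiF i z : Fm F (A z) (xi i z) /\ bdd (xi i z).
Proof.
have [hx bx] := xF i z; have [a0 _] := ab z.
have A0 : 0 <= A z by exact: le_trans (clip_ge s t (a z)).
split; last first.
  by apply: bddM => //; apply: bddM => //; exists 1 => w; case: (_ <= t); rewrite ?normr1 ?normr0.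
have [azt|/negbTE azt] := boolP (a z <= t); last first.
  rewrite (_ : xi i z = (fun=> 0)); last by apply/funext => w; rewrite /xi azt mul0r mulr0.
  exact: measurable_cst.
apply: FmM; first by apply: (Fm_le FS Fle s0 _ mb); exact: clip_ge.
apply: FmM; first exact: measurable_cst.
by apply: (Fm_le FS Fle a0 _ hx); exact: clip_id.
Qed.

Let dI w := (elemW_int W hW t w - elemW_int W hW s w) +
   (elemN_int nu p hN t w - elemN_int nu p hN s w).

(** Almost surely only, because elementary integrals are built from counts over ]a, b], which are
    increments of [Nc] off a null set. *)
Let dIE : {ae P, forall w, forall i, beta w * dI w i 0 =
   \sum_z xi i z w * inc (X z) (A z) (B z) w}.
Proof.
have h : {ae P, forall w, forall k : nat, forall kN : (k < size hN)%N,
   cc nu p (Num.min (eN k).1.1.1 t) (Num.min (eN k).1.1.2 t) (eN k).1.2 w =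
   inc (Nc nu p (eN k).1.2) (Num.min (eN k).1.1.1 t) (Num.min (eN k).1.1.2 t) w /\
   cc nu p (Num.min (eN k).1.1.1 s) (Num.min (eN k).1.1.2 s) (eN k).1.2 w =
   inc (Nc nu p (eN k).1.2) (Num.min (eN k).1.1.1 s) (Num.min (eN k).1.1.2 s) w}.
  apply: ae_foralln => k; have [kN|kN] := ltnP k (size hN); last first.
    by apply: aeW => w.
  have [/andP[a0 le] mB fB _ _] := okN' (Ordinal kN).
  have t0 := le_trans s0 st.
  have i1 := @inc_Nc _ _ _ P F _ _ _ _ pp (eN k).1.2 (Num.min (eN k).1.1.1 t) (Num.min (eN k).1.1.2 t).
  have i2 := @inc_Nc _ _ _ P F _ _ _ _ pp (eN k).1.2 (Num.min (eN k).1.1.1 s) (Num.min (eN k).1.1.2 s).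
  have min_le y : Num.min (eN k).1.1.1 y <= Num.min (eN k).1.1.2 y.
    by rewrite le_min !ge_min le lexx orbT.
  have g1 := i1 ltac:(by rewrite le_min a0 t0) (min_le t) (okBN (Ordinal kN)).
  have g2 := i2 ltac:(by rewrite le_min a0 s0) (min_le s) (okBN (Ordinal kN)).
  by apply: filterS2 g1 g2 => w -> ->.
apply: filterS h => w hw i.
have key z : xi i z w * inc (X z) (A z) (B z) w = beta w * (x i z w * inc (X z) (A z) (B z) w).
  rewrite /xi; have [azt|] := boolP (a z <= t); first by rewrite mul1r mulrA.
  rewrite -ltNge => taz; have [_ le] := ab z.
  by rewrite /A /B (clip_outside st taz le) /inc subrr !mulr0.
under eq_bigr do rewrite key.
rewrite -mulr_sumr; congr (_ * _).
rewrite big_sumType/= !mxE; congr (_ + _).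
  rewrite /elemW_int !(big_nth (0, 0, fun=> 0)) !big_mkord !summxE -sumrB.
  rewrite -(pair_bigA _ (fun k j => x i (inl (k, j)) w * inc (X (inl (k, j))) (A (inl (k, j))) (B (inl (k, j))) w))/=.
  apply: eq_bigr => k _; rewrite !mxE -sumrB; apply: eq_bigr => j _.
  by rewrite -mulrBr !mxE /A /B /X/= -(inc_clip (Wc W j) (a (inl (k, j))) (b (inl (k, j))) w st).
rewrite /elemN_int !(big_nth (0, 0, set0, fun=> 0)) !big_mkord !summxE -sumrB.
apply: eq_bigr => k _; have [h1 h2] := hw k (ltn_ord k).
rewrite !mxE -!/(eN k) -!/(cc _ _ _ _ _ _) h1 h2 -mulrBl mulrC.
by rewrite /A /B /X/= -(inc_clip (Nc nu p (eN k).1.2) (a (inr k)) (b (inr k)) w st).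
Qed.

Let mdI i : measurable_fun setT (fun w => dI w i 0).
Proof.
have mx i' z : measurable_fun setT (x i' z).
  by have [h _] := xF i' z; apply: (Fm_meas FS _ h); case: (ab z).
have t0 := le_trans s0 st.
have mW y : 0 <= y -> measurable_fun setT (fun w => elemW_int W hW y w i 0).
  move=> y0; rewrite (_ : (fun _ => _) = fun w => \sum_(k < size hW) \sum_j
     x i (inl (k, j)) w * inc (Wc W j) (Num.min (eW k).1.1 y) (Num.min (eW k).1.2 y) w); last first.
    apply/funext => w; rewrite /elemW_int (big_nth (0, 0, fun=> 0)) big_mkord summxE.
    by apply: eq_bigr => k _; rewrite mxE; apply: eq_bigr => j _; rewrite !mxE.
  apply: measurable_sum => k; apply: measurable_sum => j; apply: measurable_funM; first exact: mx.
  have [a0 le _ _] := okW' k.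
  have [||+ _ _] := @mart_W _ _ _ _ P F W FS Fle BW j (Num.min (eW k).1.1 y) (Num.min (eW k).1.2 y).
  - by rewrite le_min a0.
  - by rewrite le_min !ge_min le lexx orbT.
  - by apply: Fm_meas => //; rewrite le_min y0 (le_trans a0).
have mN y : 0 <= y -> measurable_fun setT (fun w => elemN_int nu p hN y w i 0).
  move=> y0; rewrite (_ : (fun _ => _) = fun w => \sum_(k < size hN)
     cc nu p (Num.min (eN k).1.1.1 y) (Num.min (eN k).1.1.2 y) (eN k).1.2 w * x i (inr k) w); last first.
    apply/funext => w; rewrite /elemN_int (big_nth (0, 0, set0, fun=> 0)) big_mkord summxE.
    by apply: eq_bigr => k _; rewrite mxE.
  apply: measurable_sum => k; apply: measurable_funM; last exact: mx.
  have [/andP[a0 le] _ _ _ _] := okN' k.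
  apply: (cc_meas pp); last exact: okBN.
  - by rewrite le_min a0.
  - by rewrite le_min !ge_min le lexx orbT.
rewrite (_ : (fun _ => _) = fun w => (elemW_int W hW t w i 0 - elemW_int W hW s w i 0) +
   (elemN_int nu p hN t w i 0 - elemN_int nu p hN s w i 0)); last first.
  by apply/funext => w; rewrite !mxE.
by apply: measurable_funD; apply: measurable_funB; by [exact: mW|exact: mN].
Qed.

Let over z z' := overlap (A z) (B z) (A z') (B z').

Let overxi i z z' w : over z z' * (xi i z w * xi i z' w) =
  beta w ^+ 2 * (over z z' * (x i z w * x i z' w)).
Proof.
have [_ abz] := ab z; have [_ abz'] := ab z'.
rewrite /xi; have [_|] := boolP (a z <= t); last first.
  rewrite -ltNge => taz.
  by rewrite /over /A /B (clip_outside st taz abz) overlap_degenerate !(mulr0, mul0r).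
have [_|] := boolP (a z' <= t); last first.
  rewrite -ltNge => taz.
  by rewrite /over overlapC /A /B (clip_outside st taz abz') overlap_degenerate !(mulr0, mul0r).
by rewrite !mul1r; ring.
Qed.

(** Recognizes the bracket form as the time integral of the squared integrands: the zero brackets
    separate the Brownian part from the Poisson part, and the Kronecker brackets of W rebuild the
    squared matrix norm. *)
Let val_int w : (\int[lam]_(r in `]s, t]) (frob (elemW_val hW r w) ^+ 2)%:E +
    \int[lam]_(r in `]s, t]) \int[nu]_u (frob (elemN_val hN r u w) ^+ 2)%:E =
  (\sum_i \sum_z \sum_z' c z z' * over z z' * (x i z w * x i z' w))%:E)%E.
Proof.
have -> : (\int[lam]_(r in `]s, t]) (frob (elemW_val hW r w) ^+ 2)%:E =
  \int[lam]_(r in `]s, t]) (frob (\sum_(k : IW) ((eW k).1.1 < r <= (eW k).1.2)%R%:R *: (eW k).2 w) ^+ 2)%:E)%E.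
  by apply: eq_integral => r _; rewrite /elemW_val (big_nth (0, 0, fun=> 0)) big_mkord.
have -> : (\int[lam]_(r in `]s, t]) \int[nu]_u (frob (elemN_val hN r u w) ^+ 2)%:E =
  \int[lam]_(r in `]s, t]) \int[nu]_u (frob (\sum_(k : IN)
    (((eN k).1.1.1 < r <= (eN k).1.1.2)%R%:R * \1_((eN k).1.2) u) *: (eN k).2 w) ^+ 2)%:E)%E.
  apply: eq_integral => r _; apply: eq_integral => u _.
  by rewrite /elemN_val (big_nth (0, 0, set0, fun=> 0)) big_mkord.
rewrite frob_int_W// frob_int_N//; last 2 first.
- by move=> k; case: (okN' k).
- by move=> k; case: (okN' k).
rewrite -EFinD -big_split/=; congr EFin; apply: eq_bigr => i _.
rewrite [RHS]big_sumType/=; congr (_ + _); last first.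
  apply: eq_bigr => k _; rewrite big_sumType/= [X in _ = X + _]big1 ?add0r//.
  by move=> z' _; rewrite !mul0r.
rewrite exchange_big/=.
rewrite -(pair_bigA _ (fun k j => \sum_z' c (inl (k, j)) z' * over (inl (k, j)) z' * (x i (inl (k, j)) w * x i z' w)))/=.
apply: eq_bigr => k _; apply: eq_bigr => j _.
rewrite big_sumType/= [X in _ = _ + X]big1 ?addr0; last by move=> l _; rewrite !mul0r.
rewrite -(pair_bigA _ (fun l j' => (j == j')%:R * over (inl (k, j)) (inl (l, j')) * ((eW k).2 w i j * (eW l).2 w i j')))/=.
apply: eq_bigr => l _; rewrite (bigD1 j)//= eqxx mul1r big1 ?addr0//.
by move=> j' /negPf; rewrite eq_sym => ->; rewrite !mul0r.
Qed.

Lemma isometry :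
  (\int[P]_w (frob (zeta w + beta w *: dI w) ^+ 2)%:E =
   \int[P]_w (frob (zeta w) ^+ 2)%:E +
   \int[P]_w ((beta w ^+ 2)%:E *
     (\int[lam]_(r in `]s, t]) (frob (elemW_val hW r w) ^+ 2)%:E +
      \int[lam]_(r in `]s, t]) \int[nu]_u (frob (elemN_val hN r u w) ^+ 2)%:E)))%E.
Proof.
have iso i := elementary_isometry FS Fle s0 mX bX
  (fun z => conj (clip_ge s t (a z)) (clip_le s t (ab z).2)) (xiF i) (mz i) (lz i).
have mbeta : measurable_fun setT beta by exact: (Fm_meas FS s0 mb).
pose Y i w := (zeta w + beta w *: dI w) i 0.
have mY i : measurable_fun setT (Y i).
  rewrite (_ : Y i = fun w => zeta w i 0 + beta w * dI w i 0); last by apply/funext => w; rewrite /Y !mxE.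
  by apply: measurable_funD; [case: (lz i)|exact: measurable_funM].
have eY i : {ae P, forall w, zeta w i 0 + \sum_z xi i z w * inc (X z) (A z) (B z) w = Y i w}.
  by apply: filterS dIE => w h; rewrite -h /Y !mxE.
have lY i : L2 P (Y i) by case: (iso i) => l _; exact: (L2_ae l (mY i) (eY i)).
have lxx i z z' : L1 P (fun w => c z z' * over z z' * (xi i z w * xi i z' w)).
  have [m1 b1] := xiF i z; have [m2 b2] := xiF i z'.
  apply: L1Z; apply: L2_mul; apply: bdd_L2 => //.
    by apply: (Fm_meas FS _ m1); exact: le_trans (clip_ge _ _ _).
  by apply: (Fm_meas FS _ m2); exact: le_trans (clip_ge _ _ _).
under eq_integral do rewrite frob_sqr_col.
under [in X in _ = (X + _)%E]eq_integral do rewrite frob_sqr_col.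
rewrite Ex_EFin; last by apply: L1_sum => i _; case: (lY i).
rewrite Ex_EFin; last by apply: L1_sum => i _; case: (lz i).
transitivity (Ex P (fun w => \sum_i (zeta w i 0) ^+ 2) +
   Ex P (fun w => \sum_i \sum_z \sum_z' c z z' * over z z' * (xi i z w * xi i z' w)))%:E.
  have l1 i : L1 P (fun w => \sum_z \sum_z' c z z' * over z z' * (xi i z w * xi i z' w)).
    by apply: L1_sum => z _; apply: L1_sum => z' _; exact: lxx.
  have l2 i : L1 P (fun w => zeta w i 0 ^+ 2) by case: (lz i).
  have l3 i : L1 P (fun w => Y i w ^+ 2) by case: (lY i).
  have comp i : Ex P (fun w => Y i w ^+ 2) = Ex P (fun w => zeta w i 0 ^+ 2) +
      Ex P (fun w => \sum_z \sum_z' c z z' * over z z' * (xi i z w * xi i z' w)).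
    case: (iso i) => li <-; apply: Ex_ae.
    - exact: measurable_funX.
    - by apply: measurable_funX; case: li.
    - by apply: filterS (eY i) => w ->.
  congr EFin; rewrite (Ex_sum _ (fun i _ => l3 i)) (Ex_sum _ (fun i _ => l2 i)) (Ex_sum _ (fun i _ => l1 i)).
  by rewrite -big_split/=; apply: eq_bigr => i _; exact: comp.
rewrite EFinD; congr (_ + _)%E; rewrite -Ex_EFin.
  apply: eq_integral => w _; rewrite val_int -EFinM; congr EFin.
  rewrite mulr_sumr; apply: eq_bigr => i _; rewrite mulr_sumr; apply: eq_bigr => z _.
  rewrite mulr_sumr; apply: eq_bigr => z' _.
  by rewrite -mulrA overxi; ring.
by apply: L1_sum => i _; apply: L1_sum => z _; apply: L1_sum => z' _; exact: lxx.
Qed.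

End fixed.
End isometry.

(** * Passage to the limit in the isometry *)

Section nrm2.
Context (R : realType) (dS : measure_display) (S : measurableType dS)
  (mu : {measure set S -> \bar R}) (m n : nat).
Implicit Types f g : S -> 'M[R]_(m, n).

(** Coordinatewise, so that all measurability questions about matrices are about real functions. *)
Definition cmeas f := forall i j, measurable_fun setT (fun x => f x i j).
Definition nrm2 f : \bar R := (\int[mu]_x (frob (f x) ^+ 2)%:E)%E.

Lemma cmeasD f g : cmeas f -> cmeas g -> cmeas (fun x => f x + g x).
Proof.
move=> hf hg i j; under eq_fun do rewrite mxE.
by apply: measurable_funD; [exact: hf|exact: hg].
Qed.

Lemma cmeasN f : cmeas f -> cmeas (fun x => - f x).
Proof.
move=> hf i j; under eq_fun do rewrite mxE.
by apply: measurableT_comp => //; exact: hf.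
Qed.

Lemma cmeasB f g : cmeas f -> cmeas g -> cmeas (fun x => f x - g x).
Proof. by move=> hf hg; apply: cmeasD => //; exact: cmeasN. Qed.

Lemma cmeasZ (k : S -> R) f : measurable_fun setT k -> cmeas f -> cmeas (fun x => k x *: f x).
Proof.
move=> hk hf i j; under eq_fun do rewrite mxE.
by apply: measurable_funM => //; exact: hf.
Qed.

Lemma cmeas_frob f : cmeas f -> measurable_fun setT (fun x => frob (f x) ^+ 2).
Proof.
move=> hf; under eq_fun do rewrite frob_sqr.
apply: measurable_sum => i; apply: measurable_sum => j.
by apply: measurable_funX; exact: hf.
Qed.

Lemma frob_sqrZ (k : R) (A : 'M[R]_(m, n)) : frob (k *: A) ^+ 2 = k ^+ 2 * frob A ^+ 2.
Proof.
rewrite !frob_sqr mulr_sumr; apply: eq_bigr => i _; rewrite mulr_sumr.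
by apply: eq_bigr => j _; rewrite mxE exprMn.
Qed.

Lemma frob_sqrN (A : 'M[R]_(m, n)) : frob (- A) ^+ 2 = frob A ^+ 2.
Proof. by rewrite -scaleN1r frob_sqrZ sqrrN expr1n mul1r. Qed.

(** Young's inequality with a free weight. A small e keeps the first coefficient close to 1, which
    the passage to the limit in the isometry requires; e = 1 gives the crude factor 2. *)
Lemma frob_sqrD (e : R) (A B : 'M[R]_(m, n)) : 0 < e ->
  frob (A + B) ^+ 2 <= (1 + e) * frob A ^+ 2 + (1 + e^-1) * frob B ^+ 2.
Proof.
move=> e0; rewrite !frob_sqr !mulr_sumr -big_split/=; apply: ler_sum => i _.
rewrite !mulr_sumr -big_split/=; apply: ler_sum => j _; rewrite mxE.
move: (A i j) (B i j) => x y.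
have -> : (1 + e) * x ^+ 2 + (1 + e^-1) * y ^+ 2 = (x + y) ^+ 2 + e * (x - y / e) ^+ 2.
  by field; exact: lt0r_neq0.
by rewrite lerDl mulr_ge0 ?sqr_ge0// ltW.
Qed.

Lemma nrm2_ge0 f : (0 <= nrm2 f)%E.
Proof. by apply: integral_ge0 => x _; rewrite lee_fin sqr_ge0. Qed.

Lemma nrm2D (e : R) f g : 0 < e -> cmeas f -> cmeas g ->
  (nrm2 (fun x => (f x + g x)%R) <= (1 + e)%:E * nrm2 f + (1 + e^-1)%:E * nrm2 g)%E.
Proof.
move=> e0 hf hg; have e1 : 0 <= 1 + e by rewrite addr_ge0// ltW.
have e2 : 0 <= 1 + e^-1 by rewrite addr_ge0// invr_ge0 ltW.
have mf := cmeas_frob hf; have mg := cmeas_frob hg.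
rewrite /nrm2 -!ge0_integralZl//; try (by move=> x _; rewrite lee_fin sqr_ge0);
  try exact/measurable_EFinP.
rewrite -ge0_integralD//; last 4 first.
- by move=> x _; rewrite mule_ge0// lee_fin ?sqr_ge0.
- by apply: measurable_funeM; exact/measurable_EFinP.
- by move=> x _; rewrite mule_ge0// lee_fin ?sqr_ge0.
- by apply: measurable_funeM; exact/measurable_EFinP.
apply: ge0_le_integral => //.
- by move=> x _; rewrite lee_fin sqr_ge0.
- by apply/measurable_EFinP; apply: cmeas_frob; exact: cmeasD.
- by apply: emeasurable_funD; apply: measurable_funeM; exact/measurable_EFinP.
- by move=> x _; rewrite -!EFinM -EFinD lee_fin; exact: frob_sqrD.
Qed.

Lemma nrm2D2 f g : cmeas f -> cmeas g ->
  (nrm2 (fun x => (f x + g x)%R) <= 2%:E * nrm2 f + 2%:E * nrm2 g)%E.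
Proof. by move=> hf hg; have := nrm2D (ltr01 : 0 < 1 :> R) hf hg; rewrite invr1. Qed.

Lemma nrm2N f : nrm2 (fun x => - f x) = nrm2 f.
Proof. by apply: eq_integral => x _; rewrite frob_sqrN. Qed.

Lemma nrm2B2 f g : cmeas f -> cmeas g ->
  (nrm2 (fun x => (f x - g x)%R) <= 2%:E * nrm2 f + 2%:E * nrm2 g)%E.
Proof.
by move=> hf hg; have := nrm2D2 hf (cmeasN hg); rewrite nrm2N.
Qed.

Lemma nrm2Z (k : S -> R) (K : R) f : measurable_fun setT k -> cmeas f ->
  (forall x, `|k x| <= K) -> (nrm2 (fun x => k x *: f x) <= (K ^+ 2)%:E * nrm2 f)%E.
Proof.
move=> mk hf kK; rewrite /nrm2 -ge0_integralZl//; last 3 first.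
- by apply/measurable_EFinP; exact: cmeas_frob.
- by move=> x _; rewrite lee_fin sqr_ge0.
- by rewrite lee_fin sqr_ge0.
apply: ge0_le_integral => //.
- by move=> x _; rewrite lee_fin sqr_ge0.
- by apply/measurable_EFinP; apply: cmeas_frob; exact: cmeasZ.
- by apply: measurable_funeM; apply/measurable_EFinP; exact: cmeas_frob.
move=> x _; rewrite -EFinM lee_fin frob_sqrZ ler_wpM2r ?sqr_ge0//.
by rewrite -real_normK ?num_real// ler_pXn2r ?nnegrE// (le_trans _ (kK x)).
Qed.

End nrm2.

Lemma squeeze0e (R : realType) (u v : nat -> \bar R) :
  (forall k, 0 <= u k)%E -> (forall k, u k <= v k)%E ->
  v @ \oo --> 0%E -> u @ \oo --> 0%E.
Proof.
move=> u0 uv v0; apply: (@squeeze_cvge _ _ _ _ (cst 0%E) _ v) => //.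
- by apply: nearW => k; rewrite u0 uv.
- exact: cvg_cst.
Qed.

Lemma cvg0eD (R : realType) (u v : nat -> \bar R) :
  u @ \oo --> 0%E -> v @ \oo --> 0%E -> (fun k => (u k + v k)%E) @ \oo --> 0%E.
Proof. by move=> hu hv; rewrite -[0%E]adde0; apply: cvgeD. Qed.

Lemma cvg0eZ (R : realType) (c : R) (u : nat -> \bar R) :
  u @ \oo --> 0%E -> (fun k => (c%:E * u k)%E) @ \oo --> 0%E.
Proof. by move=> hu; rewrite -[0%E](mule0 c%:E); apply: cvgeZl. Qed.

Section lists.
Context (R : realType) (d : nat) (dT : measure_display) (T : measurableType dT)
  (P : probability T R) (F : R -> set (set T)) (W : R -> T -> 'cV[R]_d)
  (dU : measure_display) (U : measurableType dU)
  (nu : {sigma_finite_measure set U -> \bar R}) (p : T -> R -> option U).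
Hypothesis FS : forall t : R, 0 <= t -> sigma_algebra setT (F t) /\ F t `<=` measurable.

(** Concatenating lists adds elementary integrands and negating the coefficients changes the sign,
    so this list represents the difference. *)
Definition subW (h h' : elemW R d T) : elemW R d T :=
  h ++ [seq (a.1, fun w => - a.2 w) | a <- h'].
Definition subN (h h' : elemN R d T U) : elemN R d T U :=
  h ++ [seq (a.1, fun w => - a.2 w) | a <- h'].

Lemma subW_val h h' r w : elemW_val (subW h h') r w = elemW_val h r w - elemW_val h' r w.
Proof.
rewrite /elemW_val big_cat big_map/= -sumrN; congr (_ + _).
by apply: eq_bigr => a _; rewrite scalerN.
Qed.

Lemma subW_int h h' t w : elemW_int W (subW h h') t w = elemW_int W h t w - elemW_int W h' t w.
Proof.
rewrite /elemW_int big_cat big_map/= -sumrN; congr (_ + _).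
by apply: eq_bigr => a _; rewrite mulNmx.
Qed.

Lemma subN_val h h' r u w : elemN_val (subN h h') r u w = elemN_val h r u w - elemN_val h' r u w.
Proof.
rewrite /elemN_val big_cat big_map/= -sumrN; congr (_ + _).
by apply: eq_bigr => a _; rewrite scalerN.
Qed.

Lemma subN_int h h' t w : elemN_int nu p (subN h h') t w = elemN_int nu p h t w - elemN_int nu p h' t w.
Proof.
rewrite /elemN_int big_cat big_map/= -sumrN; congr (_ + _).
by apply: eq_bigr => a _; rewrite scalerN.
Qed.

Let wrtN G m n (f : T -> 'M[R]_(m, n)) : measurable_wrt G f -> measurable_wrt G (fun w => - f w).
Proof.
move=> hf O oO; rewrite (_ : _ @^-1` _ = f @^-1` (-%R @^-1` O)) //.
by apply: hf; apply: open_comp => // x _; exact: opp_continuous.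
Qed.

Let bddN m n (f : T -> 'M[R]_(m, n)) : bounded_rv f -> bounded_rv (fun w => - f w).
Proof.
move=> [K hK]; exists K => w; rewrite -(@ler_pXn2r _ 2) ?nnegrE ?frob_ge0//.
  by rewrite frob_sqrN ler_pXn2r ?nnegrE ?frob_ge0// (le_trans _ (hK w))// frob_ge0.
by rewrite (le_trans _ (hK w))// frob_ge0.
Qed.

Lemma subW_ok h h' : elemW_ok F h -> elemW_ok F h' -> elemW_ok F (subW h h').
Proof.
move=> oh oh' k; rewrite /subW size_cat size_map nth_cat => kh.
case: ltnP => [/oh//|hk].
have kk : (k - size h < size h')%N by rewrite ltn_subLR.
rewrite (nth_map (0, 0, fun=> 0))//; have := oh' _ kk.
case: nth => -[a b] x [a0 ab mx bx]; split => //; [exact: wrtN|exact: bddN].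
Qed.

Lemma subN_ok h h' : elemN_ok F nu h -> elemN_ok F nu h' -> elemN_ok F nu (subN h h').
Proof.
move=> oh oh' k; rewrite /subN size_cat size_map nth_cat => kh.
case: ltnP => [/oh//|hk].
have kk : (k - size h < size h')%N by rewrite ltn_subLR.
rewrite (nth_map (0, 0, set0, fun=> 0))//; have := oh' _ kk.
case: nth => -[[a b] B] x [a0 ab fB mx bx]; split => //; [exact: wrtN|exact: bddN].
Qed.

Lemma measurable_wrt_cmeas t m n (f : T -> 'M[R]_(m, n)) : 0 <= t -> measurable_wrt (F t) f -> cmeas f.
Proof.
move=> t0 mf i j; apply: (Fm_meas FS t0); apply/(FmP FS _ t0) => A mA.
by have [sF _] := FS t0; exact: (measurable_wrt_coord i j sF mf).
Qed.

Lemma measurable_between (dS : measure_display) (S : measurableType dS) (g : S -> R) (a b : R) :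
  measurable_fun setT g -> measurable_fun setT (fun x => ((a < g x <= b)%R%:R : R)).
Proof.
move=> mg; rewrite (_ : (fun _ => _) = \1_(`]a, b]%classic : set R) \o g).
  by apply: measurableT_comp => //; apply: measurable_indic; exact: measurable_itv.
by apply/funext => x; rewrite /= indicE mem_setE in_itv.
Qed.

Lemma elemW_val_cmeas h : elemW_ok F h ->
  cmeas (m := d) (n := d) (fun z : T * measurableTypeR R => elemW_val h z.2 z.1).
Proof.
move=> oh i j.
rewrite (_ : (fun _ => _) = fun z : T * measurableTypeR R => \sum_(k < size h)
   ((nth (0, 0, fun=> 0) h k).1.1 < z.2 <= (nth (0, 0, fun=> 0) h k).1.2)%R%:R * (nth (0, 0, fun=> 0) h k).2 z.1 i j); last first.
  apply/funext => z; rewrite /elemW_val (big_nth (0, 0, fun=> 0)) big_mkord summxE.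
  by apply: eq_bigr => k _; rewrite !mxE.
apply: measurable_sum => k; have := oh _ (ltn_ord k).
case: nth => -[a b] x /= [a0 ab mx _]; apply: measurable_funM.
  exact: measurable_between.
by apply: (@measurableT_comp _ _ _ _ _ _ (fun w => x w i j)) => //; exact: (measurable_wrt_cmeas a0 mx).
Qed.

Lemma elemN_val_cmeas h : elemN_ok F nu h ->
  cmeas (m := d) (n := 1) (fun z : T * (measurableTypeR R * U) => elemN_val h z.2.1 z.2.2 z.1).
Proof.
move=> oh i j.
rewrite (_ : (fun _ => _) = fun z : T * (measurableTypeR R * U) => \sum_(k < size h)
   ((nth (0, 0, set0, fun=> 0) h k).1.1.1 < z.2.1 <= (nth (0, 0, set0, fun=> 0) h k).1.1.2)%R%:R *
   \1_((nth (0, 0, set0, fun=> 0) h k).1.2) z.2.2 * (nth (0, 0, set0, fun=> 0) h k).2 z.1 i j); last first.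
  apply/funext => z; rewrite /elemN_val (big_nth (0, 0, set0, fun=> 0)) big_mkord summxE.
  by apply: eq_bigr => k _; rewrite !mxE.
apply: measurable_sum => k; have := oh _ (ltn_ord k).
case: nth => -[[a b] B] x /= [/andP[a0 ab] mB fB mx _]; apply: measurable_funM.
  apply: measurable_funM.
    apply: measurable_between; exact: measurableT_comp.
  by apply: (@measurableT_comp _ _ _ _ _ _ (\1_B : U -> R)) => //; exact: measurableT_comp.
by apply: (@measurableT_comp _ _ _ _ _ _ (fun w => x w i j)) => //; exact: (measurable_wrt_cmeas a0 mx).
Qed.

End lists.

Section lee_limits.
Context (R : realType).

Lemma lee_cvg0 (a b : \bar R) (v : nat -> \bar R) : (forall k, a <= b + v k)%E ->
  v @ \oo --> 0%E -> (0 <= b)%E -> (a <= b)%E.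
Proof.
move=> h v0 b0; have [->|bfin] := eqVneq b +oo%E; first exact: leey.
have fb : b \is a fin_num by rewrite ge0_fin_numE// lt_neqAle bfin leey.
have : (fun k => (b + v k)%E) @ \oo --> b.
  by rewrite -[X in _ --> X]adde0; apply: cvgeD => //; [rewrite fin_num_adde_defl|exact: cvg_cst].
move=> c; rewrite -(cvg_lim _ c)//; apply: lime_ge; first by apply/cvg_ex; exists b.
by apply: nearW.
Qed.

Lemma lee_1eps (a b : \bar R) : (0 <= b)%E ->
  (forall e : R, (0 < e)%R -> a <= ((1 + e) ^+ 2)%:E * b)%E -> (a <= b)%E.
Proof.
case: b => [b| |]; [|by move=> _ _; rewrite leey|by []].
rewrite lee_fin => b0 h; apply/lee_addgt0Pr => e e0.
(* For t <= 1 the square (1 + t)^2 is at most 1 + 3 t, and the added 1 keeps the denominator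
   positive when b = 0. *)
pose t := Num.min 1 (e / (3 * (b + 1))).
have b1 : 0 < 3 * (b + 1) by lra.
have t0 : 0 < t by rewrite lt_min ltr01 divr_gt0.
have t1 : t <= 1 by rewrite ge_min lexx.
have te : t * (3 * (b + 1)) <= e by rewrite -ler_pdivlMr// ge_min lexx orbT.
apply: le_trans (h t t0) _; rewrite -EFinM -EFinD lee_fin.
have : (1 + t) ^+ 2 <= 1 + 3 * t by nra.
move/(ler_wpM2r b0)/le_trans; apply.
have : t * b <= t * (b + 1) by rewrite ler_wpM2l// ?ltW//; lra.
lra.
Qed.

End lee_limits.

Section product_sigma_finite.
Context d1 d2 (T1 : measurableType d1) (T2 : measurableType d2) (R : realType).
Variables (m1 : {sigma_finite_measure set T1 -> \bar R})
  (m2 : {sigma_finite_measure set T2 -> \bar R}).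

Lemma product_sigma_finite : sigma_finite setT (m1 \x m2)%E.
Proof.
have /sigma_finiteP[A [AT ndA Aoo]] := sigma_finiteT m1.
have /sigma_finiteP[B [BT ndB Boo]] := sigma_finiteT m2.
exists (fun n => A n `*` B n).
  rewrite -setXTT AT BT predeqE => -[x y]; split.
    move=> [/= [n _ Anx] [k _ Bky]]; exists (maxn n k) => //; split.
    - by move: x Anx; exact/subsetPset/ndA/leq_maxl.
    - by move: y Bky; exact/subsetPset/ndB/leq_maxr.
  by move=> [n _ []/= ? ?]; split; exists n.
move=> k; have [? ?] := Aoo k; have [? ?] := Boo k.
split; first exact: measurableX.
by rewrite product_measure1E// lte_mul_pinfty// ge0_fin_numE.
Qed.

(** Time times marks, packed as a sigma-finite measure so that a further product with P can be
    formed and Tonelli applies to it. *)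
Definition product_sf : {sigma_finite_measure set (T1 * T2)%type -> \bar R} :=
  HB.pack (m1 \x m2)%E (Measure_isSigmaFinite.Build _ _ _ (m1 \x m2)%E product_sigma_finite).
End product_sigma_finite.

Section limit.
Context (R : realType) (d : nat) (dT : measure_display) (T : measurableType dT)
  (P : probability T R) (F : R -> set (set T)) (W : R -> T -> 'cV[R]_d)
  (dU : measure_display) (U : measurableType dU)
  (nu : {sigma_finite_measure set U -> \bar R}) (p : T -> R -> option U).
Hypothesis FS : forall t : R, 0 <= t -> sigma_algebra setT (F t) /\ F t `<=` measurable.
Hypothesis Fle : forall s t : R, 0 <= s -> s <= t -> F s `<=` F t.
Hypothesis BW : standard_brownian_motion P F W.
Hypothesis pp : poisson_point_process P F nu p.
Hypothesis WN : indep_classes P (brownian_sigma W) (point_sigma p `[0, +oo[).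
Notation lam := (@lebesgue_measure R).
Notation TR := (T * measurableTypeR R)%type.
Notation TRU := (T * (measurableTypeR R * U))%type.
Notation PL := (P \x lam)%E.
Notation lamnu := (product_sf lam nu).
Notation PLN := (P \x lamnu)%E.

Lemma lamnuE (g : measurableTypeR R * U -> \bar R) :
  (\int[lamnu]_y g y = \int[(lam \x nu)%E]_y g y)%E.
Proof. by []. Qed.

Definition btw (s t r : R) : R := (s < r <= t)%R%:R.

Lemma btw_itv s t r : btw s t r = \1_(`]s, t]%classic : set R) r.
Proof. by rewrite /btw indicE mem_setE in_itv. Qed.

Lemma measurable_beta (dS : measure_display) (S : measurableType dS) (beta : T -> R) :
  measurable_fun setT beta -> measurable_fun setT (fun z : T * S => beta z.1).
Proof. by move=> mb; apply: (measurableT_comp mb). Qed.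

(** Turns the iterated integrals of the isometry into squared norms on a product space, where
    [nrm2D] and [nrm2Z] are available. *)
Lemma weighted_intW m n (beta : T -> R) (f : TR -> 'M[R]_(m, n)) (s t : R) :
  measurable_fun setT beta -> cmeas f ->
  (\int[P]_w ((beta w ^+ 2)%:E * \int[lam]_(r in `]s, t]) (frob (f (w, r)) ^+ 2)%:E) =
  nrm2 PL (fun z => beta z.1 *: (btw s t z.2 *: f z)))%E.
Proof.
move=> mb mf.
have mbt : measurable_fun setT (fun z : TR => btw s t z.2).
  by apply: measurable_between.
have mg : cmeas (fun z => beta z.1 *: (btw s t z.2 *: f z)).
  by apply: cmeasZ; [exact: measurable_beta|exact: cmeasZ].
rewrite /nrm2 fubini_tonelli1; last 2 first.
- by apply/measurable_EFinP; exact: cmeas_frob.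
- by move=> z; rewrite lee_fin sqr_ge0.
apply: eq_integral => w _; rewrite /fubini_F/=.
have mfw : measurable_fun setT (fun r : measurableTypeR R => frob (f (w, r)) ^+ 2).
  exact: (measurable_fun_pair2 w (cmeas_frob mf)).
rewrite -ge0_integralZl//; last 3 first.
- by apply/measurable_EFinP; exact: measurable_funTS.
- by move=> r _; rewrite lee_fin sqr_ge0.
- by rewrite lee_fin sqr_ge0.
rewrite integral_mkcond; apply: eq_integral => r _.
rewrite patchE !frob_sqrZ btw_itv indicE.
by case: ifPn => _; rewrite ?expr1n ?mul1r// expr0n/= mul0r mulr0.
Qed.

Lemma weighted_intN n (beta : T -> R) (f : TRU -> 'cV[R]_n) (s t : R) :
  measurable_fun setT beta -> cmeas f ->
  (\int[P]_w ((beta w ^+ 2)%:E * \int[lam]_(r in `]s, t]) \int[nu]_u (frob (f (w, (r, u))) ^+ 2)%:E) =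
  nrm2 PLN (fun z => beta z.1 *: (btw s t z.2.1 *: f z)))%E.
Proof.
move=> mb mf.
have mbt : measurable_fun setT (fun z : TRU => btw s t z.2.1).
  by apply: measurable_between; exact: measurableT_comp.
have mg : cmeas (fun z => beta z.1 *: (btw s t z.2.1 *: f z)).
  by apply: cmeasZ; [exact: measurable_beta|exact: cmeasZ].
rewrite /nrm2 fubini_tonelli1; last 2 first.
- by apply/measurable_EFinP; exact: cmeas_frob.
- by move=> z; rewrite lee_fin sqr_ge0.
apply: eq_integral => w _; rewrite /fubini_F/=.
have mfw : measurable_fun setT (fun y : measurableTypeR R * U => frob (f (w, y)) ^+ 2).
  exact: (measurable_fun_pair2 w (cmeas_frob mf)).
have mfu r : measurable_fun setT (fun u : U => frob (f (w, (r, u))) ^+ 2).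
  exact: (measurable_fun_pair2 r mfw).
have mfr : measurable_fun setT (fun r : measurableTypeR R => \int[nu]_u (frob (f (w, (r, u))) ^+ 2)%:E)%E.
  apply: (@measurable_fun_fubini_tonelli_F _ _ _ _ _ nu (fun y => (frob (f (w, y)) ^+ 2)%:E)).
    exact/measurable_EFinP.
  by move=> y; rewrite lee_fin sqr_ge0.
rewrite lamnuE fubini_tonelli1; last 2 first.
- apply/measurable_EFinP.
  exact: (measurable_fun_pair2 w (cmeas_frob mg)).
- by move=> z; rewrite lee_fin sqr_ge0.
rewrite -ge0_integralZl//; last 3 first.
- exact: measurable_funTS.
- by move=> r _; apply: integral_ge0 => u _; rewrite lee_fin sqr_ge0.
- by rewrite lee_fin sqr_ge0.
rewrite integral_mkcond; apply: eq_integral => r _; rewrite /fubini_F/=.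
transitivity ((beta w ^+ 2 * btw s t r ^+ 2)%:E * \int[nu]_u (frob (f (w, (r, u))) ^+ 2)%:E)%E.
  rewrite patchE btw_itv indicE.
  by case: ifPn => _; rewrite ?expr1n ?mulr1// expr0n/= mulr0 mul0e.
rewrite -ge0_integralZl//; last 3 first.
- exact/measurable_EFinP.
- by move=> u _; rewrite lee_fin sqr_ge0.
- by rewrite lee_fin mulr_ge0 ?sqr_ge0.
by apply: eq_integral => u _; rewrite !frob_sqrZ -EFinM mulrA.
Qed.

Lemma intW_nrm2 m n (f : TR -> 'M[R]_(m, n)) (s t : R) : cmeas f ->
  (\int[P]_w \int[lam]_(r in `]s, t]) (frob (f (w, r)) ^+ 2)%:E =
  nrm2 PL (fun z => btw s t z.2 *: f z))%E.
Proof.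
move=> mf; have := @weighted_intW _ _ (fun=> 1) f s t (measurable_cst _) mf.
under eq_integral do rewrite expr1n mul1e.
by move=> ->; apply: eq_integral => z _; rewrite scale1r.
Qed.

Lemma intN_nrm2 n (f : TRU -> 'cV[R]_n) (s t : R) : cmeas f ->
  (\int[P]_w \int[lam]_(r in `]s, t]) \int[nu]_u (frob (f (w, (r, u))) ^+ 2)%:E =
  nrm2 PLN (fun z => btw s t z.2.1 *: f z))%E.
Proof.
move=> mf; have := @weighted_intN _ (fun=> 1) f s t (measurable_cst _) mf.
under eq_integral do rewrite expr1n mul1e.
by move=> ->; apply: eq_integral => z _; rewrite scale1r.
Qed.

Definition Eint (hW : elemW R d T) (hN : elemN R d T U) (t : R) (w : T) : 'cV[R]_d :=
  elemW_int W hW t w + elemN_int nu p hN t w.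

Definition valW (h : elemW R d T) (z : TR) : 'M[R]_d := elemW_val h z.2 z.1.
Definition valN (h : elemN R d T U) (z : TRU) : 'cV[R]_d := elemN_val h z.2.1 z.2.2 z.1.

Lemma isometry_nrm2 (hW : elemW R d T) (hN : elemN R d T U) (s t : R)
   (beta : T -> R) (zeta : T -> 'cV[R]_d) :
  elemW_ok F hW -> elemN_ok F nu hN -> 0 <= s -> s <= t -> Fm F s beta -> bdd beta ->
  (forall i : 'I_d, Fm F s (fun w => zeta w i 0)) ->
  (forall i : 'I_d, L2 P (fun w => zeta w i 0)) ->
  (nrm2 P (fun w => zeta w + beta w *: (Eint hW hN t w - Eint hW hN s w))%R =
   nrm2 P zeta + (nrm2 PL (fun z => beta z.1 *: (btw s t z.2 *: valW hW z))%R +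
                  nrm2 PLN (fun z => beta z.1 *: (btw s t z.2.1 *: valN hN z))%R))%E.
Proof.
move=> okW okN s0 st mb bb mz lz.
have mbeta := Fm_meas FS s0 mb.
have := isometry FS Fle BW pp WN okW okN s0 st mb bb mz lz.
rewrite (_ : nrm2 P (fun w => zeta w + beta w *: (Eint hW hN t w - Eint hW hN s w))%R =
   (\int[P]_w (frob (zeta w + beta w *: ((elemW_int W hW t w - elemW_int W hW s w) +
     (elemN_int nu p hN t w - elemN_int nu p hN s w))) ^+ 2)%:E)%E); last first.
  by apply: eq_integral => w _; rewrite /Eint opprD addrACA.
move=> ->; congr (_ + _)%E.
have mW := elemW_val_cmeas FS okW; have mN := elemN_val_cmeas FS okN.
rewrite -(weighted_intW s t mbeta mW) -(weighted_intN s t mbeta mN).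
have mb2 : measurable_fun setT (fun w => (beta w ^+ 2)%:E).
  by apply/measurable_EFinP; exact: measurable_funX.
have m1 : measurable_fun setT (fun w => \int[lam]_(r in `]s, t]) (frob (valW hW (w, r)) ^+ 2)%:E)%E.
  rewrite (_ : (fun _ => _) = fun w => \int[lam]_r (frob (btw s t r *: valW hW (w, r)) ^+ 2)%:E)%E; last first.
    apply/funext => w; rewrite integral_mkcond; apply: eq_integral => r _.
    by rewrite patchE frob_sqrZ btw_itv indicE; case: ifPn => _; rewrite ?expr1n ?mul1r// expr0n mul0r.
  apply: (@measurable_fun_fubini_tonelli_F _ _ _ _ _ lam (fun z : TR => (frob (btw s t z.2 *: valW hW z) ^+ 2)%:E)).
    apply/measurable_EFinP; apply: cmeas_frob; apply: cmeasZ => //.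
    by apply: measurable_between.
  by move=> z; rewrite lee_fin sqr_ge0.
have m2 : measurable_fun setT (fun w => \int[lam]_(r in `]s, t]) \int[nu]_u (frob (valN hN (w, (r, u))) ^+ 2)%:E)%E.
  have mg : cmeas (fun z : TRU => btw s t z.2.1 *: valN hN z).
    by apply: cmeasZ => //; apply: measurable_between; exact: measurableT_comp.
  rewrite (_ : (fun _ => _) = fun w => \int[lamnu]_y (frob (btw s t y.1 *: valN hN (w, y)) ^+ 2)%:E)%E; last first.
    apply/funext => w; rewrite lamnuE fubini_tonelli1; last 2 first.
    - apply/measurable_EFinP; exact: (measurable_fun_pair2 w (cmeas_frob mg)).
    - by move=> z; rewrite lee_fin sqr_ge0.
    rewrite integral_mkcond; apply: eq_integral => r _; rewrite /fubini_F/= patchE.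
    case: ifPn => rs.
      apply: eq_integral => u _; rewrite frob_sqrZ btw_itv indicE rs expr1n mul1r//.
    rewrite -[LHS](integral0 nu setT); apply: eq_integral => u _.
    by rewrite frob_sqrZ btw_itv indicE (negbTE rs) expr0n mul0r.
  apply: (@measurable_fun_fubini_tonelli_F _ _ _ _ _ lamnu (fun z : TRU => (frob (btw s t z.2.1 *: valN hN z) ^+ 2)%:E)).
    by apply/measurable_EFinP; apply: cmeas_frob.
  by move=> z; rewrite lee_fin sqr_ge0.
have p1 w : (0 <= \int[lam]_(r in `]s, t]) (frob (valW hW (w, r)) ^+ 2)%:E)%E.
  by apply: integral_ge0 => r _; rewrite lee_fin sqr_ge0.
have p2 w : (0 <= \int[lam]_(r in `]s, t]) \int[nu]_u (frob (valN hN (w, (r, u))) ^+ 2)%:E)%E.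
  by apply: integral_ge0 => r _; apply: integral_ge0 => u _; rewrite lee_fin sqr_ge0.
rewrite -ge0_integralD//; last 4 first.
- by move=> w _; apply: mule_ge0 (p1 w); rewrite lee_fin sqr_ge0.
- exact: emeasurable_funM.
- by move=> w _; apply: mule_ge0 (p2 w); rewrite lee_fin sqr_ge0.
- exact: emeasurable_funM.
by apply: eq_integral => w _; rewrite (ge0_muleDr _ (p1 w) (p2 w)).
Qed.

Lemma Eint_cmeas hW hN (t : R) : elemW_ok F hW -> elemN_ok F nu hN -> 0 <= t -> cmeas (Eint hW hN t).
Proof.
move=> okW okN t0; have m0 (x : R) : 0 <= x -> 0 <= Num.min x t by move=> x0; rewrite le_min x0.
apply: cmeasD => i j.
  rewrite /elemW_int; under eq_fun do rewrite (big_nth (0, 0, fun=> 0)) big_mkord summxE.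
  apply: measurable_sum => k; have := okW _ (ltn_ord k).
  case: nth => -[a b] x /= [a0 ab mx _]; under eq_fun do rewrite mxE.
  have [aW _ _ _] := BW.
  have mW (y : R) : 0 <= y -> cmeas (W (Num.min y t)).
    by move=> y0; apply: (measurable_wrt_cmeas FS (m0 _ y0)); apply: aW; exact: m0.
  apply: measurable_sum => l; apply: measurable_funM.
    exact: (measurable_wrt_cmeas FS a0 mx).
  by apply: (cmeasB (mW _ (le_trans a0 ab)) (mW _ a0)).
rewrite /elemN_int; under eq_fun do rewrite (big_nth (0, 0, set0, fun=> 0)) big_mkord summxE.
apply: measurable_sum => k; have := okN _ (ltn_ord k).
case: nth => -[[a b] B] x /= [/andP[a0 ab] mB fB mx _]; under eq_fun do rewrite mxE.
apply: measurable_funM; last exact: (measurable_wrt_cmeas FS a0 mx).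
apply: (cc_meas pp _ _ (conj mB fB)); [exact: m0|by rewrite le_min !ge_min ab lexx orbT].
Qed.

Lemma Eint0 hW hN w : elemW_ok F hW -> elemN_ok F nu hN -> Eint hW hN 0 w = 0.
Proof.
move=> okW okN; rewrite /Eint /elemW_int /elemN_int (big_nth (0, 0, fun=> 0)) big_mkord.
rewrite big1 ?add0r; last first.
  move=> k _; have := okW _ (ltn_ord k).
  case: nth => -[a b] x /= [a0 ab _ _].
  by rewrite !(min_idPr _) ?subrr ?mulmx0// (le_trans a0).
rewrite (big_nth (0, 0, set0, fun=> 0)) big_mkord big1// => k _; have := okN _ (ltn_ord k).
case: nth => -[[a b] B] x /= [/andP[a0 ab] mB fB mx _].
rewrite !(min_idPr _) ?(le_trans a0)// /compensated_count subrr mul0r subr0.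
rewrite /point_count (_ : [set _ | _] = set0) ?measure0 ?scale0r//.
by apply/seteqP; split => r //= [u _ [/=]]; rewrite in_itv/= => /andP[/lt_le_trans h /h]; rewrite ltxx.
Qed.

Variables (HW : TR -> 'M[R]_d) (HN : TRU -> 'cV[R]_d) (M : R -> T -> 'cV[R]_d).

(** M is the sum of both stochastic integrals, approximated jointly; the sequences depend on t, as
    they do in the definition of the integrals. *)
Definition approximable := forall t : R, 0 <= t -> exists (hW : nat -> elemW R d T) (hN : nat -> elemN R d T U),
  [/\ forall k, elemW_ok F (hW k), forall k, elemN_ok F nu (hN k),
     (fun k => nrm2 PL (fun z => btw 0 t z.2 *: (valW (hW k) z - HW z))) @ \oo --> 0%E,
     (fun k => nrm2 PLN (fun z => btw 0 t z.2.1 *: (valN (hN k) z - HN z))) @ \oo --> 0%E &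
     (fun k => nrm2 P (fun w => Eint (hW k) (hN k) t w - M t w)) @ \oo --> 0%E].

Hypotheses (mHW : cmeas HW) (mHN : cmeas HN) (mM : forall t, 0 <= t -> cmeas (M t)).
Hypothesis ap : approximable.

Lemma btw_sq_le (s t s' t' r : R) : s' <= s -> t <= t' -> btw s t r ^+ 2 <= btw s' t' r ^+ 2.
Proof.
move=> ss tt; rewrite /btw; have [/andP[sr rt]|_] := boolP (s < r <= t); last by rewrite expr0n sqr_ge0.
by rewrite (le_lt_trans ss sr) (le_trans rt tt).
Qed.

Lemma nrm2_btw_le (dS : measure_display) (S : measurableType dS) (mu : {measure set S -> \bar R})
    (pr : S -> R) m n (f : S -> 'M[R]_(m, n)) (s t s' t' : R) :
  measurable_fun setT pr -> cmeas f -> s' <= s -> t <= t' ->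
  (nrm2 mu (fun z => btw s t (pr z) *: f z) <= nrm2 mu (fun z => btw s' t' (pr z) *: f z))%E.
Proof.
move=> mp mf ss tt; apply: ge0_le_integral => //.
- by move=> x _; rewrite lee_fin sqr_ge0.
- by apply/measurable_EFinP; apply: cmeas_frob; apply: cmeasZ => //; exact: measurable_between.
- by apply/measurable_EFinP; apply: cmeas_frob; apply: cmeasZ => //; exact: measurable_between.
- by move=> x _; rewrite lee_fin !frob_sqrZ ler_wpM2r ?sqr_ge0// btw_sq_le.
Qed.

Let m2 : measurable_fun setT (fun z : TR => z.2).
Proof. exact: measurable_snd. Qed.
Let m21 : measurable_fun setT (fun z : TRU => z.2.1).
Proof. exact: measurableT_comp. Qed.

Let mZW (s t : R) (f : TR -> 'M[R]_d) : cmeas f -> cmeas (fun z => btw s t z.2 *: f z).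
Proof. by move=> mf; apply: cmeasZ => //; exact: measurable_between. Qed.
Let mZN (s t : R) (f : TRU -> 'cV[R]_d) : cmeas f -> cmeas (fun z => btw s t z.2.1 *: f z).
Proof. by move=> mf; apply: cmeasZ => //; exact: measurable_between. Qed.

Lemma nrm2_Eint hW hN (t : R) : elemW_ok F hW -> elemN_ok F nu hN -> 0 <= t ->
  (nrm2 P (Eint hW hN t) = nrm2 PL (fun z => btw 0 t z.2 *: valW hW z) +
     nrm2 PLN (fun z => btw 0 t z.2.1 *: valN hN z))%E.
Proof.
move=> okW okN t0; have F0 : 0 <= (0:R) by [].
have mc (k : R) : Fm F 0 (fun=> k) by exact: measurable_cst.
have b1 : bdd (fun _ : T => (1 : R)) by exists 1 => w; rewrite normr1.
have := @isometry_nrm2 hW hN 0 t (fun=> 1) (fun=> 0) okW okN F0 t0 (mc 1) b1.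
have z0 i j (w : T) : (fun=> 0 : 'cV[R]_d) w i j = 0 by rewrite mxE.
move=> /(_ _ _); rewrite (_ : nrm2 P (fun w => _) = nrm2 P (Eint hW hN t)); last first.
  by apply: eq_integral => w _; rewrite Eint0// subr0 scale1r add0r.
rewrite (_ : nrm2 P (fun=> 0) = 0%E) ?add0e; last first.
  by apply: integral0_eq => w _; rewrite frob_sqr big1// => i _; rewrite big1// => j _; rewrite mxE expr0n.
rewrite (_ : nrm2 PL (fun z => 1 *: (btw 0 t z.2 *: valW hW z)) = nrm2 PL (fun z => btw 0 t z.2 *: valW hW z)); last first.
  by apply: eq_integral => z _; rewrite scale1r.
rewrite (_ : nrm2 PLN (fun z => 1 *: (btw 0 t z.2.1 *: valN hN z)) = nrm2 PLN (fun z => btw 0 t z.2.1 *: valN hN z)); last first.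
  by apply: eq_integral => z _; rewrite scale1r.
apply; move=> i.
- by rewrite (_ : (fun _ => _) = fun=> 0)//; apply/funext => w; rewrite mxE.
- by rewrite (_ : (fun _ => _) = fun=> 0) ?L2_cst//; [exact: L2_cst|apply/funext => w; rewrite mxE].
Qed.

(** An increment of M needs one sequence serving both s and t, while the sequences granted at s and
    at t are unrelated. Their integrands have the same limit on ]0, s], so by the isometry their
    integrals at time s merge, and the limit is M s for both. *)
Lemma approximable_le (hW : nat -> elemW R d T) (hN : nat -> elemN R d T U) (s t : R) :
  0 <= s -> s <= t -> (forall k, elemW_ok F (hW k)) -> (forall k, elemN_ok F nu (hN k)) ->
  (fun k => nrm2 PL (fun z => btw 0 t z.2 *: (valW (hW k) z - HW z))) @ \oo --> 0%E ->
  (fun k => nrm2 PLN (fun z => btw 0 t z.2.1 *: (valN (hN k) z - HN z))) @ \oo --> 0%E ->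
  (fun k => nrm2 P (fun w => Eint (hW k) (hN k) s w - M s w)) @ \oo --> 0%E.
Proof.
move=> s0 st okW okN cW cN.
have [hW' [hN' [okW' okN' cW' cN' cM']]] := ap s0.
pose dW k := nrm2 PL (fun z => btw 0 t z.2 *: (valW (hW k) z - HW z)).
pose dN k := nrm2 PLN (fun z => btw 0 t z.2.1 *: (valN (hN k) z - HN z)).
pose dW' k := nrm2 PL (fun z => btw 0 s z.2 *: (valW (hW' k) z - HW z)).
pose dN' k := nrm2 PLN (fun z => btw 0 s z.2.1 *: (valN (hN' k) z - HN z)).
pose dM' k := nrm2 P (fun w => Eint (hW' k) (hN' k) s w - M s w).
apply: (@squeeze0e _ _ (fun k => 2%:E * (2%:E * dW k + 2%:E * dW' k + (2%:E * dN k + 2%:E * dN' k)) + 2%:E * dM' k)%E).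
- by move=> k; exact: nrm2_ge0.
- move=> k.
  have mW h : elemW_ok F h -> cmeas (valW h) by exact: elemW_val_cmeas.
  have mN h : elemN_ok F nu h -> cmeas (valN h) by exact: elemN_val_cmeas.
  rewrite (_ : nrm2 P _ = nrm2 P (fun w => Eint (subW (hW k) (hW' k)) (subN (hN k) (hN' k)) s w +
     (Eint (hW' k) (hN' k) s w - M s w))); last first.
    apply: eq_integral => w _; congr ((frob _) ^+ 2)%:E.
    by rewrite /Eint subW_int subN_int [elemW_int _ _ _ _ - _ + _]addrACA -opprD addrA subrK.
  apply: le_trans (nrm2D2 _ _ _) _.
  - by apply: Eint_cmeas => //; [exact: subW_ok|exact: subN_ok].
  - by apply: cmeasB; [exact: Eint_cmeas|exact: mM].
  apply: leeD => //; apply: lee_wpmul2l; first by rewrite lee_fin.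
  rewrite nrm2_Eint//; [|exact: subW_ok|exact: subN_ok]; apply: leeD.
    rewrite (_ : nrm2 PL _ = nrm2 PL (fun z => btw 0 s z.2 *: (valW (hW k) z - HW z) -
       btw 0 s z.2 *: (valW (hW' k) z - HW z))); last first.
      apply: eq_integral => z _; congr ((frob _) ^+ 2)%:E.
      by rewrite /valW subW_val -scalerBr opprB addrA subrK.
    apply: le_trans (nrm2B2 _ _ _) _; try by apply: mZW; apply: cmeasB => //; exact: mW.
    apply: leeD; last exact: lexx.
    apply: lee_wpmul2l; first by rewrite lee_fin.
    by apply: nrm2_btw_le => //; apply: cmeasB => //; exact: mW.
  rewrite (_ : nrm2 PLN _ = nrm2 PLN (fun z => btw 0 s z.2.1 *: (valN (hN k) z - HN z) -
     btw 0 s z.2.1 *: (valN (hN' k) z - HN z))); last first.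
    apply: eq_integral => z _; congr ((frob _) ^+ 2)%:E.
    by rewrite /valN subN_val -scalerBr opprB addrA subrK.
  apply: le_trans (nrm2B2 _ _ _) _; try by apply: mZN; apply: cmeasB => //; exact: mN.
  apply: leeD; last exact: lexx.
  apply: lee_wpmul2l; first by rewrite lee_fin.
  by apply: nrm2_btw_le => //; apply: cmeasB => //; exact: mN.
- have cmb (u1 u2 u3 u4 u5 : nat -> \bar R) : u1 @ \oo --> 0%E -> u2 @ \oo --> 0%E ->
    u3 @ \oo --> 0%E -> u4 @ \oo --> 0%E -> u5 @ \oo --> 0%E -> (fun k => 2%:E *
    (2%:E * u1 k + 2%:E * u2 k + (2%:E * u3 k + 2%:E * u4 k)) + 2%:E * u5 k)%E @ \oo --> 0%E.
    by move=> *; do ?[apply: cvg0eD|apply: cvg0eZ].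
  exact: (cmb _ _ _ _ _ cW cW' cN cN' cM').
Qed.

End limit.

Lemma sub_sub_sub (V : zmodType) (a b x y : V) : x - y = (a - b) - ((a - x) - (b - y)).
Proof. by rewrite !opprB -[b - y + _]addrA subrKA addrCA [a + _]addrC subrK addrC. Qed.

Section limit.
Context (R : realType) (d : nat) (dT : measure_display) (T : measurableType dT)
  (P : probability T R) (F : R -> set (set T)) (W : R -> T -> 'cV[R]_d)
  (dU : measure_display) (U : measurableType dU)
  (nu : {sigma_finite_measure set U -> \bar R}) (p : T -> R -> option U).
Hypothesis FS : forall t : R, 0 <= t -> sigma_algebra setT (F t) /\ F t `<=` measurable.
Hypothesis Fle : forall s t : R, 0 <= s -> s <= t -> F s `<=` F t.
Hypothesis BW : standard_brownian_motion P F W.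
Hypothesis pp : poisson_point_process P F nu p.
Hypothesis WN : indep_classes P (brownian_sigma W) (point_sigma p `[0, +oo[).
Notation lam := (@lebesgue_measure R).
Notation TR := (T * measurableTypeR R)%type.
Notation TRU := (T * (measurableTypeR R * U))%type.
Notation PL := (P \x lam)%E.
Notation lamnu := (product_sf lam nu).
Notation PLN := (P \x lamnu)%E.

Variables (HW : TR -> 'M[R]_d) (HN : TRU -> 'cV[R]_d) (M : R -> T -> 'cV[R]_d).

Hypotheses (mHW : cmeas HW) (mHN : cmeas HN) (mM : forall t, 0 <= t -> cmeas (M t)).
Hypothesis ap : approximable P F W nu p HW HN M.

Let m21 : measurable_fun setT (fun z : TRU => z.2.1).
Proof. exact: measurableT_comp. Qed.

Let mZW (s t : R) (f : TR -> 'M[R]_d) : cmeas f -> cmeas (fun z => btw s t z.2 *: f z).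
Proof. by move=> mf; apply: cmeasZ => //; exact: measurable_between. Qed.
Let mZN (s t : R) (f : TRU -> 'cV[R]_d) : cmeas f -> cmeas (fun z => btw s t z.2.1 *: f z).
Proof. by move=> mf; apply: cmeasZ => //; exact: measurable_between. Qed.

(** The elementary isometry is exact; replacing M by its approximation, then the elementary
    integrands by their limits, costs a factor 1 + e each time. *)
Lemma increment_nrm2 (s t : R) (beta : T -> R) (zeta : T -> 'cV[R]_d) :
  0 <= s -> s <= t -> Fm F s beta -> bdd beta ->
  (forall i : 'I_d, Fm F s (fun w => zeta w i 0)) ->
  (forall i : 'I_d, L2 P (fun w => zeta w i 0)) ->
  (nrm2 P (fun w => zeta w + beta w *: (M t w - M s w))%R <=
   nrm2 P zeta + (nrm2 PL (fun z => beta z.1 *: (btw s t z.2 *: HW z))%R +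
                  nrm2 PLN (fun z => beta z.1 *: (btw s t z.2.1 *: HN z))%R))%E.
Proof.
move=> s0 st mb [C bC] mz lz; have t0 := le_trans s0 st.
have mbeta := Fm_meas FS s0 mb.
have [hW [hN [okW okN cW cN ct]]] := ap t0.
have cs := approximable_le FS Fle BW pp WN mHW mHN mM ap s0 st okW okN cW cN.
have mW h : elemW_ok F h -> cmeas (valW h) by exact: elemW_val_cmeas.
have mN h : elemN_ok F nu h -> cmeas (valN h) by exact: elemN_val_cmeas.
pose Et k := nrm2 P (fun w => Eint W nu p (hW k) (hN k) t w - M t w).
pose Es k := nrm2 P (fun w => Eint W nu p (hW k) (hN k) s w - M s w).
pose dW k := nrm2 PL (fun z => btw 0 t z.2 *: (valW (hW k) z - HW z)).
pose dN k := nrm2 PLN (fun z => btw 0 t z.2.1 *: (valN (hN k) z - HN z)).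
have mz' : cmeas zeta by move=> i j; rewrite ord1; exact: (Fm_meas FS s0).
have mE r h g : elemW_ok F h -> elemN_ok F nu g -> 0 <= r -> cmeas (Eint W nu p h g r).
  by move=> oh og r0; exact: (Eint_cmeas FS BW pp).
have mdM k : cmeas (fun w => Eint W nu p (hW k) (hN k) t w - Eint W nu p (hW k) (hN k) s w).
  by apply: cmeasB; exact: mE.
have mME r k : 0 <= r -> cmeas (fun w => Eint W nu p (hW k) (hN k) r w - M r w).
  by move=> r0; apply: cmeasB; [exact: mE|exact: mM].

have n0 := nrm2_ge0; apply: lee_1eps; first by apply: adde_ge0; [|apply: adde_ge0]; exact: n0.
move=> e e0; have e1 : 0 <= 1 + e by rewrite addr_ge0// ltW.
have e2 : 0 <= 1 + e^-1 by rewrite addr_ge0// invr_ge0 ltW.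
have C2 : 0 <= C ^+ 2 by exact: sqr_ge0.
(* All approximation errors, with the large factors 1 + 1 / e: at fixed e they vanish as k grows,
   and e tends to 0 only afterwards. *)
pose v k := ((1 + e)%:E * ((1 + e^-1)%:E * ((C ^+ 2)%:E * dW k) + (1 + e^-1)%:E * ((C ^+ 2)%:E * dN k)) +
   (1 + e^-1)%:E * ((C ^+ 2)%:E * (2%:E * Et k + 2%:E * Es k)))%E.
apply: (@lee_cvg0 _ _ _ v); last 2 first.
- have cmb (k1 k2 : R) (u1 u2 u3 u4 : nat -> \bar R) : u1 @ \oo --> 0%E -> u2 @ \oo --> 0%E ->
    u3 @ \oo --> 0%E -> u4 @ \oo --> 0%E -> (fun k => (1 + e)%:E *
    (k1%:E * (k2%:E * u1 k) + k1%:E * (k2%:E * u2 k)) + k1%:E * (k2%:E * (2%:E * u3 k + 2%:E * u4 k)))%E @ \oo --> 0%E.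
    by move=> *; do ?[apply: cvg0eD|apply: cvg0eZ].
  exact: (cmb _ _ _ _ _ _ cW cN ct cs).
- apply: mule_ge0; first by rewrite lee_fin sqr_ge0.
  by apply: adde_ge0; [|apply: adde_ge0]; exact: n0.
move=> k; pose dE w := Eint W nu p (hW k) (hN k) t w - Eint W nu p (hW k) (hN k) s w.
pose dR w := (Eint W nu p (hW k) (hN k) t w - M t w) - (Eint W nu p (hW k) (hN k) s w - M s w).
have mdR : cmeas dR by apply: cmeasB; exact: mME.
have -> : nrm2 P (fun w => zeta w + beta w *: (M t w - M s w)) =
   nrm2 P (fun w => (zeta w + beta w *: dE w) + - (beta w *: dR w)).
  apply: eq_integral => w _; congr ((frob _) ^+ 2)%:E.
  rewrite -[RHS]addrA -scalerBr; congr (_ + _ *: _).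
  exact: sub_sub_sub.
apply: le_trans (nrm2D _ e0 _ _) _.
- exact: (cmeasD mz' (cmeasZ mbeta (mdM k))).
- exact: (cmeasN (cmeasZ mbeta mdR)).
rewrite nrm2N /dE (isometry_nrm2 FS Fle BW pp WN)//; last by exists C.
rewrite /v [X in (_ <= X)%E]addeA; apply: leeD; last first.
  apply: lee_wpmul2l; first by rewrite lee_fin.
  apply: le_trans (nrm2Z _ mbeta mdR bC) _; apply: lee_wpmul2l; first by rewrite lee_fin.
  by apply: nrm2B2; exact: mME.
rewrite expr2 EFinM -muleA -ge0_muleDr; last 2 first.
- apply: mule_ge0; first by rewrite lee_fin.
  by apply: adde_ge0; [|apply: adde_ge0]; exact: n0.
- by apply: adde_ge0; do 2!(apply: mule_ge0; [by rewrite lee_fin|]); exact: n0.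
apply: lee_wpmul2l; first by rewrite lee_fin.
rewrite ge0_muleDr; [|exact: n0|by apply: adde_ge0; exact: n0]; rewrite -[X in (_ <= X)%E]addeA; apply: leeD.
  by rewrite -[X in (X <= _)%E]mul1e; apply: lee_wpmul2r; [exact: n0|by rewrite lee_fin lerDl ltW].
rewrite ge0_muleDr; [|exact: n0|exact: n0]; rewrite [X in (_ <= X)%E]addeACA; apply: leeD.
  rewrite (_ : nrm2 PL _ =
     nrm2 PL (fun z => beta z.1 *: (btw s t z.2 *: HW z) + beta z.1 *: (btw s t z.2 *: (valW (hW k) z - HW z)))); last first.
    apply: eq_integral => z _; congr ((frob _) ^+ 2)%:E.
    by rewrite -scalerDr -scalerDr addrC subrK.
  have mB : measurable_fun setT (fun z : TR => beta z.1) by exact: measurable_beta.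
  apply: le_trans (nrm2D _ e0 _ _) _; try by apply: cmeasZ => //; apply: mZW => //; apply: cmeasB => //; exact: mW.
  apply: leeD => //; apply: lee_wpmul2l; first by rewrite lee_fin.
  apply: le_trans (nrm2Z _ mB _ (fun z => bC z.1)) _.
    by apply: mZW; apply: cmeasB => //; exact: mW.
  apply: lee_wpmul2l; first by rewrite lee_fin.
  by apply: nrm2_btw_le => //; apply: cmeasB => //; exact: mW.
rewrite (_ : nrm2 PLN _ =
   nrm2 PLN (fun z => beta z.1 *: (btw s t z.2.1 *: HN z) + beta z.1 *: (btw s t z.2.1 *: (valN (hN k) z - HN z)))); last first.
  apply: eq_integral => z _; congr ((frob _) ^+ 2)%:E.
  by rewrite -scalerDr -scalerDr addrC subrK.
have mB : measurable_fun setT (fun z : TRU => beta z.1) by exact: measurable_beta.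
apply: le_trans (nrm2D _ e0 _ _) _; try by apply: cmeasZ => //; apply: mZN => //; apply: cmeasB => //; exact: mN.
apply: leeD => //; apply: lee_wpmul2l; first by rewrite lee_fin.
apply: le_trans (nrm2Z _ mB _ (fun z => bC z.1)) _.
  by apply: mZN; apply: cmeasB => //; exact: mN.
apply: lee_wpmul2l; first by rewrite lee_fin.
by apply: nrm2_btw_le => //; apply: cmeasB => //; exact: mN.
Qed.

End limit.

(** * Integrands known up to countably many times *)

Section almost_every_time.
Context (R : realType).
Notation lam := (@lebesgue_measure R).

(** Applied to integrands containing left limits and [before_exit]: they inherit measurability in
    time from a jointly measurable function with which they agree off a countable set, and this set
    is Lebesgue null. *)
Lemma countable_eq_measurable (D : set (measurableTypeR R)) (f g : measurableTypeR R -> \bar R)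
    (E : set (measurableTypeR R)) :
  countable D -> measurable E -> measurable_fun E g -> (forall r, E r -> ~ D r -> f r = g r) ->
  measurable_fun E f.
Proof.
move=> cD mE mg fg _ Y mY.
have cm (A : set (measurableTypeR R)) : countable A -> measurable A.
  by apply: countable_measurable => x; exact: measurable_set1.
rewrite (_ : _ `&` _ = ((E `&` g @^-1` Y) `\` D) `|` ((E `&` f @^-1` Y) `&` D)).
  apply: measurableU; last by apply: cm; apply: sub_countable cD; apply: subset_card_le => x [].
  by apply: measurableD; [exact: mg|exact: cm].
apply/seteqP; split => x /=.
  move=> [Ex fx]; have [Dx|nDx] := pselect (D x); first by right.
  by left; rewrite -fg.
by move=> [[[Ex gx] nDx]|[]//]; split => //; rewrite fg.
Qed.

Lemma countable_eq_integral (D : set (measurableTypeR R)) (f g : measurableTypeR R -> \bar R)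
    (E : set (measurableTypeR R)) :
  countable D -> measurable E -> measurable_fun E g -> (forall r, E r -> ~ D r -> f r = g r) ->
  (\int[lam]_(r in E) f r = \int[lam]_(r in E) g r)%E.
Proof.
move=> cD mE mg fg; apply: ae_eq_integral => //.
  exact: countable_eq_measurable fg.
exists D; split.
- by apply: countable_measurable => // x; exact: measurable_set1.
- exact: countable_lebesgue_measure0.
- by move=> r /= /not_implyP[Er frg]; apply: contrapT => nD; apply: frg; exact: fg.
Qed.

End almost_every_time.

Section representatives.
Context (R : realType) (d : nat) (dT : measure_display) (T : measurableType dT)
  (P : probability T R) (F : R -> set (set T)) (W : R -> T -> 'cV[R]_d)
  (dU : measure_display) (U : measurableType dU)
  (nu : {sigma_finite_measure set U -> \bar R}) (p : T -> R -> option U).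
Hypothesis FS : forall t : R, 0 <= t -> sigma_algebra setT (F t) /\ F t `<=` measurable.
Hypothesis BW : standard_brownian_motion P F W.
Hypothesis pp : poisson_point_process P F nu p.
Notation lam := (@lebesgue_measure R).
Notation TR := (T * measurableTypeR R)%type.
Notation TRU := (T * (measurableTypeR R * U))%type.
Notation PL := (P \x lam)%E.
Notation lamnu := (product_sf lam nu).
Notation PLN := (P \x lamnu)%E.

Let m21 : measurable_fun setT (fun z : TRU => z.2.1).
Proof. exact: measurableT_comp. Qed.

(** The exceptional times may depend on w; the inner time integral ignores them for each w
    separately. *)
Lemma ito_representative (H : R -> T -> 'M[R]_d) (I : R -> T -> 'cV[R]_d) (HW : TR -> 'M[R]_d) :
  is_ito_integral P F W H I -> cmeas HW ->
  (forall w, exists2 D : set R, countable D & forall r, 0 < r -> ~ D r -> H r w = HW (w, r)) ->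
  forall t : R, 0 <= t -> exists h : nat -> elemW R d T, [/\ forall k, elemW_ok F (h k),
     (fun k => nrm2 PL (fun z => btw 0 t z.2 *: (valW (h k) z - HW z))) @ \oo --> 0%E &
     (fun k => nrm2 P (fun w => elemW_int W (h k) t w - I t w)) @ \oo --> 0%E].
Proof.
move=> [_ _ hI] mH eqH t t0; have [h [okh ch cI]] := hI t t0.
exists h; split => //.
rewrite (_ : (fun k => _) = (fun k => \int[P]_w \int[lam]_(r in `]0%R, t])
              (frob (elemW_val (h k) r w - H r w) ^+ 2)%:E)%E)//.
apply/funext => k; have mh := elemW_val_cmeas FS (okh k).
have mf : cmeas (fun z => valW (h k) z - HW z) by exact: cmeasB.
rewrite -(intW_nrm2 P 0 t mf); apply: eq_integral => w _.
have [D cD HD] := eqH w.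
apply/esym/(countable_eq_integral (D := D)) => //.
  apply/measurable_EFinP; apply: measurable_funTS.
  exact: (measurable_fun_pair2 w (cmeas_frob mf)).
by move=> r /=; rewrite in_itv/= => /andP[r0 _] nD; rewrite HD.
Qed.

Lemma poisson_representative (H : R -> U -> T -> 'cV[R]_d) (I : R -> T -> 'cV[R]_d) (HN : TRU -> 'cV[R]_d) :
  is_poisson_integral P F nu p H I -> cmeas HN ->
  (forall w, exists2 D : set R, countable D & forall r, 0 < r -> ~ D r -> forall u, H r u w = HN (w, (r, u))) ->
  forall t : R, 0 <= t -> exists h : nat -> elemN R d T U, [/\ forall k, elemN_ok F nu (h k),
     (fun k => nrm2 PLN (fun z => btw 0 t z.2.1 *: (valN (h k) z - HN z))) @ \oo --> 0%E &
     (fun k => nrm2 P (fun w => elemN_int nu p (h k) t w - I t w)) @ \oo --> 0%E].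
Proof.
move=> [_ _ hI] mH eqH t t0; have [h [okh ch cI]] := hI t t0.
exists h; split => //.
rewrite (_ : (fun k => _) = (fun k => \int[P]_w \int[lam]_(r in `]0%R, t])
              \int[nu]_u (frob (elemN_val (h k) r u w - H r u w) ^+ 2)%:E)%E)//.
apply/funext => k; have mh := elemN_val_cmeas FS (okh k).
have mf : cmeas (fun z => valN (h k) z - HN z) by exact: cmeasB.
rewrite -(intN_nrm2 P nu 0 t mf); apply: eq_integral => w _.
have [D cD HD] := eqH w.
have mg : measurable_fun setT (fun r : measurableTypeR R => \int[nu]_u (frob (valN (h k) (w, (r, u)) - HN (w, (r, u))) ^+ 2)%:E)%E.
  apply: (@measurable_fun_fubini_tonelli_F _ _ _ _ _ nu (fun y => (frob (valN (h k) (w, y) - HN (w, y)) ^+ 2)%:E)).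
    apply/measurable_EFinP; exact: (measurable_fun_pair2 w (cmeas_frob mf)).
  by move=> y; rewrite lee_fin sqr_ge0.
apply: esym; apply: (countable_eq_integral cD _ (measurable_funTS mg)); first exact: measurable_itv.
move=> r /=; rewrite in_itv/= => /andP[r0 _] nD; apply: eq_integral => u _.
by rewrite HD.
Qed.

Lemma approximableB (HW1 HW2 : TR -> 'M[R]_d) (HN1 HN2 : TRU -> 'cV[R]_d) (I1 I2 J1 J2 : R -> T -> 'cV[R]_d) :
  cmeas HW1 -> cmeas HW2 -> cmeas HN1 -> cmeas HN2 ->
  (forall t, 0 <= t -> [/\ cmeas (I1 t), cmeas (I2 t), cmeas (J1 t) & cmeas (J2 t)]) ->
  (forall t : R, 0 <= t -> exists h : nat -> elemW R d T, [/\ forall k, elemW_ok F (h k),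
     (fun k => nrm2 PL (fun z => btw 0 t z.2 *: (valW (h k) z - HW1 z))) @ \oo --> 0%E &
     (fun k => nrm2 P (fun w => elemW_int W (h k) t w - I1 t w)) @ \oo --> 0%E]) ->
  (forall t : R, 0 <= t -> exists h : nat -> elemW R d T, [/\ forall k, elemW_ok F (h k),
     (fun k => nrm2 PL (fun z => btw 0 t z.2 *: (valW (h k) z - HW2 z))) @ \oo --> 0%E &
     (fun k => nrm2 P (fun w => elemW_int W (h k) t w - I2 t w)) @ \oo --> 0%E]) ->
  (forall t : R, 0 <= t -> exists h : nat -> elemN R d T U, [/\ forall k, elemN_ok F nu (h k),
     (fun k => nrm2 PLN (fun z => btw 0 t z.2.1 *: (valN (h k) z - HN1 z))) @ \oo --> 0%E &
     (fun k => nrm2 P (fun w => elemN_int nu p (h k) t w - J1 t w)) @ \oo --> 0%E]) ->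
  (forall t : R, 0 <= t -> exists h : nat -> elemN R d T U, [/\ forall k, elemN_ok F nu (h k),
     (fun k => nrm2 PLN (fun z => btw 0 t z.2.1 *: (valN (h k) z - HN2 z))) @ \oo --> 0%E &
     (fun k => nrm2 P (fun w => elemN_int nu p (h k) t w - J2 t w)) @ \oo --> 0%E]) ->
  approximable P F W nu p (fun z => HW1 z - HW2 z) (fun z => HN1 z - HN2 z)
    (fun t w => (I1 t w - I2 t w) + (J1 t w - J2 t w)).
Proof.
move=> m1 m2' m3 m4 mI a1 a2 a3 a4 t t0.
have [h1 [ok1 c1 e1]] := a1 t t0; have [h2 [ok2 c2 e2]] := a2 t t0.
have [g1 [og1 d1 f1]] := a3 t t0; have [g2 [og2 d2 f2]] := a4 t t0.
have [n1 n2 n3 n4] := mI t t0.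
exists (fun k => subW (h1 k) (h2 k)), (fun k => subN (g1 k) (g2 k)).
have mW h : elemW_ok F h -> cmeas (valW h) by exact: elemW_val_cmeas.
have mN h : elemN_ok F nu h -> cmeas (valN h) by exact: elemN_val_cmeas.
have sub4 (V : zmodType) (a b x y : V) : (a - b) - (x - y) = (a - x) - (b - y).
  by rewrite !opprB (addrACA a (- b)) (addrACA a (- x)) (addrC (- b)).
have cmb (u1 u2 : nat -> \bar R) : u1 @ \oo --> 0%E -> u2 @ \oo --> 0%E ->
    (fun k => 2%:E * u1 k + 2%:E * u2 k)%E @ \oo --> 0%E.
  by move=> *; do ?[apply: cvg0eD|apply: cvg0eZ].
split.
- by move=> k; exact: subW_ok.
- by move=> k; exact: subN_ok.
- apply: (squeeze0e _ _ (cmb _ _ c1 c2)) => k; first exact: nrm2_ge0.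
  rewrite (_ : nrm2 PL _ = nrm2 PL (fun z => btw 0 t z.2 *: (valW (h1 k) z - HW1 z) -
     btw 0 t z.2 *: (valW (h2 k) z - HW2 z))); last first.
    apply: eq_integral => z _; congr ((frob _) ^+ 2)%:E.
    by rewrite /valW subW_val -scalerBr sub4.
  by apply: nrm2B2; apply: cmeasZ; [exact: measurable_between|apply: cmeasB => //; exact: mW
    |exact: measurable_between|apply: cmeasB => //; exact: mW].
- apply: (squeeze0e _ _ (cmb _ _ d1 d2)) => k; first exact: nrm2_ge0.
  rewrite (_ : nrm2 PLN _ = nrm2 PLN (fun z => btw 0 t z.2.1 *: (valN (g1 k) z - HN1 z) -
     btw 0 t z.2.1 *: (valN (g2 k) z - HN2 z))); last first.
    apply: eq_integral => z _; congr ((frob _) ^+ 2)%:E.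
    by rewrite /valN subN_val -scalerBr sub4.
  by apply: nrm2B2; apply: cmeasZ; [exact: measurable_between|apply: cmeasB => //; exact: mN
    |exact: measurable_between|apply: cmeasB => //; exact: mN].
have eW h : elemW_ok F h -> cmeas (elemW_int W h t).
  move=> oh; rewrite (_ : elemW_int W h t = Eint W nu p h [::] t); first exact: (Eint_cmeas FS BW pp).
  by apply/funext => w; rewrite /Eint /elemN_int big_nil addr0.
have eN (h : elemN R d T U) : elemN_ok F nu h -> cmeas (elemN_int nu p h t).
  move=> oh; rewrite (_ : elemN_int nu p h t = Eint W nu p [::] h t); first exact: (Eint_cmeas FS BW pp).
  by apply/funext => w; rewrite /Eint /elemW_int big_nil add0r.
have cmb2 := fun u1 u2 u3 u4 c1 c2 c3 c4 => cmb _ _ (cmb u1 u2 c1 c2) (cmb u3 u4 c3 c4).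
apply: (squeeze0e _ _ (cmb2 _ _ _ _ e1 e2 f1 f2)) => k; first exact: nrm2_ge0.
rewrite (_ : nrm2 P _ = nrm2 P (fun w => ((elemW_int W (h1 k) t w - I1 t w) - (elemW_int W (h2 k) t w - I2 t w)) +
   ((elemN_int nu p (g1 k) t w - J1 t w) - (elemN_int nu p (g2 k) t w - J2 t w)))); last first.
  apply: eq_integral => w _; congr ((frob _) ^+ 2)%:E.
  rewrite -(sub4 _ (elemW_int W (h1 k) t w)) -(sub4 _ (elemN_int nu p (g1 k) t w)) /Eint subW_int subN_int.
  by move: (elemW_int W (h1 k) t w - _) (elemN_int nu p (g1 k) t w - _) => x y; rewrite opprD addrACA.
apply: le_trans (nrm2D2 _ _ _) _.
- by do 2!apply: cmeasB; do ?exact: eW.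
- by do 2!apply: cmeasB; do ?exact: eN.
apply: leeD; apply: lee_wpmul2l; rewrite ?lee_fin//; apply: nrm2B2.
- by apply: cmeasB => //; exact: eW.
- by apply: cmeasB => //; exact: eW.
- by apply: cmeasB => //; exact: eN.
- by apply: cmeasB => //; exact: eN.
Qed.

End representatives.

(** * Cadlag paths *)

Section frobenius_topology.
Context (R : realType) (m n : nat).
Implicit Types A B : 'M[R]_(m, n).

Lemma frob0 : frob (0 : 'M[R]_(m, n)) = 0.
Proof.
apply/eqP; rewrite -sqrf_eq0 frob_sqr big1// => i _; rewrite big1// => j _.
by rewrite mxE expr0n.
Qed.

Lemma frob_eq0 A : frob A = 0 -> A = 0.
Proof.
move=> A0; apply/matrixP => i j; have := frob_coord A i j.
by rewrite A0 normr_le0 mxE => /eqP.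
Qed.

Lemma frobN A : frob (- A) = frob A.
Proof. by apply/eqP; rewrite -(@eqrXn2 _ 2)// ?frob_ge0// frob_sqrN. Qed.

Lemma frobB A B : frob (A - B) = frob (B - A).
Proof. by rewrite -frobN opprB. Qed.

(** Young's inequality [frob_sqrD] at its optimal weight, the ratio of the two norms, has the
    perfect square of the sum on the right. *)
Lemma frobD A B : frob (A + B) <= frob A + frob B.
Proof.
have [a0|a0] := eqVneq (frob A) 0; first by rewrite (frob_eq0 a0) add0r frob0 add0r.
have [b0|b0] := eqVneq (frob B) 0; first by rewrite (frob_eq0 b0) addr0 frob0 addr0.
have a1 : 0 < frob A by rewrite lt_def a0 frob_ge0.
have b1 : 0 < frob B by rewrite lt_def b0 frob_ge0.
rewrite -(@ler_pXn2r _ 2) ?nnegrE ?frob_ge0 ?addr_ge0 ?frob_ge0//.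
apply: le_trans (frob_sqrD A B (divr_gt0 b1 a1)) _; rewrite le_eqVlt; apply/orP; left; apply/eqP.
by field; rewrite a0 b0.
Qed.

Lemma frob_continuous : continuous (@frob R m n).
Proof.
rewrite (_ : @frob R m n = Num.sqrt \o (fun A => \sum_i \sum_j A i j ^+ 2)); last first.
  by apply/funext => A /=; rewrite -frob_sqr sqrtr_sqr ger0_norm// frob_ge0.
move=> A; apply: continuous_comp; last exact: sqrt_continuous.
apply: (continuous_big add_continuous) => i _; apply: (continuous_big add_continuous) => j _.
by move=> B; apply: (@continuous_comp _ _ _ (fun A : 'M[R]_(m, n) => A i j) (fun y : R => y ^+ 2) B); [exact: coord_continuous|exact: exprn_continuous].
Qed.

Lemma cvg_frob (S : Type) (G : set_system S) (FG : Filter G) (x : S -> 'M[R]_(m, n)) A :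
  x @ G --> A -> frob (x s - A) @[s --> G] --> (0 : R).
Proof.
move=> xA; have := cvg_comp _ _ (cvgB xA (cvg_cst A)) (@frob_continuous _) => /(_ _ _).
by rewrite subrr frob0.
Qed.

End frobenius_topology.

Lemma continuous_bounded_ball (R : realType) (d : nat) (f : 'cV[R]_d -> R) (N : R) :
  continuous f -> exists K : R, forall x, frob x <= N -> `|f x| <= K.
Proof.
move=> cf.
(* [rV_compact] gives compact boxes of row vectors; the ball of radius N lies in the transpose of
   the box with sides [-N, N]. *)
have tc : continuous (fun v : 'rV[R]_d => v^T).
  move=> v A /nbhs_ballP[e e0 he]; apply/nbhs_ballP; exists e => // u [_ vu]; apply: he.
  by split => // i j; rewrite !mxE; exact: vu.
have := @rV_compact R d (fun=> `[(- N), N]%classic) (fun=> @segment_compact _ _ _).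
move=> /(continuous_compact (continuous_subspaceT (fun v => continuous_comp (tc v) (cf v^T)))).
move=> /compact_bounded[K [_ hK]]; exists (K + 1) => x xN; apply: hK; first by rewrite ltrDl.
exists x^T => /=; last by rewrite trmxK.
by move=> i; rewrite in_itv/= mxE -ler_norml (le_trans (frob_coord _ _ _)).
Qed.

Section cadlag_paths.
Context (R : realType) (m n : nat) (x : R -> 'M[R]_(m, n)).

Lemma right_frob (t e : R) : x @ t^'+ --> x t -> 0 < e ->
  exists2 r, 0 < r & forall s, t <= s < t + r -> frob (x s - x t) < e.
Proof.
move=> /cvg_frob/cvgr0_norm_lt h e0; have [r /= r0 hr] := h _ e0.
exists r => // s /andP[]; rewrite le_eqVlt => /orP[/eqP <- _|ts st].
  by rewrite subrr frob0.
rewrite -[X in X < _]ger0_norm ?frob_ge0//; apply: hr => //=.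
by rewrite ltr0_norm ?subr_lt0// opprB ltrBlDl.
Qed.

Lemma left_frob (t e : R) : cvg (x @ t^'-) -> 0 < e ->
  exists2 r, 0 < r & forall s, t - r < s < t -> frob (x s - left_lim x t) < e.
Proof.
move=> /cvg_frob/cvgr0_norm_lt h e0; have [r /= r0 hr] := h _ e0.
exists r => // s /andP[ts st].
rewrite -[X in X < _]ger0_norm ?frob_ge0//; apply: hr => //=.
by rewrite gtr0_norm ?subr_gt0// ltrBlDr -ltrBlDl.
Qed.

Hypothesis cx : cadlag x.

(** The set J k q holds the times with a jump above 2 / (k + 1) after which the path moves by less
    than 1 / (k + 1) up to the rational q. It has at most one point: if r' < r both belong to it,
    the values at r and just before r are within 1 / (k + 1) of the value at r', so the jump at r is
    too small. *)
Lemma jumps_countable : countable [set r | 0 < r /\ left_lim x r <> x r].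
Proof.
pose J (k : nat) (q : rat) : set R := [set r | [/\ 0 < r, r < ratr q, 2 / k.+1%:R < frob (left_lim x r - x r)
   & forall s, r <= s < ratr q -> frob (x s - x r) < k.+1%:R^-1]].
apply: (@sub_countable _ _ _ (\bigcup_k \bigcup_q J k q)).
  apply: subset_card_le => r [r0 jr].
  have j0 : 0 < frob (left_lim x r - x r).
    by rewrite lt_def frob_ge0 andbT; apply/eqP => /frob_eq0/eqP; rewrite subr_eq0 => /eqP.
  pose k := Num.truncn (2 / frob (left_lim x r - x r)).
  have k0 : 2 / k.+1%:R < frob (left_lim x r - x r).
    by rewrite ltr_pdivrMr// mulrC -ltr_pdivrMr//; exact: truncnS_gt.
  have kk : 0 < k.+1%:R^-1 :> R by rewrite invr_gt0.
  have [e e0 he] := right_frob (cx.1 r (ltW r0)) kk.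
  have re : r < r + e by rewrite ltrDl.
  have [q] := rat_in_itvoo re; rewrite in_itv/= => /andP[rq qr].
  exists k => //; exists q => //; split => // s /andP[rs sq].
  by apply: he; rewrite rs (lt_trans sq).
apply: bigcup_countable => // k _; apply: bigcup_countable => // q _.
have J1 r r' : J k q r -> J k q r' -> r <= r'.
  move=> [r0 rq jr hr] [r'0 r'q jr' hr']; rewrite leNgt; apply/negP => rr'.
  have : 0 < frob (left_lim x r - x r) - 2 / k.+1%:R by rewrite subr_gt0.
  move=> /(left_frob (cx.2 r r0))[e e0 he].
  (* A time close enough to r on its left to see the left limit, yet not before r'. *)
  have [s1 s2] : r - e < Num.max r' (r - e / 2) < r /\ r' <= Num.max r' (r - e / 2) < ratr q.
    rewrite !lt_max !gt_max le_max lexx/= rr'; split.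
      by apply/andP; split; [apply/orP; right|]; lra.
    by rewrite (lt_trans rr' rq)/=; lra.
  move: (Num.max _ _) s1 s2 => s s1 s2.
  have h1 := he s s1; have h2 := hr' s s2.
  have h3 : frob (x r - x r') < k.+1%:R^-1 by apply: hr'; rewrite (ltW rr').
  have : frob (left_lim x r - x r) <= frob (x s - left_lim x r) + (frob (x s - x r') + frob (x r - x r')).
    rewrite -[left_lim x r - x r](subrKA (x s)) [frob (x s - left_lim x r)]frobB.
    apply: le_trans (frobD _ _) _; rewrite lerD2l -(subrKA (x r')).
    by apply: le_trans (frobD _ _) _; rewrite lerD2l frobB.
  by move: h1 h2 h3 => {J jr jr' hr hr'}; move: k.+1%:R^-1 => c; lra.
have [->//|/set0P[r Jr]] := eqVneq (J k q) set0.
rewrite (_ : J k q = [set r]) ?countable1//; apply/seteqP; split => [s Js|s ->//].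
by apply/eqP; rewrite /= eq_le; apply/andP; split; exact: J1.
Qed.

(** Take the supremum of the times up to which the path is bounded: the left limit there gives a
    bound up to it, and right continuity carries the bound beyond it, so it cannot be less than
    t. *)
Lemma cadlag_bounded (t : R) : 0 <= t -> exists K : nat, forall s, 0 <= s <= t -> frob (x s) <= K%:R.
Proof.
move=> t0; pose S := [set s | 0 <= s <= t /\ exists K : R, forall r, 0 <= r <= s -> frob (x r) <= K].
have fr s r : frob (x s) <= frob (x s - r) + frob r by rewrite -[in X in X <= _](subrK r (x s)); exact: frobD.
have S0 : S 0.
  split; first by rewrite lexx.
  by exists (frob (x 0)) => r; rewrite -eq_le => /eqP <-.
have Sb : has_sup S by split; [exists 0|exists t => s [/andP[]]].
have s0 : 0 <= sup S by exact: sup_upper_bound.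
have st : sup S <= t by apply: ge_sup; [exists 0|move=> s [/andP[]]].
have [K hK] : exists K : R, forall r, 0 <= r < sup S -> frob (x r) <= K.
  have [<-|sp] := eqVneq 0 (sup S).
    by exists 0 => r /andP[r0 /(le_lt_trans r0)]; rewrite ltxx.
  have s1 : 0 < sup S by rewrite lt_def eq_sym sp.
  have [e e0 he] := left_frob (cx.2 _ s1) (@ltr01 R).
  have [u [ut [K hK]] su] := sup_adherent e0 Sb.
  exists (Num.max K (1 + frob (left_lim x (sup S)))) => r /andP[r0 rs]; rewrite le_max.
  have [ru|ur] := leP r u; first by rewrite hK ?r0.
  apply/orP; right; apply: le_trans (fr _ (left_lim x (sup S))) _; rewrite lerD2r ltW//.
  by apply: he; rewrite rs (lt_trans su).
have [e e0 he] := right_frob (cx.1 _ s0) (@ltr01 R).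
pose K' := Num.max K (1 + frob (x (sup S))).
have hK' r : 0 <= r < sup S + e -> frob (x r) <= K'.
  move=> /andP[r0 re]; rewrite le_max; have [rs|sr] := ltP r (sup S); first by rewrite hK ?r0.
  apply/orP; right; apply: le_trans (fr _ (x (sup S))) _; rewrite lerD2r ltW//.
  by apply: he; rewrite sr.
have tS : t < sup S + e.
  rewrite ltNge; apply/negP => et.
  have : S (sup S + e / 2).
    split; first by apply/andP; split; lra.
    by exists K' => r /andP[r0 rs]; apply: hK'; rewrite r0/=; lra.
  by move=> /(sup_upper_bound Sb); lra.
exists (Num.truncn K').+1 => s /andP[s1 s2]; apply: le_trans (hK' s _) _.
  by rewrite s1 (le_lt_trans s2).
by rewrite ltW// truncnS_gt.
Qed.

End cadlag_paths.

(** * Joint measurability and survival in the ball *)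

Lemma joint_measurable (R : realType) (dT dS : measure_display) (T : measurableType dT) (S : measurableType dS)
    (m n : nat) (X : R -> T -> 'M[R]_(m, n)) (Phi : 'M[R]_(m, n) -> S -> R) :
  (forall w t, 0 <= t -> X ^~ w @ t^'+ --> X t w) -> (forall u, continuous (Phi ^~ u)) ->
  (forall q, 0 <= q -> measurable_fun setT (fun y : T * S => Phi (X q y.1) y.2)) ->
  measurable_fun setT (fun z : T * (measurableTypeR R * S) => Phi (X (Num.max z.2.1 0) z.1) z.2.2).
Proof.
move=> rX cPhi mPhi.
(* The first point of the grid of step 1 / (k + 1) strictly after r, so that right continuity gives
   the limit. *)
pose q k (r : R) : R := (Num.truncn (k.+1%:R * r)).+1%:R / k.+1%:R.
have k1 k : 0 < k.+1%:R :> R by [].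
apply: (measurable_fun_cvg (h := fun k (z : T * (measurableTypeR R * S)) => Phi (X (q k (Num.max z.2.1 0)) z.1) z.2.2)).
  move=> k _ Y mY; rewrite setTI.
  pose h (z : T * (measurableTypeR R * S)) : R := k.+1%:R * Num.max z.2.1 0.
  have mh : measurable_fun setT h.
    apply: measurable_funM => //; apply: measurable_maxr => //.
    exact: (measurableT_comp (@measurable_fst _ _ _ _) (@measurable_snd _ _ _ _)).
  have h0 z : 0 <= h z by rewrite mulr_ge0// le_max lexx orbT.
  (* On each slab of times the approximation is the process at one fixed grid time. *)
  rewrite (_ : _ @^-1` Y = \bigcup_i ((h @^-1` `[i%:R, i.+1%:R[) `&`
     ((fun z => Phi (X (i.+1%:R / k.+1%:R) z.1) z.2.2) @^-1` Y))); last first.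
    apply/seteqP; split => [z /= Yz|z [i _ [/= hz Yz]]].
      exists (Num.truncn (h z)) => //; split => //=; rewrite in_itv/=; exact: truncn_itv.
    by move: hz; rewrite in_itv/= /q => /(truncn_def) ->.
  apply: bigcupT_measurable => i; apply: measurableI.
    by rewrite -[X in measurable X]setTI; apply: mh => //; exact: measurable_itv.
  rewrite -[X in measurable X]setTI.
  have mg : measurable_fun setT (fun z : T * (measurableTypeR R * S) => (z.1, z.2.2)).
    apply: measurable_fun_pair; first exact: measurable_fst.
    exact: (measurableT_comp (@measurable_snd _ _ _ _) (@measurable_snd _ _ _ _)).
  have q0 : 0 <= i.+1%:R / k.+1%:R :> R by rewrite divr_ge0.
  exact: (measurableT_comp (mPhi _ q0) mg).
move=> [w [r0 u]] _ /=; set r := Num.max r0 0; have r1 : 0 <= r by rewrite le_max lexx orbT.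
have qr : q ^~ r @ \oo --> r^'+.
  move=> A [e /= e0 he]; have := near_infty_natSinv_lt (PosNum e0); apply: filterS => k /= ke.
  have kr : 0 <= k.+1%:R * r by rewrite mulr_ge0.
  have /andP[t1 t2] := truncn_itv kr.
  have rq : r < q k r by rewrite /q ltr_pdivlMr// mulrC.
  apply: he => //=; rewrite ltr0_norm ?subr_lt0// opprB.
  apply: le_lt_trans ke; rewrite lerBlDr /q ler_pdivrMr// mulrDl mulVf ?lt0r_neq0// -natr1.
  by rewrite addrC lerD2l [r * _]mulrC.
apply: (cvg_comp (fun k => X (q k r) w) (Phi ^~ u)); last exact: cPhi.
exact: (cvg_comp _ _ qr (rX w r r1)).
Qed.

Section alive.
Context (R : realType) (d : nat) (dT : measure_display) (T : measurableType dT)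
  (X : R -> T -> 'cV[R]_d) (n : nat).
Hypothesis cX : forall w, cadlag (fun t => X t w).

(* Agrees with before_exit except at the exit time itself, and is determined by
   the path on the closed interval [0, r]. *)
Definition alive (r : R) (w : T) := forall s, 0 <= s <= r -> frob (X s w) <= n%:R.
Definition alive_ind (r : R) (w : T) : R := \1_[set w | alive r w] w.

Lemma alive_ind1 r w : alive r w -> alive_ind r w = 1.
Proof. by move=> h; rewrite /alive_ind indicE mem_set. Qed.

Lemma alive_ind0 r w : ~ alive r w -> alive_ind r w = 0.
Proof. by move=> h; rewrite /alive_ind indicE memNset. Qed.

Lemma alive_ind_itv r w : 0 <= alive_ind r w <= 1.
Proof. by rewrite /alive_ind indicE; case: (_ \in _); rewrite lexx ler01. Qed.

Lemma alive_le s t w : s <= t -> alive t w -> alive s w.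
Proof. by move=> st h r /andP[r0 rs]; apply: h; rewrite r0 (le_trans rs). Qed.

(** By right continuity an excess at s < r persists to a rational between s and r. The time r is
    tested separately, since an excess there would be visible at rationals only after r. *)
Lemma alive_ratP r w : 0 <= r -> alive r w <->
  frob (X r w) <= n%:R /\ forall q : rat, 0 <= (ratr q : R) <= r -> frob (X (ratr q) w) <= n%:R.
Proof.
move=> r0; split => [h|[hr hq] s /andP[s0]].
  by split => [|q]; [apply: h; rewrite r0 lexx|exact: h].
rewrite le_eqVlt => /orP[/eqP -> //|sr]; rewrite leNgt; apply/negP => ns.
have ns' : 0 < frob (X s w) - n%:R by rewrite subr_gt0.
have [e e0 he] := right_frob ((cX w).1 s s0) ns'.
have sm : s < Num.min r (s + e) by rewrite lt_min sr ltrDl.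
have [q] := rat_in_itvoo sm; rewrite in_itv/= lt_min => /and3P[sq qr qe].
have := he (ratr q); rewrite (ltW sq) qe => /(_ isT).
have := hq q; rewrite (ltW qr) (le_trans s0 (ltW sq)) => /(_ isT).
have := frobD (X s w - X (ratr q) w) (X (ratr q) w); rewrite subrK frobB.
lra.
Qed.

End alive.

Lemma bigcap_rat_measurable (dT : measure_display) (T : measurableType dT) (D : set rat) (A : rat -> set T) :
  (forall q, D q -> measurable (A q)) -> measurable (\bigcap_(q in D) A q).
Proof.
move=> mA; rewrite -[X in measurable X]setCK setC_bigcap bigcup_mkcond; apply: measurableC.
apply: bigcupT_measurable_rat => q; case: ifPn => // /set_mem Dq.
by apply: measurableC; exact: mA.
Qed.

(** The measurable space is arbitrary and only times up to r are involved, so that [F r] itself can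
    be taken as the sigma-algebra. *)
Lemma alive_measurable (R : realType) (d : nat) (dT : measure_display) (T : measurableType dT)
    (X : R -> T -> 'cV[R]_d) (n : nat) (r : R) : (forall w, cadlag (fun t => X t w)) -> 0 <= r ->
  (forall q, 0 <= q <= r -> measurable_fun setT (fun w => frob (X q w))) ->
  measurable_fun setT (alive_ind X n r).
Proof.
move=> cX r0 mX; apply: measurable_indic.
have mle q : 0 <= q <= r -> measurable [set w | frob (X q w) <= n%:R].
  move=> /mX m; rewrite (_ : mkset _ = setT `&` (fun w => frob (X q w)) @^-1` `]-oo, n%:R]).
    by apply: m => //; exact: measurable_itv.
  by apply/seteqP; split => w /=; rewrite in_itv/= => // -[].
rewrite (_ : mkset _ = [set w | frob (X r w) <= n%:R] `&`
   \bigcap_(q in [set q : rat | 0 <= (ratr q : R) <= r]) [set w | frob (X (ratr q) w) <= n%:R]); last first.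
  by apply/seteqP; split => w /=; rewrite alive_ratP.
apply: measurableI; first by apply: mle; rewrite r0 lexx.
by apply: bigcap_rat_measurable => q; exact: mle.
Qed.

Lemma joint_measurable1 (R : realType) (dT : measure_display) (T : measurableType dT)
    (m n : nat) (X : R -> T -> 'M[R]_(m, n)) (phi : 'M[R]_(m, n) -> R) :
  (forall w t, 0 <= t -> X ^~ w @ t^'+ --> X t w) -> continuous phi ->
  (forall q, 0 <= q -> measurable_fun setT (fun w : T => phi (X q w))) ->
  measurable_fun setT (fun z : T * measurableTypeR R => phi (X (Num.max z.2 0) z.1)).
Proof.
move=> rX cphi mphi.
have := @joint_measurable R _ _ T unit m n X (fun A _ => phi A) rX (fun=> cphi).
have mg : measurable_fun setT (fun z : T * measurableTypeR R => (z.1, (z.2, tt))).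
  apply: measurable_fun_pair; first exact: measurable_fst.
  apply: measurable_fun_pair; first exact: measurable_snd.
  exact: measurable_cst.
move=> h; apply: (measurableT_comp (h _) mg) => q q0.
by apply: (measurableT_comp (mphi q q0)); exact: measurable_fst.
Qed.

Lemma alive_joint_measurable (R : realType) (d : nat) (dT : measure_display) (T : measurableType dT)
    (X : R -> T -> 'cV[R]_d) (n : nat) : (forall w, cadlag (fun t => X t w)) ->
  (forall q, 0 <= q -> measurable_fun setT (fun w => frob (X q w))) ->
  measurable_fun setT (fun z : T * measurableTypeR R => alive_ind X n (Num.max z.2 0) z.1).
Proof.
move=> cX mX.
have mF := joint_measurable1 (fun w t t0 => (cX w).1 t t0) (@frob_continuous R d 1) mX.
rewrite (_ : (fun _ => _) = \1_[set z : T * measurableTypeR R | alive X n (Num.max z.2 0) z.1]); last first.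
  by apply/funext => z; rewrite /alive_ind !indicE; congr (_%:R); apply/idP/idP; rewrite !inE.
apply: measurable_indic.
rewrite (_ : mkset _ = [set z : T * measurableTypeR R | frob (X (Num.max z.2 0) z.1) <= n%:R] `&`
   \bigcap_(q in [set q : rat | 0 <= (ratr q : R)])
     [set z : T * measurableTypeR R | (frob (X (ratr q) z.1) <= n%:R) || (Num.max z.2 0 < ratr q)]); last first.
  apply/seteqP; split => z /=; rewrite alive_ratP ?le_max ?lexx ?orbT//.
    move=> [h1 h2]; split => // q /= q0; case: leP => /= qr; rewrite ?orbT// orbF.
    by rewrite h2 ?q0.
  move=> [h1 h2]; split => // q /andP[q0 qr]; have := h2 q q0.
  by rewrite /= ltNge qr orbF.
have mle (S : measurableType _) (f : S -> R) (c : R) : measurable_fun setT f -> measurable [set z | f z <= c].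
  move=> m; rewrite (_ : mkset _ = setT `&` f @^-1` `]-oo, c]).
    by apply: m => //; exact: measurable_itv.
  by apply/seteqP; split => w /=; rewrite in_itv/= => // -[].
apply: measurableI; first exact: mle.
apply: bigcap_rat_measurable => q q0; rewrite (_ : mkset _ = [set z : T * measurableTypeR R | frob (X (ratr q) z.1) <= n%:R] `|`
   ~` [set z : T * measurableTypeR R | - Num.max z.2 0 <= - ratr q]); last first.
  apply/seteqP; split => z /=; rewrite lerN2 ltNge.
    by move=> /orP[|/negP]; [left|right].
  by move=> [->//|/negP ->]; rewrite orbT.
apply: measurableU.
  by apply: mle; apply: (measurableT_comp (mX _ q0)); exact: measurable_fst.
apply: measurableC; apply: mle; apply: measurableT_comp => //.
by apply: measurable_maxr => //; exact: measurable_snd.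
Qed.

Section exit.
Context (R : realType) (d : nat) (dT : measure_display) (T : measurableType dT)
  (X : R -> T -> 'cV[R]_d) (n : nat).

Lemma alive_le_exit r w : alive X n r w -> (r%:E <= exit_time X n w)%E.
Proof.
move=> h; apply: le_ereal_inf_tmp => _ [t [t0 nt] <-]; rewrite lee_fin leNgt; apply/negP => tr.
by have := h t; rewrite t0 ltW// leNgt nt => /(_ isT).
Qed.

Lemma before_exit_alive r w : 0 <= r -> r%:E <> exit_time X n w ->
  before_exit X n r w = alive_ind X n r w.
Proof.
move=> r0 nr; rewrite /before_exit; have [h|h] := pselect (alive X n r w).
  by rewrite alive_ind1// alive_le_exit.
rewrite alive_ind0//; case: leP => // rx; exfalso; apply: nr; apply/le_anti.
rewrite rx/=; move: h => /existsNP[s /not_implyP[/andP[s0 sr] /negP]]; rewrite -ltNge => ns.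
by apply: le_trans (_ : s%:E <= _)%E; [apply: ereal_inf_lbound; exists s|rewrite lee_fin].
Qed.

Lemma stopped_alive s t w : s <= t -> alive X n t w -> stopped_at X n s w = s.
Proof.
move=> st /alive_le_exit h; rewrite /stopped_at (min_idPl _)//.
by apply: le_trans h; rewrite lee_fin.
Qed.

Lemma exit_countable w : countable [set r : R | r%:E = exit_time X n w].
Proof.
have [->|/set0P[r hr]] := eqVneq [set r : R | r%:E = exit_time X n w] set0; first exact: countable0.
rewrite (_ : mkset _ = [set r]) ?countable1//; apply/seteqP; split => [s /= hs|s ->//].
by have := etrans hs (esym hr) => -[].
Qed.

Lemma integrand_alive (V : lmodType R) (f : 'cV[R]_d -> V) w :
  exists2 D : set R, countable D & forall r, 0 < r -> ~ D r ->
    before_exit X n r w *: f (X r w) = alive_ind X n (Num.max r 0) w *: f (X (Num.max r 0) w).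
Proof.
exists [set r : R | r%:E = exit_time X n w]; first exact: exit_countable.
move=> r r0 nD; rewrite (max_idPl (ltW r0)); congr (_ *: _).
by apply: before_exit_alive => //; exact: ltW.
Qed.

Lemma left_integrand_alive (U : Type) (V : lmodType R) (f : 'cV[R]_d -> U -> V) w : cadlag (fun t => X t w) ->
  exists2 D : set R, countable D & forall r, 0 < r -> ~ D r -> forall u,
    before_exit X n r w *: f (left_lim (fun s => X s w) r) u = alive_ind X n (Num.max r 0) w *: f (X (Num.max r 0) w) u.
Proof.
move=> cX; exists ([set r : R | r%:E = exit_time X n w] `|` [set r | 0 < r /\ left_lim (fun s => X s w) r <> X r w]).
  rewrite -bigcup2E; apply: bigcup_countable => // -[|[|i]] _ /=; last exact: countable0.
    exact: exit_countable.
  exact: jumps_countable.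
move=> r r0 /not_orP[nD nJ] u; rewrite (max_idPl (ltW r0)) before_exit_alive//; last exact: ltW.
by rewrite (_ : left_lim _ r = X r w)//; apply: contrapT => h; apply: nJ.
Qed.

End exit.

(** * Bounds on a ball *)

Section ball_bounds.
Context (R : realType) (d : nat) (dU : measure_display) (U : measurableType dU)
  (nu : {sigma_finite_measure set U -> \bar R})
  (b : 'cV[R]_d -> 'cV[R]_d) (sigma : 'cV[R]_d -> 'M[R]_d) (c : 'cV[R]_d -> U -> 'cV[R]_d).
Hypotheses (b_cont : continuous b) (sigma_cont : continuous sigma)
  (c_meas : forall i : 'I_d, measurable_fun setT (fun xu : borelRd R d * U => c xu.1 xu.2 i 0))
  (c_sq_fin : forall x, (int_sq nu (c x) < +oo)%E)
  (c_sq_cont : continuous (fun x => fine (int_sq nu (c x)))).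

Lemma coefficient_bounds (N : R) : exists2 K : R, 0 < K & forall x, frob x <= N ->
  [/\ frob (b x) <= K, frob (sigma x) ^+ 2 <= K & (int_sq nu (c x) <= K%:E)%E].
Proof.
have cfb : continuous (fun x => frob (b x)).
  by move=> x; apply: continuous_comp; [exact: b_cont|exact: frob_continuous].
have cfs : continuous (fun x => frob (sigma x)).
  by move=> x; apply: continuous_comp; [exact: sigma_cont|exact: frob_continuous].
have [K1 h1] := continuous_bounded_ball N cfb.
have [K2 h2] := continuous_bounded_ball N cfs.
have [K3 h3] := continuous_bounded_ball N c_sq_cont.
exists (`|K1| + K2 ^+ 2 + `|K3| + 1).
  by rewrite ltr_wpDl// !addr_ge0// sqr_ge0.
move=> x xN; have k1 := normr_ge0 K1; have k2 := sqr_ge0 K2; have k3 := normr_ge0 K3.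
split.
- have := h1 x xN; rewrite ger0_norm ?frob_ge0// => h.
  by have := ler_norm K1; lra.
- have := h2 x xN; rewrite ger0_norm ?frob_ge0// => h.
  have : frob (sigma x) ^+ 2 <= K2 ^+ 2.
    by rewrite ler_pXn2r ?nnegrE ?frob_ge0// (le_trans _ h)// frob_ge0.
  lra.
- have fin : int_sq nu (c x) \is a fin_num by rewrite ge0_fin_numE ?c_sq_fin//; exact: nrm2_ge0.
  rewrite -(fineK fin) lee_fin; have := h3 x xN; have := ler_norm (fine (int_sq nu (c x))).
  by have := ler_norm K3; lra.
Qed.

Lemma dotpE (x y : 'cV[R]_d) : dotp x y = \sum_i x i 0 * y i 0.
Proof. by rewrite /dotp mxE; apply: eq_bigr => i _; rewrite mxE. Qed.

Lemma dotp_le (x y : 'cV[R]_d) : `|dotp x y| <= d%:R * (frob x * frob y).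
Proof.
rewrite dotpE; apply: le_trans (ler_norm_sum _ _ _) _.
apply: (@le_trans _ _ (\sum_(i < d) frob x * frob y)).
  by apply: ler_sum => i _; rewrite normrM ler_pM// frob_coord.
by rewrite sumr_const card_ord mulr_natl.
Qed.

Lemma c_cmeas x : cmeas (c x).
Proof. by move=> i j; rewrite ord1; exact: (measurable_fun_pair2 (x : borelRd R d) (c_meas i)). Qed.

(** The weights p and q are there for the survival indicators of the two paths, which need not
    coincide. *)
Lemma int_sq_diff (x z : 'cV[R]_d) (K p q : R) : 0 <= p <= 1 -> 0 <= q <= 1 ->
  (int_sq nu (c x) <= K%:E)%E -> (int_sq nu (c z) <= K%:E)%E ->
  (int_sq nu (fun u => (p *: c x u - q *: c z u)%R) <= (4 * K)%:E)%E.
Proof.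
move=> p01 q01 hx hz.
have Zle (y : 'cV[R]_d) (k : R) : 0 <= k <= 1 -> (int_sq nu (c y) <= K%:E)%E ->
    cmeas (fun u => k *: c y u) /\ (nrm2 nu (fun u => k *: c y u) <= K%:E)%E.
  move=> /andP[k0 k1] hy; split; first by apply: cmeasZ => //; exact: c_cmeas.
  apply: le_trans (nrm2Z (K := 1) _ _ _ _) _ => //; first exact: c_cmeas.
  - by move=> _; rewrite ger0_norm.
  - by rewrite expr1n mul1e.
have [mx nx] := Zle x p p01 hx; have [mz nz] := Zle z q q01 hz.
apply: le_trans (nrm2B2 _ mx mz) _.
rewrite (_ : (4 * K)%:E = 2%:E * K%:E + 2%:E * K%:E)%E; last by rewrite -!EFinM -EFinD; congr EFin; ring.
by apply: leeD; (apply: lee_wpmul2l; first by rewrite lee_fin); [exact: nx|exact: nz].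
Qed.

(** Removes the restriction to nearby points: for points of the ball further apart than delta0 the
    left side is bounded, while rho at the squared distance is at least rho (delta0^2) > 0, so a
    larger constant suffices. *)
Lemma modulus_on_ball (N : R) (delta0 : R) (rho : R -> R) (kappa : R) :
  0 < delta0 -> 0 < kappa -> (forall r, 0 <= r -> 0 <= rho r) -> nondecreasing_on_nonneg rho -> (forall r, 0 < r -> 0 < rho r) ->
  (forall x z : 'cV[R]_d, Num.max (frob x) (frob z) <= N -> frob (x - z) <= delta0 ->
     ((2 * dotp (x - z) (b x - b z) + frob (sigma x - sigma z) ^+ 2)%:E
        + int_sq nu (fun u => (c x u - c z u)%R) <= (kappa * rho (frob (x - z) ^+ 2))%:E)%E) ->
  exists2 k : R, 0 < k & forall x z : 'cV[R]_d, frob x <= N -> frob z <= N ->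
     ((2 * dotp (x - z) (b x - b z) + frob (sigma x - sigma z) ^+ 2)%:E
        + int_sq nu (fun u => (c x u - c z u)%R) <= (k * rho (frob (x - z) ^+ 2))%:E)%E.
Proof.
move=> d0 k0 rge0 rmono rpos H; have [K K0 hK] := coefficient_bounds N.
have rd : 0 < rho (delta0 ^+ 2) by apply: rpos; rewrite exprn_gt0.
pose C := 2 * (d%:R * ((N + N) * (K + K))) + 4 * K + 4 * K.
pose k := kappa + `|C| / rho (delta0 ^+ 2).
have kk : kappa <= k by rewrite lerDl divr_ge0// ltW.
exists k; first exact: lt_le_trans kk.
move=> x z xN zN; have [dz|dz] := leP (frob (x - z)) delta0.
  apply: le_trans (H x z _ dz) _; first by rewrite ge_max xN.
  by rewrite lee_fin ler_wpM2r// rge0// sqr_ge0.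
have [bx sx cx] := hK x xN; have [bz sz cz] := hK z zN.
have fB m n (A B : 'M[R]_(m, n)) : frob (A - B) <= frob A + frob B by rewrite -(frobN B); exact: frobD.
have h1 : 2 * dotp (x - z) (b x - b z) <= 2 * (d%:R * ((N + N) * (K + K))).
  apply: ler_wpM2l => //; apply: le_trans (ler_norm _) _; apply: le_trans (dotp_le _ _) _.
  rewrite ler_wpM2l// ler_pM ?frob_ge0//; apply: le_trans (fB _ _ _ _) _; exact: lerD.
have h2 : frob (sigma x - sigma z) ^+ 2 <= 4 * K.
  have := frob_sqrD (sigma x) (- sigma z) (@ltr01 R); rewrite frob_sqrN invr1; lra.
have h3 : (int_sq nu (fun u => (c x u - c z u)%R) <= (4 * K)%:E)%E.
  have o1 : 0 <= (1 : R) <= 1 by rewrite ler01 lexx.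
  rewrite (_ : (fun u => _) = (fun u => 1 *: c x u - 1 *: c z u)).
    exact: int_sq_diff.
  by apply/funext => u; rewrite !scale1r.
have hk : C <= k * rho (frob (x - z) ^+ 2).
  apply: le_trans (ler_norm _) _.
  have rr : rho (delta0 ^+ 2) <= rho (frob (x - z) ^+ 2).
    by apply: rmono; rewrite ?sqr_ge0// ler_pXn2r ?nnegrE ?frob_ge0// ltW.
  apply: (@le_trans _ _ (`|C| / rho (delta0 ^+ 2) * rho (frob (x - z) ^+ 2))).
    by rewrite -mulrA ler_peMr// ler_pdivlMl// mulr1.
  rewrite ler_wpM2r//; first by apply: le_trans rr; exact: ltW.
  by rewrite lerDr ltW.
apply: (@le_trans _ _ C%:E); last by rewrite lee_fin; exact: hk.
by rewrite /C (EFinD _ (4 * K)); apply: leeD => //; rewrite lee_fin lerD.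
Qed.

End ball_bounds.

(** * One step along a partition *)

Section time_integral.
Context (R : realType) (dT : measure_display) (T : measurableType dT) (P : probability T R) (s t : R).
Notation lam := (@lebesgue_measure R).
Notation TR := (T * measurableTypeR R)%type.
Implicit Types f g : TR -> R.

Definition bmeas f := measurable_fun setT f /\ exists K : R, forall z, `|f z| <= K.
Definition tint f (w : T) : R := (\int[lam]_(r in `]s, t]) f (w, r))%R.

Let mI : measurable (`]s, t]%classic : set (measurableTypeR R)).
Proof. exact: measurable_itv. Qed.

Let fI : (lam (`]s, t]%classic : set (measurableTypeR R)) < +oo)%E.
Proof. by rewrite lebesgue_measure_itv/=; case: ifP => _; rewrite ?ltry// ?ltry. Qed.

Lemma bmeas_cst (k : R) : bmeas (fun=> k).
Proof. by split; [exact: measurable_cst|exists `|k|]. Qed.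

Lemma bmeasD f g : bmeas f -> bmeas g -> bmeas (fun z => f z + g z).
Proof.
move=> [mf [K hK]] [mg [L hL]]; split; first exact: measurable_funD.
by exists (K + L) => z; apply: le_trans (ler_normD _ _) _; exact: lerD.
Qed.

Lemma bmeasM f g : bmeas f -> bmeas g -> bmeas (fun z => f z * g z).
Proof.
move=> [mf [K hK]] [mg [L hL]]; split; first exact: measurable_funM.
by exists (K * L) => z; rewrite normrM ler_pM.
Qed.

Lemma bmeasZ (k : R) f : bmeas f -> bmeas (fun z => k * f z).
Proof. by move=> hf; apply: bmeasM => //; exact: bmeas_cst. Qed.

Lemma bmeas_sum (I : Type) (r : seq I) (f : I -> TR -> R) : (forall i, bmeas (f i)) ->
  bmeas (fun z => \sum_(i <- r) f i z).
Proof.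
move=> hf; elim: r => [|i r ih].
  by under [X in bmeas X]eq_fun do rewrite big_nil; exact: bmeas_cst.
by under [X in bmeas X]eq_fun do rewrite big_cons; exact: bmeasD.
Qed.

Let msec f w : bmeas f -> measurable_fun setT (fun r : measurableTypeR R => f (w, r)).
Proof. by move=> [mf _]; exact: measurable_fun_pair2. Qed.

Lemma tint_integrable f w : bmeas f -> lam.-integrable `]s, t] (fun r => (f (w, r))%:E).
Proof.
move=> hf; have [_ [K hK]] := hf.
apply: (@measurable_bounded_integrable _ _ _ lam (fun r => f (w, r))) => //.
  by apply: measurable_funTS; exact: msec.
exists K; split; first exact: num_real.
by move=> M KM r _ /=; apply: le_trans (hK _) (ltW KM).
Qed.

Lemma tintE f w : bmeas f -> (\int[lam]_(r in `]s, t]) (f (w, r))%:E)%E = (tint f w)%:E.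
Proof.
move=> hf; rewrite /tint /Rintegral fineK//; apply: integrable_fin_num => //.
exact: tint_integrable.
Qed.

Lemma tintD f g w : bmeas f -> bmeas g -> tint (fun z => f z + g z) w = tint f w + tint g w.
Proof. by move=> hf hg; rewrite /tint RintegralD//; exact: tint_integrable. Qed.

Lemma tintZ (k : R) f w : bmeas f -> tint (fun z => k * f z) w = k * tint f w.
Proof. by move=> hf; rewrite /tint RintegralZl//; exact: tint_integrable. Qed.

Lemma tint_cst (k : R) w : s <= t -> tint (fun=> k) w = k * (t - s).
Proof.
move=> st; rewrite /tint Rintegral_cst//= lebesgue_measure_itv/= lte_fin.
by case: ltP => [//|ts]; rewrite (_ : t - s = 0)//; apply/eqP; rewrite subr_eq0 eq_le st ts.
Qed.

Lemma tint_sum (I : Type) (r : seq I) (f : I -> TR -> R) w : s <= t -> (forall i, bmeas (f i)) ->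
  tint (fun z => \sum_(i <- r) f i z) w = \sum_(i <- r) tint (f i) w.
Proof.
move=> st hf; elim: r => [|i r ih].
  rewrite big_nil -[RHS](mul0r (t - s)) -(tint_cst 0 w st); congr (tint _ w).
  by apply/funext => z; rewrite big_nil.
rewrite big_cons -ih -tintD//; last exact: bmeas_sum.
by congr (tint _ w); apply/funext => z; rewrite big_cons.
Qed.

Lemma tint_le f g w : bmeas f -> bmeas g -> (forall r, s < r <= t -> f (w, r) <= g (w, r)) ->
  tint f w <= tint g w.
Proof.
by move=> hf hg fg; apply: le_Rintegral => //; exact: tint_integrable.
Qed.

Lemma tint_bound f w (K : R) : s <= t -> bmeas f -> (forall z, `|f z| <= K) -> `|tint f w| <= K * (t - s).
Proof.
move=> st hf hK; rewrite ler_norml -mulNr -!(tint_cst _ w st).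
by apply/andP; split; apply: tint_le => //; try exact: bmeas_cst; move=> r _; have := hK (w, r);
  rewrite ler_norml => /andP[].
Qed.

Lemma tint_meas f : s <= t -> bmeas f -> measurable_fun setT (tint f).
Proof.
move=> st hf; have [mf [K hK]] := hf.
(* Adding the bound K makes the integrand nonnegative, as Tonelli requires. *)
have hg : bmeas (fun z => f z + K) by apply: bmeasD => //; exact: bmeas_cst.
have -> : tint f = (fun w => tint (fun z => f z + K) w - K * (t - s)).
  by apply/funext => w; rewrite tintD ?tint_cst ?addrK//; exact: bmeas_cst.
apply: measurable_funB => //.
have -> : tint (fun z => f z + K) = fine \o (fun w => \int[lam]_r (btw s t r * (f (w, r) + K))%:E)%E.
  apply/funext => w; rewrite /tint /Rintegral /=; congr fine; rewrite integral_mkcond.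
  apply: eq_integral => r _; rewrite patchE btw_itv indicE.
  by case: ifPn => _; rewrite ?mul1r// mul0r.
apply: measurableT_comp => //.
apply: (@measurable_fun_fubini_tonelli_F _ _ _ _ _ lam (fun z : TR => (btw s t z.2 * (f z + K))%:E)).
  apply/measurable_EFinP; apply: measurable_funM; last by have [] := hg.
  by apply: measurable_between; exact: measurable_snd.
move=> z; rewrite lee_fin mulr_ge0// ?/btw ?ler0n//.
by have := hK z; rewrite ler_norml => /andP[h _]; rewrite -lerBlDr sub0r.
Qed.

Lemma tint_L1 f : s <= t -> bmeas f -> L1 P (tint f).
Proof.
move=> st hf; apply: bdd_L1; first exact: tint_meas.
by have [_ [K hK]] := hf; exists (K * (t - s)) => w; exact: tint_bound.
Qed.

Lemma Ex_tint f : s <= t -> bmeas f ->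
  (\int[P]_w \int[lam]_(r in `]s, t]) (f (w, r))%:E)%E = (Ex P (tint f))%:E.
Proof.
by move=> st hf; rewrite -Ex_EFin; [apply: eq_integral => w _; exact: tintE|exact: tint_L1].
Qed.

End time_integral.

Lemma nrm2_Ex (R : realType) (dT : measure_display) (T : measurableType dT) (P : probability T R)
    m n (f : T -> 'M[R]_(m, n)) :
  cmeas f -> (nrm2 P f < +oo)%E -> L1 P (fun w => frob (f w) ^+ 2) /\
    nrm2 P f = (Ex P (fun w => frob (f w) ^+ 2))%:E.
Proof.
move=> mf fy; have lf : L1 P (fun w => frob (f w) ^+ 2).
  by apply: L1_ge0_lty => //; [exact: cmeas_frob|move=> w; exact: sqr_ge0].
by split => //; rewrite -Ex_EFin.
Qed.

Section one_step.
Context (R : realType) (d : nat) (dT : measure_display) (T : measurableType dT) (P : probability T R) (s t : R).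
Notation lam := (@lebesgue_measure R).
Notation TR := (T * measurableTypeR R)%type.
Variables (xi D : T -> 'cV[R]_d) (a : TR -> 'cV[R]_d) (gam phi : TR -> R) (K eta : R).
Hypotheses (st : s <= t) (mxi : cmeas xi) (mD : cmeas D) (ma : cmeas a) (eta0 : 0 < eta)
  (bxi : exists C : R, forall w, frob (xi w) <= C) (aK : forall z, frob (a z) <= K)
  (bg : bmeas gam) (bphi : bmeas phi).
Notation I f := (\int[P]_w \int[lam]_(r in `]s, t]) (f (w, r))%:E)%E.
Hypothesis h1 : (nrm2 P (fun w => (xi w + D w)%R) <= nrm2 P xi + I gam)%E.
Hypothesis h2 : (nrm2 P D <= I gam)%E.
Hypothesis h3 : forall w r, s < r <= t ->
  2 * dotp (xi w) (a (w, r)) + (1 + eta) * gam (w, r) <= phi (w, r).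

Definition drift (w : T) : 'cV[R]_d := \col_i tint s t (fun z => a z i 0) w.

Let ba i : bmeas (fun z => a z i 0).
Proof. by split; [exact: ma|exists K => z; apply: le_trans (frob_coord _ _ _) (aK z)]. Qed.

Lemma drift_cmeas : cmeas drift.
Proof.
move=> i j; rewrite (_ : (fun _ => _) = tint s t (fun z => a z i 0)); first exact: tint_meas.
by apply/funext => w; rewrite mxE.
Qed.

Lemma drift_bound w : frob (drift w) ^+ 2 <= d%:R * (K * (t - s)) ^+ 2.
Proof.
have ts : 0 <= t - s by rewrite subr_ge0.
have K0 : 0 <= K by apply: le_trans (aK (w, 0)); exact: frob_ge0.
rewrite frob_sqr_col; apply: (@le_trans _ _ (\sum_(i < d) (K * (t - s)) ^+ 2)).
  apply: ler_sum => i _; rewrite mxE -real_normK ?num_real// ler_pXn2r ?nnegrE ?mulr_ge0//.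
  by apply: tint_bound => // z; apply: le_trans (frob_coord _ _ _) (aK z).
by rewrite sumr_const card_ord mulr_natl.
Qed.

(** Here x is the gap at time s, y the martingale increment and z the drift. Only the product of y
    and z is estimated; z being of order t - s, its square is of second order in the mesh. *)
Lemma frob_sqrDD (x y z : 'cV[R]_d) :
  frob (x + y + z) ^+ 2 <= frob (x + y) ^+ 2 + 2 * dotp x z + eta * frob y ^+ 2 + (1 + eta^-1) * frob z ^+ 2.
Proof.
rewrite dotpE !frob_sqr_col !mulr_sumr -!big_split/=; apply: ler_sum => i _; rewrite !mxE.
move: (x i 0) (y i 0) (z i 0) => p q r.
have -> : (p + q) ^+ 2 + 2 * (p * r) + eta * q ^+ 2 + (1 + eta^-1) * r ^+ 2 =
   (p + q + r) ^+ 2 + eta * (q - r / eta) ^+ 2 by field; exact: lt0r_neq0.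
by rewrite lerDl mulr_ge0 ?sqr_ge0// ltW.
Qed.

(** The term eta |D|^2 left by [frob_sqrDD] is paid for by [h2], whence the factor 1 + eta in [h3].
    All terms of first order are then gathered under one time integral and compared there
    pointwise. *)
Lemma one_step : (nrm2 P (fun w => (xi w + D w + drift w)%R) <=
  nrm2 P xi + I phi + ((1 + eta^-1) * (d%:R * (K * (t - s)) ^+ 2))%:E)%E.
Proof.
have [C hC] := bxi.
have L1x : L1 P (fun w => frob (xi w) ^+ 2).
  apply: bdd_L1; first exact: cmeas_frob.
  exists (C ^+ 2) => w; rewrite ger0_norm ?sqr_ge0// ler_pXn2r ?nnegrE ?frob_ge0//.
  by apply: le_trans (hC w); exact: frob_ge0.
have nx : nrm2 P xi = (Ex P (fun w => frob (xi w) ^+ 2))%:E by rewrite -Ex_EFin.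
have Eg := Ex_tint P st bg; have Ep := Ex_tint P st bphi.
move: h1 h2; rewrite Eg Ep nx -EFinD => k1 k2.
have [Lx ex] := nrm2_Ex (cmeasD mxi mD) (le_lt_trans k1 (ltry _)).
have [Lm em] := nrm2_Ex mD (le_lt_trans k2 (ltry _)).
move: k1 k2; rewrite ex em !lee_fin => k1 k2.
pose c := (1 + eta^-1) * (d%:R * (K * (t - s)) ^+ 2).
have mA := drift_cmeas.
have LA : L1 P (fun w => 2 * dotp (xi w) (drift w)).
  rewrite (_ : (fun _ => _) = fun w => \sum_i 2 * (xi w i 0 * drift w i 0)); last first.
    by apply/funext => w; rewrite dotpE mulr_sumr.
  apply: L1_sum => i _; apply: L1Z; apply: bdd_L1.
    by apply: measurable_funM; [exact: mxi|exact: mA].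
  exists (C * (K * (t - s))) => w; rewrite normrM ler_pM//.
    by apply: le_trans (frob_coord _ _ _) (hC w).
  by rewrite mxE; apply: tint_bound => // z; apply: le_trans (frob_coord _ _ _) (aK z).
have Lg := tint_L1 P st bg; have Lp := tint_L1 P st bphi.
pose rhs w := (frob (xi w + D w) ^+ 2 + eta * frob (D w) ^+ 2 + c) + 2 * dotp (xi w) (drift w).
have Lr : L1 P rhs by apply: L1D => //; apply: L1D; [apply: L1D => //; exact: L1Z|exact: L1_cst].
have mS : cmeas (fun w => xi w + D w + drift w) by apply: cmeasD => //; exact: cmeasD.
have le1 w : frob (xi w + D w + drift w) ^+ 2 <= rhs w.
  apply: le_trans (frob_sqrDD _ _ _) _.
  have : (1 + eta^-1) * frob (drift w) ^+ 2 <= c.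
    by rewrite ler_wpM2l ?addr_ge0 ?invr_ge0 ?(ltW eta0)//; exact: drift_bound.
  by rewrite /rhs; lra.
have LS : L1 P (fun w => frob (xi w + D w + drift w) ^+ 2).
  apply: (L1_le _ Lr); first exact: cmeas_frob.
  by move=> w; rewrite ger0_norm ?sqr_ge0.
rewrite /nrm2 (Ex_EFin LS) -!EFinD lee_fin.
apply: le_trans (Ex_le LS Lr le1) _; rewrite /rhs.
rewrite ExD//; last by apply: L1D; [apply: L1D => //; exact: L1Z|exact: L1_cst].
rewrite ExD//; [|by apply: L1D => //; exact: L1Z|exact: L1_cst].
rewrite ExD//; last exact: L1Z.
rewrite Ex_cst (ExZ eta Lm).
have le2 w : 2 * dotp (xi w) (drift w) + (1 + eta) * tint s t gam w <= tint s t phi w.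
  have bx : bmeas (fun z => \sum_i (2 * xi w i 0) * a z i 0) by apply: bmeas_sum => i; exact: bmeasZ.
  have -> : 2 * dotp (xi w) (drift w) = tint s t (fun z => \sum_i (2 * xi w i 0) * a z i 0) w.
    rewrite tint_sum//; last by move=> i; exact: bmeasZ.
    rewrite dotpE mulr_sumr; apply: eq_bigr => i _; rewrite tintZ// mulrA; congr (_ * _).
    by rewrite mxE.
  rewrite -tintZ// -tintD//; last exact: bmeasZ.
  apply: tint_le => //; first by apply: bmeasD => //; exact: bmeasZ.
  move=> r sr; apply: le_trans (h3 w sr); rewrite lerD2r dotpE mulr_sumr.
  by apply: ler_sum => i _; rewrite mulrA.
have : Ex P (fun w => 2 * dotp (xi w) (drift w)) + (1 + eta) * Ex P (tint s t gam) <= Ex P (tint s t phi).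
  rewrite -(ExZ (1 + eta) Lg) -(ExD LA (L1Z (1 + eta) Lg)).
  by apply: Ex_le => //; apply: L1D => //; exact: L1Z.
have : eta * Ex P (fun w => frob (D w) ^+ 2) <= eta * Ex P (tint s t gam) by rewrite ler_pM2l.
rewrite -/c; clearbody c; move: k1.
move: (Ex P _) (Ex P _) (Ex P _) (Ex P _) (Ex P _) (Ex P _) => ? ? ? ? ? ?; lra.
Qed.

End one_step.

Section stopped_coefficients.
Context (R : realType) (d : nat) (dT : measure_display) (T : measurableType dT)
  (F : R -> set (set T)) (dU : measure_display) (U : measurableType dU)
  (X : R -> T -> 'cV[R]_d) (n : nat).
Hypothesis FS : forall t : R, 0 <= t -> sigma_algebra setT (F t) /\ F t `<=` measurable.
Hypothesis Fle : forall s t : R, 0 <= s -> s <= t -> F s `<=` F t.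
Hypothesis aX : adapted F X.
Hypothesis cX : forall w, cadlag (fun t => X t w).
Notation TR := (T * measurableTypeR R)%type.
Notation TRU := (T * (measurableTypeR R * U))%type.

Lemma adapted_comp (phi : 'cV[R]_d -> R) (q : R) : 0 <= q -> continuous phi -> Fm F q (fun w => phi (X q w)).
Proof.
move=> q0 cphi; have [sF _] := FS q0.
by apply/(GmE _ sF); apply: measurable_wrt_comp => //; exact: (aX q0).
Qed.

Lemma adapted_comp_meas (phi : 'cV[R]_d -> R) (q : R) : 0 <= q -> continuous phi ->
  measurable_fun setT (fun w => phi (X q w)).
Proof. by move=> q0 cphi; apply: (Fm_meas FS q0); exact: adapted_comp. Qed.

Lemma alive_ind_Fm (r : R) : 0 <= r -> Fm F r (alive_ind X n r).
Proof.
move=> r0; have h (q : R) : 0 <= q <= r -> Fm F r (fun w => frob (X q w)).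
  by move=> /andP[q0 qr]; apply: (Fm_le FS Fle q0 qr); apply: adapted_comp => //; exact: frob_continuous.
exact: (@alive_measurable R d _ (g_sigma_algebraType (F r)) X n r cX r0 h).
Qed.

Lemma alive_ind_joint : measurable_fun setT (fun z : TR => alive_ind X n (Num.max z.2 0) z.1).
Proof.
by apply: alive_joint_measurable => // q q0; apply: adapted_comp_meas => //; exact: frob_continuous.
Qed.

Lemma path_joint (phi : 'cV[R]_d -> R) : continuous phi ->
  measurable_fun setT (fun z : TR => phi (X (Num.max z.2 0) z.1)).
Proof.
move=> cphi.
exact: (joint_measurable1 (fun w => (cX w).1) cphi (fun q q0 => adapted_comp_meas q0 cphi)).
Qed.

(** Jointly measurable version of the coefficient before exit. Negative times are sent to 0, since
    the paths are constrained at nonnegative times only. *)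
Definition stopped m k (f : 'cV[R]_d -> 'M[R]_(m, k)) (z : TR) : 'M[R]_(m, k) :=
  alive_ind X n (Num.max z.2 0) z.1 *: f (X (Num.max z.2 0) z.1).

Lemma stopped_cmeas m k (f : 'cV[R]_d -> 'M[R]_(m, k)) : continuous f -> cmeas (stopped f).
Proof.
move=> cf; apply: cmeasZ; first exact: alive_ind_joint.
move=> i j; apply: (path_joint (phi := fun x => f x i j)) => x.
by apply: (@continuous_comp _ _ _ f (fun A : 'M[R]_(m, k) => A i j)); [exact: cf|exact: coord_continuous].
Qed.

Definition stoppedU (c : 'cV[R]_d -> U -> 'cV[R]_d) (z : TRU) : 'cV[R]_d :=
  alive_ind X n (Num.max z.2.1 0) z.1 *: c (X (Num.max z.2.1 0) z.1) z.2.2.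

Lemma stoppedU_cmeas (c : 'cV[R]_d -> U -> 'cV[R]_d) :
  (forall i : 'I_d, measurable_fun setT (fun xu : borelRd R d * U => c xu.1 xu.2 i 0)) ->
  (forall u : U, continuous (fun x => c x u)) -> cmeas (stoppedU c).
Proof.
move=> mc cc; apply: cmeasZ.
  have mg : measurable_fun setT (fun z : TRU => (z.1, z.2.1)).
    apply: measurable_fun_pair; first exact: measurable_fst.
    exact: (measurableT_comp (@measurable_fst _ _ _ _) (@measurable_snd _ _ _ _)).
  exact: (measurableT_comp alive_ind_joint mg).
move=> i j; rewrite ord1.
apply: (joint_measurable (Phi := fun x u => c x u i 0)).
- by move=> w; exact: (cX w).1.
- move=> u x; apply: (@continuous_comp _ _ _ (fun x => c x u) (fun A : 'cV[R]_d => A i 0)); first exact: cc.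
  exact: coord_continuous.
move=> q q0; have mX : measurable_fun setT (X q : T -> borelRd R d).
  apply: (@measurability _ _ T (borelRd R d) setT (X q) (@open 'cV[R]_d)) => //.
  move=> A [V oV <-]; rewrite setTI.
  by have [_] := FS q0; apply; exact: (aX q0).
have mp : measurable_fun setT (fun y : T * U => (X q y.1 : borelRd R d, y.2)).
  by apply: measurable_fun_pair => //; exact: (measurableT_comp mX (@measurable_fst _ _ _ _)).
exact: (measurableT_comp (mc i) mp).
Qed.

End stopped_coefficients.

(** * Vanishing of the discretization error *)

Section riemann_error.
Context (R : realType) (dT : measure_display) (T : measurableType dT) (P : probability T R) (s t : R).
Notation lam := (@lebesgue_measure R).
Notation TR := (T * measurableTypeR R)%type.

Definition grid (m i : nat) : R := s + (t - s) * i%:R / m.+1%:R.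

Lemma grid0 m : grid m 0 = s.
Proof. by rewrite /grid mulr0 mul0r addr0. Qed.

Lemma gridm m : grid m m.+1 = t.
Proof. by rewrite /grid mulfK ?lt0r_neq0//; ring. Qed.

Hypothesis st : s <= t.

Lemma gridS m i : grid m i.+1 - grid m i = (t - s) / m.+1%:R.
Proof. by rewrite /grid -natr1; field; rewrite lt0r_neq0//= addr0 natr1. Qed.

Lemma grid_le m i j : (i <= j)%N -> grid m i <= grid m j.
Proof.
move=> ij; rewrite lerD2l ler_pM2r ?invr_gt0//; apply: ler_wpM2l; first by rewrite subr_ge0.
by rewrite ler_nat.
Qed.

Lemma grid_ge m i : s <= grid m i.
Proof. by rewrite -(grid0 m); exact: grid_le. Qed.

Lemma grid_leT m i : (i <= m.+1)%N -> grid m i <= t.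
Proof. by move=> im; rewrite -(gridm m); exact: grid_le. Qed.

Lemma sum_btw (g : nat -> R) m r : (forall i, g i <= g i.+1) ->
  \sum_(i < m) btw (g i) (g i.+1) r = btw (g 0%N) (g m) r.
Proof.
move=> gS; elim: m => [|m ih].
  by rewrite big_ord0 /btw; case: ltP => //= h; rewrite leNgt h.
rewrite big_ord_recr/= ih /btw; have g0 : g 0%N <= g m.
  by elim: m {ih} => // m ih; exact: le_trans (gS m).
have [h|h] := leP r (g m).
  by rewrite (le_trans h (gS m)) andbT addr0.
by rewrite (le_lt_trans g0 h) andbF add0r.
Qed.

Lemma tint_restrict (u v : R) (g : TR -> R) w : s <= u -> v <= t ->
  tint u v g w = tint s t (fun z => btw u v z.2 * g z) w.
Proof.
move=> su vt; rewrite /tint /Rintegral; congr fine; rewrite integral_mkcond [RHS]integral_mkcond.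
apply: eq_integral => r _; rewrite !patchE !mem_setE !in_itv/= /btw.
have [/andP[ur rv]|h] := boolP (u < r <= v).
  by rewrite (le_lt_trans su ur) (le_trans rv vt)/= mul1r.
by case: ifP => _ //; rewrite mul0r.
Qed.

Variables (e : R -> TR -> R) (C : R).
Hypotheses (s0 : 0 <= s) (be : forall u, 0 <= u -> bmeas (e u))
  (e0 : forall u z, 0 <= u -> 0 <= e u z) (eC : forall u z, 0 <= u -> e u z <= C)
  (e_left : forall w, exists2 D : set R, countable D & forall r, s < r <= t -> ~ D r ->
     forall eps, 0 < eps -> exists2 del, 0 < del &
       forall u, 0 <= u -> r - del < u < r -> e u (w, r) <= eps).

(** At each time of ]s, t] exactly one term is present: the error made by freezing at the left end
    of the current cell. *)
Let E m (z : TR) : R := \sum_(i < m.+1) btw (grid m i) (grid m i.+1) z.2 * e (grid m i) z.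

Let g0 m i : 0 <= grid m i.
Proof. exact: le_trans s0 (grid_ge m i). Qed.

Let btw01 (u v r : R) : 0 <= btw u v r <= 1.
Proof. by rewrite /btw; case: (_ < _ <= _) => /=; rewrite lexx ler01. Qed.

Let E_bmeas m : bmeas (E m).
Proof.
apply: bmeas_sum => i; apply: bmeasM; last exact: be.
split; first by apply: measurable_between; exact: measurable_snd.
by exists 1 => z; have /andP[b0 b1] := btw01 (grid m i) (grid m i.+1) z.2; rewrite ger0_norm.
Qed.

Let E_ge0 m z : 0 <= E m z.
Proof.
by apply: sumr_ge0 => i _; rewrite mulr_ge0 ?e0.
Qed.

Let E_le m z (eps : R) : 0 <= eps ->
  (forall i, grid m i < z.2 <= grid m i.+1 -> e (grid m i) z <= eps) -> E m z <= eps.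
Proof.
move=> eps0 h; apply: (@le_trans _ _ (\sum_(i < m.+1) btw (grid m i) (grid m i.+1) z.2 * eps)).
  apply: ler_sum => i _; rewrite /btw; have [hi|_] := boolP (_ < _ <= _); last by rewrite !mul0r.
  by rewrite !mul1r; exact: h.
rewrite -mulr_suml (sum_btw (g := grid m)); last by move=> i; exact: grid_le.
by rewrite ler_piMl//; have /andP[] := btw01 (grid m 0) (grid m m.+1) z.2.
Qed.

Let C0 (w : T) : 0 <= C.
Proof. exact: le_trans (e0 (w, s) s0) (eC (w, s) s0). Qed.

Let EC m z : E m z <= C.
Proof. by apply: E_le; [exact: C0 z.1|move=> i _; exact: eC]. Qed.

(** Cells are open on the left, so the freezing time lies strictly before r and tends to it:
    behaviour to the left of r is all that matters. *)
Let E_cvg w : exists2 D : set R, countable D & forall r, s < r <= t -> ~ D r ->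
  (E m (w, r)) @[m --> \oo] --> (0 : R).
Proof.
have [D cD hD] := e_left w; exists D => // r sr nD; apply/cvgr0Pnorm_le => eps eps0.
have [del del0 hdel] := hD r sr nD eps eps0.
(* The added 1 keeps the denominator positive when s = t. *)
have del1 : 0 < del / (t - s + 1) by rewrite divr_gt0//; lra.
have := near_infty_natSinv_lt (PosNum del1); apply: filterS => m /= hm.
rewrite ger0_norm ?E_ge0//; apply: E_le; first exact: ltW.
move=> i /andP[gr rg]; apply: hdel => //; rewrite gr andbT.
have hS := gridS m i.
have hd : (t - s) / m.+1%:R < del.
  apply: (@le_lt_trans _ _ ((t - s + 1) * m.+1%:R^-1)).
    by rewrite ler_wpM2r ?invr_ge0//; lra.
  by rewrite mulrC -ltr_pdivlMr//; lra.
by rewrite ltrBlDr; apply: le_lt_trans rg _; rewrite -ltrBlDl hS.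
Qed.

Let tint_E_cvg w : (tint s t (E m) w) @[m --> \oo] --> (0 : R).
Proof.
have [D cD hD] := E_cvg w.
have mI : measurable (`]s, t]%classic : set (measurableTypeR R)) by exact: measurable_itv.
have h := @dominated_convergence _ (measurableTypeR R) R lam `]s, t]%classic mI
   (fun m r => (E m (w, r))%:E) (cst 0%E) (cst C%:E) _ _ _ _ _.
have [] := h.
- move=> m; apply/measurable_EFinP; apply: measurable_funTS.
  by have [mE _] := E_bmeas m; exact: (measurable_fun_pair2 w mE).
- exact: measurable_cst.
- exists D; split.
  + by apply: countable_measurable => // x; exact: measurable_set1.
  + exact: countable_lebesgue_measure0.
  + move=> r /= /not_implyP[]; rewrite in_itv/= => rI hr; apply: contrapT => nD; apply: hr.
    by apply/fine_cvgP; split; [exact: nearW|exact: hD].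
- exact: (tint_integrable s t w (bmeas_cst _ C)).
- by apply: nearW => r m _ /=; rewrite lee_fin ger0_norm ?E_ge0// EC.
move=> _ _; rewrite integral0 => /fine_cvgP[_]; apply: cvg_trans.
by apply: near_eq_cvg; apply: nearW.
Qed.

(** The sum is the mean of the integral of [E m] over ]s, t]. As [E m] is bounded by C and tends to
    0 off countably many times, dominated convergence applies in time and then in w. *)
Lemma riemann_error_cvg0 :
  (\sum_(i < m.+1) Ex P (tint (grid m i) (grid m i.+1) (e (grid m i)))) @[m --> \oo] --> (0 : R).
Proof.
rewrite (_ : (fun m => _) = (fun m => Ex P (tint s t (E m)))); last first.
  apply/funext => m; rewrite -Ex_sum; last first.
    by move=> i _; apply: tint_L1; [exact: grid_le|exact: be].
  congr Ex; apply/funext => w; rewrite /E tint_sum//.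
    by apply: eq_bigr => i _; apply: tint_restrict; [exact: grid_ge|exact: grid_leT].
  move=> i; apply: bmeasM; last exact: be.
  split; first by apply: measurable_between; exact: measurable_snd.
  by exists 1 => z; have /andP[b0 b1] := btw01 (grid m i) (grid m i.+1) z.2; rewrite ger0_norm.
have h := @dominated_convergence _ T R P setT measurableT
   (fun m w => (tint s t (E m) w)%:E) (cst 0%E) (cst (C * (t - s))%:E) _ _ _ _ _.
have [] := h.
- by move=> m; apply/measurable_EFinP; exact: tint_meas.
- exact: measurable_cst.
- by apply: nearW => w _; apply/fine_cvgP; split; [exact: nearW|exact: tint_E_cvg].
- exact: L1_cst.
- apply: nearW => w m _ /=; rewrite lee_fin; apply: tint_bound => // z.
  by rewrite ger0_norm ?E_ge0// EC.
move=> _ _; rewrite integral0 => /fine_cvgP[_]; apply: cvg_trans.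
by apply: near_eq_cvg; apply: nearW.
Qed.

End riemann_error.

(** Over m + 1 equal cells the quadratic terms add up to k (t - s)^2 / (m + 1) and vanish with the
    mesh; the linear terms add up exactly. *)
Lemma grid_telescope (R : realType) (s t B k : R) (f : R -> R) (Er : R -> R -> R) :
  0 <= s -> s <= t ->
  (forall u v, s <= u -> u <= v -> v <= t -> f v <= f u + B * (v - u) + Er u v + k * (v - u) ^+ 2) ->
  (\sum_(i < m.+1) Er (grid s t m i) (grid s t m i.+1)) @[m --> \oo] --> (0 : R) ->
  f t <= f s + B * (t - s).
Proof.
move=> s0 st h e0.
have step m j : (j <= m.+1)%N -> f (grid s t m j) <= f s + \sum_(i < j) Er (grid s t m i) (grid s t m i.+1)
    + j%:R * (B * ((t - s) / m.+1%:R) + k * ((t - s) / m.+1%:R) ^+ 2).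
  elim: j => [_|j ih jm]; first by rewrite grid0 big_ord0 mul0r !addr0.
  apply: le_trans (h (grid s t m j) (grid s t m j.+1) _ _ _) _.
  - exact: grid_ge.
  - exact: grid_le.
  - exact: grid_leT.
  have := ih (ltnW jm); rewrite gridS big_ord_recr/= -(natr1 j).
  by move: ((t - s) / m.+1%:R) (\sum_(_ < _) _) => x y; lra.
have lim : (f s + \sum_(i < m.+1) Er (grid s t m i) (grid s t m i.+1) + B * (t - s) + k * (t - s) ^+ 2 * m.+1%:R^-1)
    @[m --> \oo] --> f s + 0 + B * (t - s) + k * (t - s) ^+ 2 * 0.
  apply: cvgD; first by apply: cvgD; [apply: cvgD => //; exact: cvg_cst|exact: cvg_cst].
  by apply: cvgM; [exact: cvg_cst|exact: cvg_harmonic].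
rewrite -[X in _ <= X]addr0 -(mulr0 (k * (t - s) ^+ 2)) -[f s in X in _ <= X]addr0.
rewrite -(cvg_lim _ lim)//; apply: limr_ge; first by apply/cvg_ex; eexists; exact: lim.
apply: nearW => m; have := step m m.+1 (leqnn _); rewrite gridm.
move/le_trans; apply; rewrite -!addrA !lerD2l le_eqVlt; apply/orP; left; apply/eqP.
by field; rewrite lt0r_neq0//= natr1.
Qed.

Section left_continuity.
Context (R : realType) (d : nat) (dT : measure_display) (T : measurableType dT) (n : nat).

(** A path alive at r was alive before. Otherwise it was outside the ball at some s <= r: if s < r
    this is already known shortly before r, and if s = r the absence of a jump puts it outside
    shortly before r as well. *)
Lemma alive_ind_left (X : R -> T -> 'cV[R]_d) w r : cadlag (fun t => X t w) -> 0 < r ->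
  left_lim (fun s => X s w) r = X r w ->
  exists2 del, 0 < del & forall u, r - del < u < r -> alive_ind X n u w = alive_ind X n r w.
Proof.
move=> cX r0 lr; have [al|nal] := pselect (alive X n r w).
  exists 1 => // u /andP[_ ur]; rewrite !alive_ind1//; exact: alive_le (ltW ur) al.
move: (nal) => /existsNP[s /not_implyP[/andP[s0 sr] /negP]]; rewrite -ltNge => ns.
suff [del del0 h] : exists2 del, 0 < del & forall u, r - del < u < r -> ~ alive X n u w.
  by exists del => // u hu; rewrite !alive_ind0//; exact: h.
move: sr; rewrite le_eqVlt => /orP[/eqP sr|sr]; last first.
  exists (r - s); first by rewrite subr_gt0.
  move=> u /andP[]; rewrite opprB addrC subrK => su _ /(_ s).
  by rewrite s0 (ltW su) => /(_ isT); rewrite leNgt ns.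
have e0 : 0 < Num.min r (frob (X r w) - n%:R) by rewrite lt_min r0 subr_gt0 -sr.
have [del del0 h] := left_frob (cX.2 r r0) e0.
exists (Num.min r del); first by rewrite lt_min r0.
move=> u /andP[ru ur]; have : r - r <= r - Num.min r del /\ r - del <= r - Num.min r del.
  by split; rewrite lerD2l lerN2 ge_min lexx ?orbT.
rewrite subrr => -[h1 h2] /(_ u); rewrite lexx (le_trans h1 (ltW ru))/= => /(_ isT) un.
have := h u; rewrite ur (le_lt_trans h2 ru) lr lt_min => /(_ isT)/andP[_ h3].
have := frobD (X r w - X u w) (X u w); rewrite subrK frobB; lra.
Qed.

Lemma freeze_err_left (X1 X2 : R -> T -> 'cV[R]_d) (c1 c2 : R) w :
  cadlag (fun t => X1 t w) -> cadlag (fun t => X2 t w) -> 0 <= c2 ->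
  exists2 D : set R, countable D & forall r, 0 < r -> ~ D r -> forall eps, 0 < eps ->
    exists2 del, 0 < del & forall u, r - del < u < r ->
     c1 * `|alive_ind X1 n u w * alive_ind X2 n u w - alive_ind X1 n r w * alive_ind X2 n r w| +
     c2 * frob ((alive_ind X1 n r w * alive_ind X2 n r w) *: (X1 r w - X2 r w) -
                (alive_ind X1 n u w * alive_ind X2 n u w) *: (X1 u w - X2 u w)) <= eps.
Proof.
move=> cX1 cX2 c20.
exists ([set r | 0 < r /\ left_lim (fun s => X1 s w) r <> X1 r w] `|` [set r | 0 < r /\ left_lim (fun s => X2 s w) r <> X2 r w]).
  rewrite -bigcup2E; apply: bigcup_countable => // -[|[|i]] _ /=; last exact: countable0.
    exact: jumps_countable.
  exact: jumps_countable.
move=> r r0 /not_orP[n1 n2] eps eps0.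
have l1 : left_lim (fun s => X1 s w) r = X1 r w by apply: contrapT => h; apply: n1.
have l2 : left_lim (fun s => X2 s w) r = X2 r w by apply: contrapT => h; apply: n2.
have [d1 d10 h1] := alive_ind_left cX1 r0 l1; have [d2 d20 h2] := alive_ind_left cX2 r0 l2.
(* Each of the two paths may move by this amount, and c2 times twice it is at most eps. *)
have e0 : 0 < eps / (2 * c2 + 1) by rewrite divr_gt0//; lra.
have [d3 d30 h3] := left_frob (cX1.2 r r0) e0.
have [d4 d40 h4] := left_frob (cX2.2 r r0) e0.
exists (Num.min (Num.min d1 d2) (Num.min d3 d4)); first by rewrite !lt_min d10 d20 d30 d40.
move=> u /andP[]; rewrite ltrBlDr -ltrBlDl !lt_min => /andP[/andP[u1 u2] /andP[u3 u4]] ur.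
have H1 := h1 u; have H2 := h2 u; have H3 := h3 u; have H4 := h4 u.
rewrite H1; last by rewrite ur; lra.
rewrite H2; last by rewrite ur; lra.
rewrite subrr normr0 mulr0 add0r -scalerBr.
have b01 : 0 <= alive_ind X1 n r w * alive_ind X2 n r w <= 1.
  have /andP[a0 a1] := alive_ind_itv X1 n r w; have /andP[b0 b1] := alive_ind_itv X2 n r w.
  by rewrite mulr_ge0//= mulr_ile1.
move: (alive_ind X1 n r w * _) b01 => k /andP[k0 k1].
have fk (B : 'cV[R]_d) : frob (k *: B) <= frob B.
  rewrite -(@ler_pXn2r _ 2) ?nnegrE ?frob_ge0// frob_sqrZ ler_piMl ?sqr_ge0//.
  by rewrite expr_le1.
have fl : frob (X1 r w - X2 r w - (X1 u w - X2 u w)) <= 2 * (eps / (2 * c2 + 1)).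
  have -> : X1 r w - X2 r w - (X1 u w - X2 u w) = (X1 r w - X1 u w) - (X2 r w - X2 u w).
    by rewrite !opprB (addrACA (X1 r w) (- X2 r w)) (addrACA (X1 r w) (- X1 u w)) (addrC (- X2 r w)).
  apply: le_trans (frobD _ _) _; rewrite frobN frobB (frobB (X2 r w)) -{1}l1 -l2.
  have := H3; have := H4; rewrite ur => H4' H3'.
  have : r - d3 < u < r by rewrite ur; lra.
  have : r - d4 < u < r by rewrite ur; lra.
  by rewrite ur => /H4' {}H4' /H3' {}H3'; lra.
apply: le_trans (ler_wpM2l c20 (le_trans (fk _) fl)) _.
rewrite (_ : c2 * _ = (2 * c2) / (2 * c2 + 1) * eps); last by ring.
by rewrite ler_piMl ?(ltW eps0)// ler_pdivrMr; lra.
Qed.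

End left_continuity.

(** * The gap between two solutions *)

Section stopped_bounds.
Context (R : realType) (d : nat) (dT : measure_display) (T : measurableType dT)
  (X : R -> T -> 'cV[R]_d) (n : nat).

(* Where the path has already left the ball, any point of the ball may stand for X r w. *)
Lemma stopped_point (r : R) (w : T) : 0 <= r -> exists2 x : 'cV[R]_d, frob x <= n%:R &
  forall (V : lmodType R) (f : 'cV[R]_d -> V), alive_ind X n r w *: f (X r w) = alive_ind X n r w *: f x.
Proof.
move=> r0; have [h|h] := pselect (alive X n r w).
  by exists (X r w) => //; apply: h; rewrite r0 lexx.
by exists 0; [rewrite frob0|move=> V f; rewrite alive_ind0// !scale0r].
Qed.

Lemma stopped_bound m k (f : 'cV[R]_d -> 'M[R]_(m, k)) (C : R) z : 0 <= C ->
  (forall x, frob x <= n%:R -> frob (f x) ^+ 2 <= C) -> frob (stopped X n f z) ^+ 2 <= C.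
Proof.
move=> C0 hC; have z0 : 0 <= Num.max z.2 0 by rewrite le_max lexx orbT.
have [x xn e] := stopped_point z.1 z0; rewrite /stopped e frob_sqrZ.
have /andP[i0 i1] := alive_ind_itv X n (Num.max z.2 0) z.1.
apply: le_trans (hC _ xn); rewrite ler_piMl ?sqr_ge0//.
by rewrite expr_le1.
Qed.

End stopped_bounds.

Section pair.
Context (R : realType) (d : nat) (dT : measure_display) (T : measurableType dT)
  (P : probability T R) (F : R -> set (set T)) (W : R -> T -> 'cV[R]_d)
  (dU : measure_display) (U : measurableType dU)
  (nu : {sigma_finite_measure set U -> \bar R}) (p : T -> R -> option U).
Hypothesis FS : forall t : R, 0 <= t -> sigma_algebra setT (F t) /\ F t `<=` measurable.
Hypothesis Fle : forall s t : R, 0 <= s -> s <= t -> F s `<=` F t.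
Hypothesis BW : standard_brownian_motion P F W.
Hypothesis pp : poisson_point_process P F nu p.
Hypothesis WN : indep_classes P (brownian_sigma W) (point_sigma p `[0, +oo[).
Context (b : 'cV[R]_d -> 'cV[R]_d) (sigma : 'cV[R]_d -> 'M[R]_d) (c : 'cV[R]_d -> U -> 'cV[R]_d).
Hypotheses (b_cont : continuous b) (sigma_cont : continuous sigma)
  (c_meas : forall i : 'I_d, measurable_fun setT (fun xu : borelRd R d * U => c xu.1 xu.2 i 0))
  (c_cont : forall u : U, continuous (fun x => c x u)).
Context (X1 X2 : R -> T -> 'cV[R]_d) (n : nat).
Hypotheses (aX1 : adapted F X1) (aX2 : adapted F X2)
  (cX1 : forall w, cadlag (fun t => X1 t w)) (cX2 : forall w, cadlag (fun t => X2 t w)).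
Context (MW1 MW2 MN1 MN2 : R -> T -> 'cV[R]_d).
Hypotheses
  (iW1 : is_ito_integral P F W (fun r w => before_exit X1 n r w *: sigma (X1 r w)) MW1)
  (iW2 : is_ito_integral P F W (fun r w => before_exit X2 n r w *: sigma (X2 r w)) MW2)
  (iN1 : is_poisson_integral P F nu p
     (fun r u w => before_exit X1 n r w *: c (left_lim (fun s => X1 s w) r) u) MN1)
  (iN2 : is_poisson_integral P F nu p
     (fun r u w => before_exit X2 n r w *: c (left_lim (fun s => X2 s w) r) u) MN2).
Context (K : R).
Hypotheses (K0 : 0 < K) (hK : forall x, frob x <= n%:R ->
  [/\ frob (b x) <= K, frob (sigma x) ^+ 2 <= K & (int_sq nu (c x) <= K%:E)%E]).

Notation lam := (@lebesgue_measure R).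
Notation TR := (T * measurableTypeR R)%type.
Notation TRU := (T * (measurableTypeR R * U))%type.

Definition both_alive (r : R) (w : T) : R := alive_ind X1 n r w * alive_ind X2 n r w.
Definition gap (r : R) (w : T) : 'cV[R]_d := both_alive r w *: (X1 r w - X2 r w).
Definition diffW (z : TR) : 'M[R]_d := stopped X1 n sigma z - stopped X2 n sigma z.
(** Evaluated at the current state where the equation has the left limit; the two agree at all but
    countably many times. *)
Definition diffN (z : TRU) : 'cV[R]_d := stoppedU X1 n c z - stoppedU X2 n c z.
Definition drift_coef (z : TR) : 'cV[R]_d := stopped X1 n b z - stopped X2 n b z.
Definition mart_diff (t : R) (w : T) : 'cV[R]_d := (MW1 t w - MW2 t w) + (MN1 t w - MN2 t w).
Definition qv_rateW (z : TR) : R := frob (diffW z) ^+ 2.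
Definition qv_rateN (z : TR) : R := fine (int_sq nu (fun u => diffN (z.1, (z.2, u)))).
(** The weight is frozen at s because the isometry multiplies the increment by a factor known at
    time s. *)
Definition qv_rate (s : R) (z : TR) : R := both_alive s z.1 ^+ 2 * qv_rateW z + both_alive s z.1 ^+ 2 * qv_rateN z.

Lemma diffW_cmeas : cmeas diffW.
Proof. by apply: cmeasB; apply: (stopped_cmeas _ FS). Qed.

Lemma diffN_cmeas : cmeas diffN.
Proof. by apply: cmeasB; apply: (stoppedU_cmeas _ FS). Qed.

Lemma drift_coef_cmeas : cmeas drift_coef.
Proof. by apply: cmeasB; apply: (stopped_cmeas _ FS). Qed.

Lemma mart_diff_cmeas (t : R) : 0 <= t -> cmeas (mart_diff t).
Proof.
move=> t0; have h (I : R -> T -> 'cV[R]_d) : adapted F I -> cmeas (I t).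
  by move=> aI; apply: (measurable_wrt_cmeas FS t0); exact: aI.
have [a1 _ _] := iW1; have [a2 _ _] := iW2; have [a3 _ _] := iN1; have [a4 _ _] := iN2.
by apply: cmeasD; apply: cmeasB; exact: h.
Qed.

Lemma approximable_diff : approximable P F W nu p diffW diffN mart_diff.
Proof.
apply: (approximableB FS BW pp).
- exact: (stopped_cmeas _ FS aX1).
- exact: (stopped_cmeas _ FS aX2).
- exact: (stoppedU_cmeas _ FS aX1).
- exact: (stoppedU_cmeas _ FS aX2).
- move=> t t0; have h (I : R -> T -> 'cV[R]_d) : adapted F I -> cmeas (I t).
    by move=> aI; apply: (measurable_wrt_cmeas FS t0); exact: aI.
  have [a1 _ _] := iW1; have [a2 _ _] := iW2; have [a3 _ _] := iN1; have [a4 _ _] := iN2.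
  by split; exact: h.
- apply: (ito_representative FS iW1); first exact: (stopped_cmeas _ FS aX1).
  by move=> w; exact: integrand_alive.
- apply: (ito_representative FS iW2); first exact: (stopped_cmeas _ FS aX2).
  by move=> w; exact: integrand_alive.
- apply: (poisson_representative FS iN1); first exact: (stoppedU_cmeas _ FS aX1).
  by move=> w; apply: left_integrand_alive; exact: cX1.
- apply: (poisson_representative FS iN2); first exact: (stoppedU_cmeas _ FS aX2).
  by move=> w; apply: left_integrand_alive; exact: cX2.
Qed.

Lemma both_alive_Fm (s : R) : 0 <= s -> Fm F s (both_alive s).
Proof. by move=> s0; apply: FmM; apply: (alive_ind_Fm _ FS). Qed.

Lemma both_alive_itv (s : R) w : 0 <= both_alive s w <= 1.
Proof.
have /andP[a0 a1] := alive_ind_itv X1 n s w; have /andP[b0 b1] := alive_ind_itv X2 n s w.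
by rewrite /both_alive mulr_ge0//= mulr_ile1.
Qed.

Lemma both_alive_cases (s : R) w : (alive X1 n s w /\ alive X2 n s w /\ both_alive s w = 1) \/
  (~ (alive X1 n s w /\ alive X2 n s w) /\ both_alive s w = 0).
Proof.
have [h1|h1] := pselect (alive X1 n s w); last first.
  by right; split; [case|rewrite /both_alive (alive_ind0 h1) mul0r].
have [h2|h2] := pselect (alive X2 n s w); last first.
  by right; split; [case|rewrite /both_alive (alive_ind0 h2) mulr0].
by left; rewrite /both_alive !alive_ind1// mulr1.
Qed.

Lemma gap_Fm (s : R) (i : 'I_d) : 0 <= s -> Fm F s (fun w => gap s w i 0).
Proof.
move=> s0; have cc : continuous (fun A : 'cV[R]_d => A i 0) by exact: coord_continuous.
rewrite (_ : (fun _ => _) = fun w => both_alive s w * (X1 s w i 0 - X2 s w i 0)).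
  apply: FmM; [exact: both_alive_Fm|apply: FmB].
    exact: (adapted_comp FS aX1 s0 cc).
  exact: (adapted_comp FS aX2 s0 cc).
by apply/funext => w; rewrite !mxE.
Qed.

Lemma gap_bound (s : R) w : 0 <= s -> frob (gap s w) <= 2 * n%:R.
Proof.
move=> s0; rewrite /gap; have [[h1 [h2 ->]]|[_ ->]] := both_alive_cases s w; last first.
  by rewrite scale0r frob0 mulr_ge0.
have ss : 0 <= s <= s by rewrite s0 lexx.
rewrite scale1r; apply: le_trans (frobD _ _) _; rewrite frobN.
by have := h1 s ss; have := h2 s ss; lra.
Qed.

Lemma gap_cmeas (s : R) : 0 <= s -> cmeas (gap s).
Proof. by move=> s0 i j; rewrite ord1; apply: (Fm_meas FS s0); exact: gap_Fm. Qed.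

Let sub_sqr m k (A B : 'M[R]_(m, k)) (C : R) : frob A ^+ 2 <= C -> frob B ^+ 2 <= C ->
  frob (A - B) ^+ 2 <= 4 * C.
Proof. by move=> h1 h2; have := frob_sqrD A (- B) (@ltr01 R); rewrite frob_sqrN invr1; lra. Qed.

Lemma qv_rateW_bmeas : bmeas qv_rateW /\ forall z, 0 <= qv_rateW z <= 4 * K.
Proof.
have h z : 0 <= qv_rateW z <= 4 * K.
  rewrite sqr_ge0/=; apply: sub_sqr; apply: stopped_bound; rewrite ?(ltW K0)//;
  by move=> x /hK[].
split=> //; split; first by apply: cmeas_frob; exact: diffW_cmeas.
by exists (4 * K) => z; have /andP[h0 h1] := h z; rewrite ger0_norm.
Qed.

Lemma diffN_int_sq w (r : R) : (int_sq nu (fun u => diffN (w, (r, u))) <= (4 * K)%:E)%E.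
Proof.
have r0 : 0 <= Num.max r 0 by rewrite le_max lexx orbT.
have [x xn ex] := stopped_point X1 n w r0; have [z zn ez] := stopped_point X2 n w r0.
have -> : (fun u => diffN (w, (r, u))) =
   (fun u => alive_ind X1 n (Num.max r 0) w *: c x u - alive_ind X2 n (Num.max r 0) w *: c z u).
  by apply/funext => u; rewrite /diffN /stoppedU /= (ex _ (c ^~ u)) (ez _ (c ^~ u)).
apply: int_sq_diff => //; try exact: alive_ind_itv.
- by have [] := hK xn.
- by have [] := hK zn.
Qed.

Lemma qv_rateNE w (r : R) : (int_sq nu (fun u => diffN (w, (r, u))) = (qv_rateN (w, r))%:E)%E.
Proof.
rewrite /qv_rateN fineK//= ge0_fin_numE; last exact: nrm2_ge0.
by apply: le_lt_trans (diffN_int_sq w r) _; exact: ltry.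
Qed.

Lemma qv_rateN_bmeas : bmeas qv_rateN /\ forall z, 0 <= qv_rateN z <= 4 * K.
Proof.
have h z : 0 <= qv_rateN z <= 4 * K.
  case: z => w r; rewrite -!lee_fin -qv_rateNE diffN_int_sq andbT; exact: nrm2_ge0.
split=> //; split; last by exists (4 * K) => z; have /andP[h0 h1] := h z; rewrite ger0_norm.
apply: measurableT_comp => //.
have mg : measurable_fun setT (fun y : TR * U => (y.1.1, (y.1.2, y.2))).
  apply: measurable_fun_pair.
    exact: (measurableT_comp (@measurable_fst _ _ _ _) (@measurable_fst _ _ _ _)).
  apply: measurable_fun_pair; last exact: measurable_snd.
  exact: (measurableT_comp (@measurable_snd _ _ _ _) (@measurable_fst _ _ _ _)).
apply: (@measurable_fun_fubini_tonelli_F _ _ _ _ _ nu (fun y : TR * U => (frob (diffN (y.1.1, (y.1.2, y.2))) ^+ 2)%:E)).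
  by apply/measurable_EFinP; exact: (measurableT_comp (cmeas_frob diffN_cmeas) mg).
by move=> y; rewrite lee_fin sqr_ge0.
Qed.

Lemma both_alive_bmeas (s : R) : 0 <= s -> bmeas (fun z : TR => both_alive s z.1).
Proof.
move=> s0; split.
  by apply: (measurableT_comp (Fm_meas FS s0 (both_alive_Fm s0))); exact: measurable_fst.
by exists 1 => z; have /andP[h0 h1] := both_alive_itv s z.1; rewrite ger0_norm.
Qed.

Lemma qv_rate_bmeas (s : R) : 0 <= s -> bmeas (qv_rate s).
Proof.
move=> s0; have hb := both_alive_bmeas s0; have hb2 := bmeasM hb hb.
by apply: bmeasD; apply: bmeasM => //; [have [] := qv_rateW_bmeas|have [] := qv_rateN_bmeas].
Qed.

Lemma increment_diff (s t : R) (zeta : T -> 'cV[R]_d) : 0 <= s -> s <= t ->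
  (forall i : 'I_d, Fm F s (fun w => zeta w i 0)) ->
  (forall i : 'I_d, L2 P (fun w => zeta w i 0)) ->
  (nrm2 P (fun w => zeta w + both_alive s w *: (mart_diff t w - mart_diff s w))%R <=
   nrm2 P zeta + \int[P]_w \int[lam]_(r in `]s, t]) (qv_rate s (w, r))%:E)%E.
Proof.
move=> s0 st mz lz; have mb := both_alive_Fm s0.
have bb : bdd (both_alive s) by exists 1 => w; have /andP[h0 h1] := both_alive_itv s w; rewrite ger0_norm.
have := increment_nrm2 FS Fle BW pp WN diffW_cmeas diffN_cmeas mart_diff_cmeas approximable_diff s0 st mb bb mz lz.
move=> /le_trans; apply; apply: leeD => //.
have mbeta := Fm_meas FS s0 mb.
rewrite -(weighted_intW P s t mbeta diffW_cmeas) -(weighted_intN P nu s t mbeta diffN_cmeas).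
have hb := both_alive_bmeas s0; have hb2 : bmeas (fun z : TR => both_alive s z.1 ^+ 2) by apply: bmeasM.
have [hW _] := qv_rateW_bmeas; have [hN _] := qv_rateN_bmeas.
have hbW := bmeasM hb2 hW; have hbN := bmeasM hb2 hN.
have e g : bmeas g -> (\int[P]_w ((both_alive s w ^+ 2)%:E * \int[lam]_(r in `]s, t]) (g (w, r))%:E) =
    (Ex P (tint s t (fun z => (both_alive s z.1 ^+ 2 * g z)%R)))%:E)%E.
  move=> hg; rewrite -Ex_EFin; last by apply: tint_L1 => //; exact: bmeasM.
  apply: eq_integral => w _; rewrite tintE// -EFinM; congr EFin.
  by rewrite -(tintZ s t (both_alive s w ^+ 2) w hg).
rewrite (Ex_tint P st (qv_rate_bmeas s0)) (e _ hW).
rewrite (_ : (\int[P]_w _)%E = (Ex P (tint s t (fun z => (both_alive s z.1 ^+ 2 * qv_rateN z)%R)))%:E); last first.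
  rewrite -(e _ hN); apply: eq_integral => w _; congr (_ * _)%E.
  by apply: eq_integral => r _; exact: qv_rateNE.
rewrite -EFinD lee_fin -ExD; [|exact: tint_L1|exact: tint_L1].
rewrite (_ : (fun w => _) = tint s t (qv_rate s))//.
by apply/funext => w; rewrite -tintD.
Qed.

Hypotheses
  (eq1 : {ae P, forall w, forall t : R, 0 <= t -> X1 (stopped_at X1 n t w) w =
     X1 0 w + \col_i (\int[lam]_(r in `[0%R, stopped_at X1 n t w]) (b (X1 r w) i 0))%R
       + MW1 t w + MN1 t w})
  (eq2 : {ae P, forall w, forall t : R, 0 <= t -> X2 (stopped_at X2 n t w) w =
     X2 0 w + \col_i (\int[lam]_(r in `[0%R, stopped_at X2 n t w]) (b (X2 r w) i 0))%R
       + MW2 t w + MN2 t w})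
  (X0 : {ae P, forall w, X1 0 w = X2 0 w}).

Let stopped_b_bound (X : R -> T -> 'cV[R]_d) z : frob (stopped X n b z) <= K.
Proof.
rewrite -(@ler_pXn2r _ 2) ?nnegrE ?frob_ge0 ?(ltW K0)//; apply: stopped_bound; first exact: sqr_ge0.
by move=> x /hK[h _ _]; rewrite ler_pXn2r ?nnegrE ?frob_ge0 ?(ltW K0).
Qed.

Let stopped_b_bmeas (X : R -> T -> 'cV[R]_d) i : adapted F X -> (forall w, cadlag (fun t => X t w)) ->
  bmeas (fun z => stopped X n b z i 0).
Proof.
move=> aX cX; split; first exact: (stopped_cmeas _ FS aX cX b_cont).
by exists K => z; apply: le_trans (frob_coord _ _ _) (stopped_b_bound X z).
Qed.

Lemma drift_coef_bound z : frob (drift_coef z) <= 2 * K.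
Proof.
apply: le_trans (frobD _ _) _; rewrite frobN.
by have := stopped_b_bound X1 z; have := stopped_b_bound X2 z; lra.
Qed.

Lemma drift_split (X : R -> T -> 'cV[R]_d) (s t : R) w i : adapted F X -> (forall w, cadlag (fun t => X t w)) ->
  0 <= s -> s <= t -> alive X n t w ->
  (\int[lam]_(r in `[0%R, t]) (b (X r w) i 0))%R =
  (\int[lam]_(r in `[0%R, s]) (b (X r w) i 0))%R + tint s t (fun z => stopped X n b z i 0) w.
Proof.
move=> aX cX s0 st al; have hb := stopped_b_bmeas i aX cX; have t0 := le_trans s0 st.
have e (u : R) : 0 <= u -> u <= t -> (\int[lam]_(r in `[0%R, u]) (b (X r w) i 0))%R =
    (\int[lam]_(r in `[0%R, u]) (stopped X n b (w, r) i 0))%R.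
  move=> u0 ut; apply: eq_Rintegral => r /set_mem; rewrite /= in_itv/= => /andP[r0 ru].
  by rewrite /stopped/= (max_idPl r0) alive_ind1 ?scale1r//; apply: alive_le al; exact: le_trans ut.
rewrite !e//; apply/eqP; rewrite addrC -subr_eq; apply/eqP.
apply: (@Rintegral_itvB _ (fun r => stopped X n b (w, r) i 0) (BLeft 0) (BRight t) s); rewrite ?bnd_simp//.
have [mf [C hC]] := hb.
apply: (@measurable_bounded_integrable _ _ _ lam (fun r => stopped X n b (w, r) i 0)).
- exact: measurable_itv.
- by rewrite /= lebesgue_measure_itv/=; case: ifP => _; rewrite ltry.
- by apply: measurable_funTS; exact: (measurable_fun_pair2 w mf).
- exists C; split; first exact: num_real.
  by move=> M CM r _ /=; apply: le_trans (hC _) (ltW CM).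
Qed.

Lemma tint_stopped_sub (s t : R) w i : s <= t ->
  tint s t (fun z => drift_coef z i 0) w = tint s t (fun z => stopped X1 n b z i 0) w - tint s t (fun z => stopped X2 n b z i 0) w.
Proof.
move=> st; have h1 := stopped_b_bmeas i aX1 cX1; have h2 := stopped_b_bmeas i aX2 cX2.
rewrite -mulN1r -(tintZ s t (-1) w h2) -tintD//; last exact: bmeasZ.
by congr (tint s t _ w); apply/funext => z; rewrite /drift_coef !mxE mulN1r.
Qed.

(** A path alive at t has not been stopped before t, so the stopped equations may be read at s and t
    themselves and subtracted; the drift up to t is then that of the stopped coefficient. *)
Lemma path_increment : {ae P, forall w, forall s t : R, 0 <= s -> s <= t ->
  alive X1 n t w -> alive X2 n t w ->
  X1 t w - X2 t w = (X1 s w - X2 s w) + (mart_diff t w - mart_diff s w) + drift s t drift_coef w}.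
Proof.
apply: filterS2 eq1 eq2 => w h1 h2 s t s0 st a1 a2; have t0 := le_trans s0 st.
have := h1 t t0; have := h1 s s0; rewrite (stopped_alive st a1) (stopped_alive (lexx t) a1) => -> ->.
have := h2 t t0; have := h2 s s0; rewrite (stopped_alive st a2) (stopped_alive (lexx t) a2) => -> ->.
apply/matrixP => i j; rewrite ord1 !mxE (drift_split i aX1 cX1 s0 st a1) (drift_split i aX2 cX2 s0 st a2).
rewrite (tint_stopped_sub w i st).
by move: (tint _ _ _ _) (tint _ _ _ _) (\int[_]_(_ in _) _)%R (\int[_]_(_ in _) _)%R => ? ? ? ?; ring.
Qed.

(** An inequality, because killing can only shrink the gap: either it is 0 at t, or both paths are
    alive at t, hence at s, and [path_increment] applies. *)
Lemma gap_step (s t : R) : 0 <= s -> s <= t -> {ae P, forall w,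
  frob (gap t w) ^+ 2 <= frob (gap s w + both_alive s w *: (mart_diff t w - mart_diff s w) + drift s t drift_coef w) ^+ 2}.
Proof.
move=> s0 st; apply: filterS path_increment => w h; rewrite {1}/gap.
have [[a1 [a2 ->]]|[_ ->]] := both_alive_cases t w; last by rewrite scale0r frob0 expr0n sqr_ge0.
rewrite scale1r (h s t s0 st a1 a2) /gap /both_alive !alive_ind1 ?mulr1 ?scale1r//; exact: alive_le st _.
Qed.

(** The modulus enters only through an affine bound in the squared distance, which can be
    integrated; [A] will be a constant times rho at eps. *)
Context (A eps eta : R).
Hypotheses (A0 : 0 <= A) (eps0 : 0 < eps) (eta0 : 0 < eta) (eta1 : eta <= 1)
  (growth : forall x z : 'cV[R]_d, frob x <= n%:R -> frob z <= n%:R ->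
     ((2 * dotp (x - z) (b x - b z) + frob (sigma x - sigma z) ^+ 2)%:E
        + int_sq nu (fun u => (c x u - c z u)%R) <= (A * (1 + frob (x - z) ^+ 2 / eps))%:E)%E).

Definition mean_sq_gap (r : R) : R := Ex P (fun w => frob (gap r w) ^+ 2).
(* What it costs to freeze at time s the alive indicator and the gap that enter
   the integrand at time r. *)
Definition freeze_err (s : R) (z : TR) : R :=
  (4 * d%:R * (2 * n%:R) * K + 16 * K) * `|both_alive s z.1 - both_alive (Num.max z.2 0) z.1|
  + 4 * d%:R * K * frob (gap (Num.max z.2 0) z.1 - gap s z.1).
(** The last term pays for the excess eta of the weight of [qv_rate]: its two parts are at most 4 K
    each. *)
Definition growth_term (z : TR) : R := A * (1 + frob (gap (Num.max z.2 0) z.1) ^+ 2 / eps) + eta * (8 * K).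

Let max0 (r : R) : 0 <= Num.max r 0.
Proof. by rewrite le_max lexx orbT. Qed.

Lemma both_alive_joint : bmeas (fun z : TR => both_alive (Num.max z.2 0) z.1).
Proof.
split; first by apply: measurable_funM; apply: (alive_ind_joint _ FS).
by exists 1 => z; have /andP[h0 h1] := both_alive_itv (Num.max z.2 0) z.1; rewrite ger0_norm.
Qed.

Lemma gap_joint : cmeas (fun z : TR => gap (Num.max z.2 0) z.1).
Proof.
apply: cmeasZ; first by have [] := both_alive_joint.
have cc i j : continuous (fun B : 'cV[R]_d => B i j) by exact: coord_continuous.
apply: cmeasB => i j; first exact: (path_joint FS aX1 cX1 (cc i j)).
exact: (path_joint FS aX2 cX2 (cc i j)).
Qed.

Lemma frob_measurable (dS : measure_display) (S : measurableType dS) m k (g : S -> 'M[R]_(m, k)) :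
  cmeas g -> measurable_fun setT (fun x => frob (g x)).
Proof.
move=> mg; rewrite (_ : (fun _ => _) = Num.sqrt \o (fun x => frob (g x) ^+ 2)).
  apply: measurableT_comp; last exact: cmeas_frob.
  by apply: continuous_measurable_fun; exact: sqrt_continuous.
by apply/funext => x /=; rewrite sqrtr_sqr ger0_norm// frob_ge0.
Qed.

Lemma gap_sq_bmeas : bmeas (fun z : TR => frob (gap (Num.max z.2 0) z.1) ^+ 2).
Proof.
split; first exact: (cmeas_frob gap_joint).
exists ((2 * n%:R) ^+ 2) => z; rewrite ger0_norm ?sqr_ge0// ler_pXn2r ?nnegrE ?frob_ge0 ?mulr_ge0//.
exact: gap_bound.
Qed.

Lemma growth_term_bmeas : bmeas growth_term.
Proof.
apply: bmeasD; last exact: bmeas_cst.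
apply: bmeasZ; apply: bmeasD; first exact: bmeas_cst.
by apply: bmeasM; [exact: gap_sq_bmeas|exact: bmeas_cst].
Qed.

Lemma freeze_err_ge0 (s : R) z : 0 <= freeze_err s z.
Proof. by rewrite addr_ge0// !mulr_ge0 ?addr_ge0 ?mulr_ge0 ?frob_ge0// ltW. Qed.

Definition freeze_errC : R := (4 * d%:R * (2 * n%:R) * K + 16 * K) * 2 + 4 * d%:R * K * (4 * n%:R).

Lemma freeze_err_le (s : R) z : 0 <= s -> freeze_err s z <= freeze_errC.
Proof.
move=> s0; have k0 := ltW K0; apply: lerD; apply: ler_wpM2l.
- by rewrite addr_ge0 ?mulr_ge0.
- have /andP[a0 a1] := both_alive_itv s z.1; have /andP[b0 b1] := both_alive_itv (Num.max z.2 0) z.1.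
  by rewrite ler_norml; apply/andP; split; lra.
- by rewrite !mulr_ge0.
- apply: le_trans (frobD _ _) _; rewrite frobN.
  by have := gap_bound z.1 s0; have := gap_bound z.1 (max0 z.2); lra.
Qed.

Lemma freeze_err_bmeas (s : R) : 0 <= s -> bmeas (freeze_err s).
Proof.
move=> s0; split; last first.
  by exists freeze_errC => z; rewrite ger0_norm ?freeze_err_ge0//; exact: freeze_err_le.
have [mb _] := both_alive_bmeas s0; have [mb' _] := both_alive_joint.
apply: measurable_funD; apply: measurable_funM => //.
  by apply: measurableT_comp => //; exact: measurable_funB.
apply: (@frob_measurable _ TR); apply: cmeasB; first exact: gap_joint.
by move=> i j; apply: (measurableT_comp (gap_cmeas s0 i j)); exact: measurable_fst.
Qed.

Lemma gap_sq_L1 (s : R) : 0 <= s -> L1 P (fun w => frob (gap s w) ^+ 2).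
Proof.
move=> s0; apply: bdd_L1; first exact: (cmeas_frob (gap_cmeas s0)).
exists ((2 * n%:R) ^+ 2) => w; rewrite ger0_norm ?sqr_ge0// ler_pXn2r ?nnegrE ?frob_ge0 ?mulr_ge0//.
exact: gap_bound.
Qed.

Lemma gap_coord_L2 (s : R) i : 0 <= s -> L2 P (fun w => gap s w i 0).
Proof.
move=> s0; apply: bdd_L2; first exact: (gap_cmeas s0).
by exists (2 * n%:R) => w; apply: le_trans (frob_coord _ _ _) (gap_bound w s0).
Qed.

(** If a path is dead at s, the left side is 0. If both are alive at s but not at r, crude bounds
    are charged to the change of the indicator. If both are alive at r, [growth] applies there,
    after the gap at s has been replaced by the gap at r. *)
Lemma integrand_bound (s t : R) w (r : R) : 0 <= s -> s < r <= t ->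
  2 * dotp (gap s w) (drift_coef (w, r)) + (1 + eta) * qv_rate s (w, r) <= growth_term (w, r) + freeze_err s (w, r).
Proof.
move=> s0 /andP[sr rt]; have r0 : 0 <= r by rewrite (le_trans s0)// ltW.
have k0 := ltW K0; have d0 : 0 <= d%:R :> R by [].
have e0 := freeze_err_ge0 s (w, r).
have m0 : 0 <= growth_term (w, r).
  by rewrite addr_ge0 ?mulr_ge0 ?addr_ge0 ?divr_ge0 ?sqr_ge0// ltW.
have [[a1 [a2 bs]]|[_ bs]] := both_alive_cases s w; last first.
  rewrite /gap /qv_rate bs scale0r expr0n !mul0r addr0 mulr0 addr0.
  have -> : dotp 0 (drift_coef (w, r)) = 0 by rewrite dotpE big1// => i _; rewrite mxE mul0r.
  by rewrite mulr0; exact: addr_ge0.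
have [_ gW] := qv_rateW_bmeas; have [_ gN] := qv_rateN_bmeas.
have /andP[w0 w1] := gW (w, r); have /andP[n0 n1] := gN (w, r).
have xs := gap_bound w s0; have aK := drift_coef_bound (w, r).
have gE : qv_rate s (w, r) = qv_rateW (w, r) + qv_rateN (w, r) by rewrite /qv_rate bs expr1n !mul1r.
have etag : eta * qv_rate s (w, r) <= eta * (8 * K) by rewrite ler_wpM2l ?(ltW eta0)// gE; lra.
have [[c1 [c2 br]]|[_ br]] := both_alive_cases r w; last first.
  (* Twice this bound and the 16 K of the next one form the coefficient of the indicator change in
     [freeze_err]. *)
  have h1 : dotp (gap s w) (drift_coef (w, r)) <= d%:R * (2 * n%:R * (2 * K)).
    apply: le_trans (ler_norm _) _; apply: le_trans (dotp_le _ _) _.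
    by rewrite ler_wpM2l// ler_pM ?frob_ge0.
  have h2 : (1 + eta) * qv_rate s (w, r) <= 2 * (8 * K).
    rewrite gE; apply: ler_pM.
    - by rewrite addr_ge0// ltW.
    - exact: addr_ge0.
    - by rewrite (_ : 2 = 1 + 1)// lerD2l.
    - by apply: le_trans (lerD w1 n1) _; rewrite -mulrDl ler_wpM2r//; lra.
  apply: (@le_trans _ _ (freeze_err s (w, r))); last by rewrite lerDr.
  rewrite /freeze_err /= (max_idPl r0) bs br subr0 normr1 mulr1.
  have h3 : 0 <= 4 * d%:R * K * frob (gap r w - gap s w) by rewrite !mulr_ge0 ?frob_ge0.
  have : 2 * (d%:R * (2 * n%:R * (2 * K))) = 4 * d%:R * (2 * n%:R) * K by ring.
  lra.
have rr : 0 <= r <= r by rewrite r0 lexx.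
have := growth (c1 r rr) (c2 r rr).
have xr : gap r w = X1 r w - X2 r w by rewrite /gap br scale1r.
have i1 := alive_ind1 c1; have i2 := alive_ind1 c2.
have adE : drift_coef (w, r) = b (X1 r w) - b (X2 r w).
  by rewrite /drift_coef /stopped /= (max_idPl r0) i1 i2 !scale1r.
have HE : diffW (w, r) = sigma (X1 r w) - sigma (X2 r w).
  by rewrite /diffW /stopped /= (max_idPl r0) i1 i2 !scale1r.
have NE : int_sq nu (fun u => (c (X1 r w) u - c (X2 r w) u)%R) = (qv_rateN (w, r))%:E.
  rewrite -qv_rateNE; congr int_sq; apply/funext => u.
  by rewrite /diffN /stoppedU /= (max_idPl r0) i1 i2 !scale1r.
rewrite NE -adE -HE -xr -/(qv_rateW (w, r)) -EFinD lee_fin => hg.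
(* Twice the error term here is the gap part of [freeze_err]. *)
have dl : dotp (gap s w) (drift_coef (w, r)) <= dotp (gap r w) (drift_coef (w, r)) + d%:R * (frob (gap r w - gap s w) * (2 * K)).
  rewrite -lerBlDl; apply: (@le_trans _ _ `|dotp (gap s w - gap r w) (drift_coef (w, r))|).
    apply: le_trans (ler_norm _); rewrite !dotpE -sumrB le_eqVlt; apply/orP; left; apply/eqP.
    by apply: eq_bigr => i _; rewrite !mxE mulrBl.
  by apply: le_trans (dotp_le _ _) _; rewrite ler_wpM2l// frobB ler_pM ?frob_ge0.
have mE : growth_term (w, r) = A * (1 + frob (gap r w) ^+ 2 / eps) + eta * (8 * K).
  by rewrite /growth_term /= (max_idPl r0).
have eE : freeze_err s (w, r) = 2 * (d%:R * (frob (gap r w - gap s w) * (2 * K))).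
  by rewrite /freeze_err /= (max_idPl r0) bs br subrr normr0 mulr0 add0r; ring.
rewrite mE eE mulrDl mul1r gE in etag *.
lra.
Qed.

Lemma step (s t : R) : 0 <= s -> s <= t ->
  mean_sq_gap t <= mean_sq_gap s + Ex P (tint s t growth_term) + Ex P (tint s t (freeze_err s))
    + (1 + eta^-1) * (d%:R * (2 * K * (t - s)) ^+ 2).
Proof.
move=> s0 st; have t0 := le_trans s0 st.
have bphi : bmeas (fun z => growth_term z + freeze_err s z) by apply: bmeasD; [exact: growth_term_bmeas|exact: freeze_err_bmeas].
have mD : cmeas (fun w => both_alive s w *: (mart_diff t w - mart_diff s w)).
  by apply: cmeasZ; [exact: (Fm_meas FS s0 (both_alive_Fm s0))|apply: cmeasB; exact: mart_diff_cmeas].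
have bx : exists C : R, forall w, frob (gap s w) <= C.
  by exists (2 * n%:R) => w; exact: gap_bound.
have h1 := increment_diff s0 st (fun i => gap_Fm i s0) (fun i => gap_coord_L2 i s0).
have h2 : (nrm2 P (fun w => both_alive s w *: (mart_diff t w - mart_diff s w)) <=
    \int[P]_w \int[lam]_(r in `]s, t]) (qv_rate s (w, r))%:E)%E.
  (* Starting from 0 instead of the gap bounds the second moment of the martingale increment
     alone. *)
  have := @increment_diff s t (fun=> 0) s0 st _ _.
  rewrite (_ : nrm2 P (fun=> 0) = 0%E) ?add0e; last first.
    by apply: integral0_eq => w _; rewrite frob0 expr0n.
  rewrite (_ : nrm2 P (fun w => 0 + _) = nrm2 P (fun w => both_alive s w *: (mart_diff t w - mart_diff s w))); last first.
    by apply: eq_integral => w _; rewrite add0r.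
  have e0 (i : 'I_d) : (fun w : T => (0 : 'cV[R]_d) i 0) = fun=> 0 by apply/funext => w; rewrite mxE.
  by apply => i; rewrite e0; [exact: measurable_cst|exact: L2_cst].
have h3 w r : s < r <= t -> 2 * dotp (gap s w) (drift_coef (w, r)) + (1 + eta) * qv_rate s (w, r) <= growth_term (w, r) + freeze_err s (w, r).
  exact: integrand_bound.
have := one_step st (gap_cmeas s0) mD drift_coef_cmeas eta0 bx drift_coef_bound (qv_rate_bmeas s0) bphi h1 h2 h3.
rewrite (Ex_tint P st bphi) /nrm2 (Ex_EFin (gap_sq_L1 s0)) -!EFinD.
set S := integral _ _ _ => hS.
have : ((mean_sq_gap t)%:E <= S)%E.
  rewrite /mean_sq_gap -(Ex_EFin (gap_sq_L1 t0)); apply: ae_ge0_le_integral => //.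
  - by move=> w _; rewrite lee_fin sqr_ge0.
  - by apply/measurable_EFinP; exact: (cmeas_frob (gap_cmeas t0)).
  - by move=> w _; rewrite lee_fin sqr_ge0.
  - apply/measurable_EFinP; apply: cmeas_frob; apply: cmeasD; last exact: (drift_cmeas st drift_coef_cmeas drift_coef_bound).
    by apply: cmeasD => //; exact: gap_cmeas.
  - by apply: filterS (gap_step s0 st) => w h _; rewrite lee_fin.
move=> /le_trans/(_ hS); rewrite lee_fin => /le_trans; apply.
rewrite lerD2r -/(mean_sq_gap s) -[X in _ <= X]addrA lerD2l -ExD; first last.
- by apply: tint_L1 => //; exact: freeze_err_bmeas.
- by apply: tint_L1 => //; exact: growth_term_bmeas.
rewrite (_ : (fun w => _) = tint s t (fun z => growth_term z + freeze_err s z))//.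
by apply/funext => w; rewrite -tintD//; [exact: growth_term_bmeas|exact: freeze_err_bmeas].
Qed.

(** Tonelli brings the expectation inside, where it is [mean_sq_gap r] at each time r. *)
Lemma tint_gap_sq (u v Fs : R) : 0 <= u -> u <= v -> (forall r, 0 <= r <= v -> mean_sq_gap r <= Fs) ->
  Ex P (tint u v (fun z => frob (gap (Num.max z.2 0) z.1) ^+ 2)) <= Fs * (v - u).
Proof.
move=> u0 uv hF; rewrite -lee_fin -(Ex_tint P uv gap_sq_bmeas) (intW_nrm2 P u v gap_joint) /nrm2.
have mb : measurable_fun setT (fun z : TR => (frob (btw u v z.2 *: gap (Num.max z.2 0) z.1) ^+ 2)%:E).
  apply/measurable_EFinP; apply: cmeas_frob; apply: cmeasZ; last exact: gap_joint.
  by apply: measurable_between; exact: measurable_snd.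
have p0 (z : TR) : (0 <= (frob (btw u v z.2 *: gap (Num.max z.2 0) z.1) ^+ 2)%:E)%E.
  by rewrite lee_fin sqr_ge0.
rewrite (fubini_tonelli2 _ mb p0).
apply: (@le_trans _ _ (\int[lam]_(r in `]u, v]) (cst Fs%:E) r)%E); last first.
  rewrite integral_cst//= lebesgue_measure_itv/= lte_fin; case: ltP => [//|vu].
  by rewrite mule0 lee_fin (_ : v - u = 0) ?mulr0//; lra.
rewrite [leRHS]integral_mkcond; apply: ge0_le_integral => //.
- by move=> r _; apply: integral_ge0 => w _; exact: p0.
- exact: (measurable_fun_fubini_tonelli_G _ mb p0).
- by apply/(measurable_restrictT _ _).1 => //; exact: measurable_itv.
move=> r _; rewrite /fubini_G/= patchE.
case: ifPn => [/set_mem|/negP nr].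
  rewrite /= in_itv/= => /andP[ur rv]; have r0 : 0 <= r by rewrite (le_trans u0)// ltW.
  rewrite (_ : (\int[P]_x _)%E = (mean_sq_gap r)%:E) ?lee_fin ?hF ?r0//.
  rewrite /mean_sq_gap -(Ex_EFin (gap_sq_L1 r0)); apply: eq_integral => w _.
  by rewrite /btw ur rv scale1r (max_idPl r0).
rewrite integral0_eq// => w _; rewrite (_ : btw u v r = 0) ?scale0r ?frob0 ?expr0n//.
rewrite /btw; have [h|//] := boolP (u < r <= v).
by case: nr; rewrite mem_setE in_itv.
Qed.

Lemma growth_term_le (u v Fs : R) : 0 <= u -> u <= v -> (forall r, 0 <= r <= v -> mean_sq_gap r <= Fs) ->
  Ex P (tint u v growth_term) <= (A * (1 + Fs / eps) + eta * (8 * K)) * (v - u).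
Proof.
move=> u0 uv hF; have hx := gap_sq_bmeas.
have -> : tint u v growth_term = (fun w => (A + eta * (8 * K)) * (v - u) +
    A / eps * tint u v (fun z => frob (gap (Num.max z.2 0) z.1) ^+ 2) w).
  apply/funext => w; rewrite -(tint_cst _ w uv) -tintZ// -tintD; last 2 first.
  - exact: bmeas_cst.
  - exact: bmeasZ.
  by congr (tint u v _ w); apply/funext => z; rewrite /growth_term; ring.
rewrite ExD ?Ex_cst ?ExZ//; last 3 first.
- exact: tint_L1.
- exact: L1_cst.
- by apply: L1Z; exact: tint_L1.
have ae : 0 <= A / eps by rewrite divr_ge0// ltW.
have := ler_wpM2l ae (tint_gap_sq u0 uv hF).
by rewrite (_ : A * (1 + Fs / eps) = A + A / eps * Fs); [lra|ring].
Qed.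

Lemma mean_sq_gap_inequality (s t Fs : R) : 0 <= s -> s <= t -> (forall r, 0 <= r <= t -> mean_sq_gap r <= Fs) ->
  mean_sq_gap t <= mean_sq_gap s + (A * (1 + Fs / eps) + eta * (8 * K)) * (t - s).
Proof.
move=> s0 st hF.
apply: (@grid_telescope _ s t _ ((1 + eta^-1) * (d%:R * (2 * K) ^+ 2)) mean_sq_gap (fun u v => Ex P (tint u v (freeze_err u)))) => //.
  move=> u v su uv vt; have u0 := le_trans s0 su.
  apply: le_trans (step u0 uv) _.
  have := growth_term_le u0 uv (Fs := Fs) _; move/(_ _) => hm.
  have -> : (1 + eta^-1) * (d%:R * (2 * K * (v - u)) ^+ 2) = (1 + eta^-1) * (d%:R * (2 * K) ^+ 2) * (v - u) ^+ 2 by ring.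
  rewrite lerD2r lerD2r lerD2l; apply: hm => r /andP[r0 rv]; apply: hF.
  by rewrite r0 (le_trans rv).
apply: (@riemann_error_cvg0 _ _ _ P s t st freeze_err freeze_errC s0) => //.
- exact: freeze_err_bmeas.
- by move=> u z _; exact: freeze_err_ge0.
- by move=> u z u0; exact: freeze_err_le.
move=> w; have c20 : 0 <= 4 * d%:R * K by rewrite !mulr_ge0// ltW.
have [D cD hD] := freeze_err_left n (4 * d%:R * (2 * n%:R) * K + 16 * K) (cX1 w) (cX2 w) c20.
exists D => // r /andP[sr rt] nD e e0; have r0 : 0 < r by exact: le_lt_trans sr.
have [del del0 h] := hD r r0 nD e e0; exists del => // u u0 hu.
by have := h u hu; rewrite /freeze_err /gap /both_alive /= (max_idPl (ltW r0)).
Qed.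

Lemma mean_sq_gap_ge0 r : 0 <= mean_sq_gap r.
Proof. by apply: Ex_ge0 => w; exact: sqr_ge0. Qed.

Lemma mean_sq_gap_le r : 0 <= r -> mean_sq_gap r <= (2 * n%:R) ^+ 2.
Proof.
move=> r0; rewrite -[leRHS](Ex_cst P); apply: Ex_le; [exact: gap_sq_L1|exact: L1_cst|].
by move=> w; rewrite ler_pXn2r ?nnegrE ?frob_ge0 ?mulr_ge0//; exact: gap_bound.
Qed.

Lemma mean_sq_gap0 : mean_sq_gap 0 = 0.
Proof.
apply: etrans (Ex_cst P 0); apply: Ex_ae; [exact: (cmeas_frob (gap_cmeas (lexx 0)))|exact: measurable_cst|].
by apply: filterS X0 => w e; rewrite /gap e subrr scaler0 frob0 expr0n.
Qed.

Lemma mean_sq_gap_eq0 r : 0 <= r -> mean_sq_gap r = 0 ->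
  {ae P, forall w, alive X1 n r w -> alive X2 n r w -> X1 r w = X2 r w}.
Proof.
move=> r0 m0; have mx := cmeas_frob (gap_cmeas r0).
have : (\int[P]_w `|(frob (gap r w) ^+ 2)%:E| = 0)%E.
  rewrite -[RHS]/(0%:E) -m0 /mean_sq_gap -(Ex_EFin (gap_sq_L1 r0)); apply: eq_integral => w _.
  by rewrite abse_EFin ger0_norm// sqr_ge0.
have mE : measurable_fun setT (fun w => (frob (gap r w) ^+ 2)%:E) by exact/measurable_EFinP.
move=> /(ae_eq_integral_abs P measurableT mE); apply: filterS => w /(_ I) [] /eqP.
rewrite sqrf_eq0 => /eqP/frob_eq0 + a1 a2; rewrite /gap /both_alive !alive_ind1// mulr1 scale1r.
by move=> /eqP; rewrite subr_eq0 => /eqP.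
Qed.

End pair.

(** * The Bihari argument *)

(** Below eps by monotonicity. Beyond eps, concavity on [0, v] and rho 0 >= 0 give rho eps >= (eps /
    v) rho v. *)
Lemma concave_growth (R : realType) (rho : R -> R) (eps v : R) :
  (forall r, 0 <= r -> 0 <= rho r) -> nondecreasing_on_nonneg rho -> concave_on_nonneg rho ->
  0 < eps -> 0 <= v -> rho v <= rho eps * (1 + v / eps).
Proof.
move=> r0 mono conc e0 v0; have re := r0 eps (ltW e0).
have [ve|ev] := leP v eps.
  by apply: le_trans (mono _ _ v0 ve) _; rewrite ler_peMr// lerDl divr_ge0// (ltW e0).
have vp : 0 < v by exact: lt_trans ev.
have a01 : 0 <= eps / v <= 1 by rewrite divr_ge0 ?(ltW e0)//= ler_pdivrMr// mul1r ltW.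
have := conc v 0 (eps / v) v0 (lexx 0) a01.
rewrite mulr0 addr0 mulfVK ?lt0r_neq0// => h.
have /andP[_ a1] := a01.
have h0 : 0 <= (1 - eps / v) * rho 0 by rewrite mulr_ge0 ?subr_ge0 ?r0.
have : rho v <= rho eps * (v / eps).
  by rewrite -[v / eps]invf_div ler_pdivlMr ?divr_gt0// mulrC; lra.
by rewrite mulrDr mulr1; lra.
Qed.

Section bihari.
Context (R : realType) (f rho : R -> R) (k C : R).
Notation lam := (@lebesgue_measure R).
Hypotheses (f0 : f 0 = 0) (fge0 : forall r, 0 <= r -> 0 <= f r) (fC : forall r, 0 <= r -> f r <= C)
  (k0 : 0 < k) (rho0 : forall r, 0 <= r -> 0 <= rho r) (rho_pos : forall r, 0 < r -> 0 < rho r)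
  (rho_mono : nondecreasing_on_nonneg rho)
  (rho_int : forall e : R, 0 < e -> (\int[lam]_(r in `]0%R, e[) ((rho r)^-1)%:E = +oo)%E)
  (f_ineq : forall eps s t Fs : R, 0 < eps -> 0 <= s -> s <= t -> (forall r, 0 <= r <= t -> f r <= Fs) ->
     f t <= f s + k * rho eps * (1 + Fs / eps) * (t - s)).

Let Fset t := [set f r | r in [set r | 0 <= r <= t]].
Let F t := sup (Fset t).

Let Fsup t : 0 <= t -> has_sup (Fset t).
Proof.
move=> t0; split; first by exists (f 0), 0 => //=; rewrite lexx.
by exists C => _ [r /andP[r0 _] <-]; exact: fC.
Qed.

Let fF r t : 0 <= r <= t -> f r <= F t.
Proof.
move=> /andP[r0 rt]; apply: (sup_upper_bound (Fsup (le_trans r0 rt))).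
by exists r => //=; rewrite r0.
Qed.

Let F_le t M : 0 <= t -> (forall r, 0 <= r <= t -> f r <= M) -> F t <= M.
Proof.
move=> t0 h; apply: ge_sup; first by have [] := Fsup t0.
by move=> _ [r hr <-]; exact: h.
Qed.

Let F_mono s t : 0 <= s -> s <= t -> F s <= F t.
Proof.
by move=> s0 st; apply: F_le => // r /andP[r0 rs]; apply: fF; rewrite r0 (le_trans rs).
Qed.

Let F0 : F 0 = 0.
Proof.
apply/le_anti/andP; split; last by rewrite -{1}f0; apply: fF; rewrite lexx.
by apply: F_le => // r; rewrite -eq_le => /eqP <-; rewrite f0.
Qed.

Let F_ge0 t : 0 <= t -> 0 <= F t.
Proof. by move=> t0; rewrite -F0; exact: F_mono. Qed.

(** Both free parameters of [f_ineq] are set to F t, so that 1 + Fs / eps = 2. *)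
Let F_incr s t : 0 <= s -> s <= t -> 0 < F t -> F t <= F s + 2 * k * rho (F t) * (t - s).
Proof.
move=> s0 st Ft; have t0 := le_trans s0 st; have rF := rho0 (ltW Ft).
apply: F_le => // r /andP[r0 rt].
have c0 : 0 <= 2 * k * rho (F t) by rewrite !mulr_ge0// ltW.
have [rs|/ltW sr] := leP r s.
  have := fF (_ : 0 <= r <= s); rewrite r0 rs => /(_ isT).
  have : 0 <= 2 * k * rho (F t) * (t - s) by rewrite mulr_ge0// subr_ge0.
  lra.
have := @f_ineq (F t) s r (F t) Ft s0 sr (fun q => _); move/(_ _).
have hq q : 0 <= q <= r -> f q <= F t by move=> /andP[q0 qr]; apply: fF; rewrite q0 (le_trans qr).
move=> /(_ hq); rewrite divff ?lt0r_neq0// => h.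
have fs : f s <= F s by apply: fF; rewrite s0 lexx.
have : 2 * k * rho (F t) * (r - s) <= 2 * k * rho (F t) * (t - s) by rewrite ler_wpM2l// lerD2r.
lra.
Qed.

(** By [F_incr] the running supremum is Lipschitz on [0, t]; clamping the argument extends it to the
    line, and the intermediate value theorem can then produce the times [tau]. *)
Let F_cont (t : R) : 0 <= t -> continuous (fun x : R => F (Num.min (Num.max x 0) t) : R).
Proof.
move=> t0; pose c x := Num.min (Num.max x 0) t; pose L := 2 * k * rho (F t).
have L0 : 0 <= L by rewrite !mulr_ge0 ?rho0 ?F_ge0// ltW.
have c0 x : 0 <= c x <= t by rewrite le_min le_max lexx orbT t0 ge_min lexx orbT.
have lip x y : x <= y -> F (c x) <= F (c y) /\ F (c y) - F (c x) <= L * (y - x).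
  move=> xy; have /andP[x0 xt] := c0 x; have /andP[y0 yt] := c0 y.
  have cxy : c x <= c y.
    by rewrite /c le_min !ge_min lexx orbT andbT; apply/orP; left; rewrite ge_max !le_max xy lexx orbT.
  have cd : c y - c x <= y - x.
    have hmin (p q : R) : p <= q -> Num.min q t - Num.min p t <= q - p.
      by move=> pq; have [?|?] := leP q t; have [?|?] := leP p t; lra.
    have hmax (p q : R) : p <= q -> Num.max q 0 - Num.max p 0 <= q - p.
      by move=> pq; have [?|?] := leP q 0; have [?|?] := leP p 0; lra.
    apply: le_trans (hmax _ _ xy); apply: hmin.
    by rewrite ge_max !le_max xy lexx orbT.
  split; first exact: F_mono.
  have [Fy|Fy] := leP (F (c y)) 0.
    have := F_ge0 x0; have : 0 <= L * (y - x) by rewrite mulr_ge0// subr_ge0.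
    by lra.
  have := F_incr x0 cxy Fy.
  have : 2 * k * rho (F (c y)) * (c y - c x) <= L * (y - x).
    rewrite ler_pM// ?subr_ge0//; first by rewrite !mulr_ge0 ?rho0 ?(ltW Fy)// ltW.
    by rewrite /L ler_wpM2l ?mulr_ge0 ?(ltW k0)// rho_mono ?(ltW Fy)// F_mono.
  lra.
move=> x; apply/cvgrPdist_lt => e e0; have d0 : 0 < e / (L + 1) by rewrite divr_gt0//; lra.
apply/nbhs_ballP; exists (e / (L + 1)) => //= y xy.
have Le : L * `|x - y| < e.
  have := xy; rewrite /ball/= ltr_pdivlMr; last by lra.
  by apply: le_lt_trans; rewrite mulrC ler_wpM2l//; lra.
rewrite -/(c x) -/(c y); have [h|/ltW h] := leP x y.
  have [h1 h2] := lip _ _ h; rewrite ler0_norm ?subr_le0// opprB.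
  by apply: le_lt_trans Le; rewrite ler0_norm ?subr_le0// opprB.
have [h1 h2] := lip _ _ h; rewrite ger0_norm ?subr_ge0//.
by apply: le_lt_trans Le; rewrite ger0_norm ?subr_ge0.
Qed.

(* With F the running supremum of f and F (tau i) = F t / 2 ^ i, the increment of F
   over ]tau i.+1, tau i] bounds the integral of 1 / rho over a dyadic block by a
   multiple of tau i.+1 - tau i.+2, and these lengths add up to at most t. *)
Lemma bihari t : 0 <= t -> f t = 0.
Proof.
move=> t0; apply/eqP; rewrite eq_le fge0// andbT leNgt; apply/negP => ft.
have Ft : 0 < F t by apply: lt_le_trans ft _; apply: fF; rewrite t0 lexx.
pose v i := F t / 2 ^+ i.
have v_pos i : 0 < v i by rewrite divr_gt0// exprn_gt0.
have vS i : v i = 2 * v i.+1 by rewrite /v exprS; field; rewrite expf_neq0.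
have v_le i : v i <= F t by rewrite ler_pdivrMr ?exprn_gt0// ler_peMr ?(ltW Ft)// exprn_ege1// ler1n.
have times i : exists x : R, 0 <= x <= t /\ F x = v i.
  have := @IVT R (fun x => F (Num.min (Num.max x 0) t)) 0 t (v i) t0 (continuous_subspaceT (F_cont t0)).
  rewrite maxxx (min_idPl t0) (max_idPl t0) minxx F0 (min_idPl (ltW Ft)) (max_idPr (ltW Ft)).
  rewrite (ltW (v_pos i)) v_le => /(_ isT)[x]; rewrite in_itv/= => /andP[x0 xt].
  by rewrite (max_idPl x0) (min_idPl xt) => e; exists x; rewrite x0 xt.
have [tau htau] := choice times.
have tau_le i : tau i.+1 <= tau i.
  have [/andP[a0 _] ea] := htau i; have [/andP[b0 _] eb] := htau i.+1.
  rewrite leNgt; apply/negP => /ltW/(F_mono a0); rewrite ea eb vS => h.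
  by have := v_pos i.+1; lra.
have level i : v i.+1 <= 2 * k * rho (v i) * (tau i - tau i.+1).
  have [/andP[a0 _] ea] := htau i; have [/andP[b0 _] eb] := htau i.+1.
  have := F_incr b0 (tau_le i); rewrite ea eb => /(_ (v_pos i)).
  by rewrite {1}vS; lra.
pose g (r : R) := ((rho r)^-1)%:E.
(* Measurable because monotone, once extended by a constant below v i. *)
have mg i (a : R) : measurable_fun (`[v i, a[%classic : set (measurableTypeR R)) g.
  apply/measurable_EFinP.
  apply: (@eq_measurable_fun _ _ (measurableTypeR R) R _ (fun r => (rho (Num.max r (v i)))^-1)).
    by move=> r /set_mem; rewrite /= in_itv/= => /andP[/max_idPl ->].
  apply: nonincreasing_measurable; first exact: measurable_itv.
  move=> x y xy; have vp (z : R) : 0 < Num.max z (v i) by rewrite lt_max v_pos orbT.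
  rewrite lef_pV2 ?posrE ?rho_pos//; apply: rho_mono; first exact: ltW.
  by rewrite ge_max !le_max xy lexx orbT.
have g0 i (a r : R) : (`[v i, a[%classic : set R) r -> (0 <= g r)%E.
  rewrite /= in_itv/= => /andP[vr _]; rewrite lee_fin invr_ge0 ltW// rho_pos//.
  exact: lt_le_trans vr.
(* The block has length v i.+1 = 2 v i.+2 and 1 / rho is at most its value at the left end; [level]
   at i.+1 cancels rho and contributes 2 k, whence 4 k. *)
have piece i : (\int[lam]_(r in `[v i.+1, v i[) g r <= (4 * k * (tau i.+1 - tau i.+2))%:E)%E.
  apply: (@le_trans _ _ (\int[lam]_(r in `[v i.+1, v i[) (cst ((rho (v i.+1))^-1)%:E) r)%E).
    apply: ge0_le_integral => //.
    - exact: g0.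
    - move=> r /=; rewrite in_itv/= => /andP[vr _]; rewrite lee_fin lef_pV2 ?posrE ?rho_pos//.
        by apply: rho_mono => //; exact: ltW.
      exact: lt_le_trans vr.
  rewrite integral_cst//= lebesgue_measure_itv/= lte_fin.
  have vv : v i.+1 < v i by rewrite (vS i); have := v_pos i.+1; lra.
  rewrite vv -EFinM lee_fin ler_pdivrMl ?rho_pos//.
  by have := level i.+1; have := vS i; have := vS i.+1; lra.
have total N : (\int[lam]_(r in `[v N, v 0%N[) g r <= (4 * k * (tau 1%N - tau N.+1))%:E)%E.
  elim: N => [|N ih].
    by rewrite set_itvco0 integral_set0 subrr mulr0.
  have vv : v N.+1 <= v N by rewrite (vS N); have := v_pos N.+1; lra.
  have v0 : v N <= v 0%N by rewrite {2}/v expr0 divr1.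
  rewrite (@itv_bndbnd_setU _ _ _ (BLeft (v N)))//=.
  rewrite ge0_integral_setU//=.
  - have -> : 4 * k * (tau 1%N - tau N.+2) = 4 * k * (tau N.+1 - tau N.+2) + 4 * k * (tau 1%N - tau N.+1) by ring.
    by rewrite EFinD; apply: leeD.
  - by rewrite -itv_bndbnd_setU.
  - by move=> r [] /g0.
  - rewrite disj_set2E; apply/eqP/seteqP; split => // r [] /=; rewrite !in_itv/=.
    by move=> /andP[_ h1] /andP[h2 _]; have := lt_le_trans h1 h2; rewrite ltxx.
have tle i : tau i <= t by have [/andP[]] := htau i.
have tge i : 0 <= tau i by have [/andP[]] := htau i.
have bigU : \bigcup_N (`[v N, v 0%N[%classic : set R) = `]0%R, F t[%classic.
  have v0 : v 0%N = F t by rewrite /v expr0 divr1.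
  apply/seteqP; split => [r [N _ /=]|r /=]; rewrite !in_itv/= v0.
    by move=> /andP[vr ->]; rewrite (lt_le_trans (v_pos N) vr).
  move=> /andP[r0 rF]; pose N := (Num.truncn (F t / r)).+1.
  exists N => //; rewrite set_itvE /mkset rF andbT /v ler_pdivrMr ?exprn_gt0// mulrC -ler_pdivrMr//.
  apply: (@le_trans _ _ N%:R); first by rewrite ltW// truncnS_gt.
  by rewrite -natrX ler_nat ltnW// ltn_expl.
have nd : nondecreasing_seq (fun N => (`[v N, v 0%N[%classic : set R)).
  apply/nondecreasing_seqP => N; apply/subsetPset => r /=; rewrite !in_itv/= => /andP[vr ->].
  by rewrite andbT (le_trans _ vr)// (vS N); have := v_pos N.+1; lra.
have := @ge0_nondecreasing_set_cvg_integral _ (measurableTypeR R) R (fun N => `[v N, v 0%N[%classic) g lam nd.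
move=> /(_ _ _ _); rewrite bigU rho_int// => cv.
(* The blocks exhaust ]0, F t[, where the integral of 1 / rho is infinite, while every partial
   integral is at most 4 k t. *)
suff : (+oo <= (4 * k * t)%:E :> \bar R)%E by rewrite leNgt ltry.
have {}cv := cv (fun N => measurable_itv _) (fun N => mg N _) (fun N => g0 N _).
rewrite -(cvg_lim _ cv)//; apply: lime_le; first by apply/cvg_ex; eexists; exact: cv.
apply: nearW => N; apply: le_trans (total N) _; rewrite lee_fin.
rewrite ler_wpM2l ?mulr_ge0 ?(ltW k0)//.
by have := tle 1%N; have := tge N.+1; lra.
Qed.

End bihari.

(** * Indistinguishability *)

Section indistinguishability.
Context (R : realType) (d : nat) (dT : measure_display) (T : measurableType dT) (P : probability T R)
  (X1 X2 : R -> T -> 'cV[R]_d).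
Hypotheses (cX1 : forall w, cadlag (fun t => X1 t w)) (cX2 : forall w, cadlag (fun t => X2 t w)).

Lemma right_continuous_eq w (t : R) : 0 <= t ->
  (forall q : rat, t < ratr q -> ratr q < t + 1 -> X1 (ratr q) w = X2 (ratr q) w) -> X1 t w = X2 t w.
Proof.
move=> t0 h; apply/eqP; rewrite -subr_eq0; apply/eqP/frob_eq0/eqP.
rewrite eq_le frob_ge0 andbT leNgt; apply/negP => e0.
have e1 : 0 < frob (X1 t w - X2 t w) / 2 by rewrite divr_gt0.
have [r1 r10 h1] := right_frob ((cX1 w).1 t t0) e1.
have [r2 r20 h2] := right_frob ((cX2 w).1 t t0) e1.
have tm : t < Num.min (t + 1) (Num.min (t + r1) (t + r2)) by rewrite !lt_min !ltrDl ltr01 r10.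
have [q] := rat_in_itvoo tm; rewrite in_itv/= !lt_min => /and4P[tq q1 q2 q3].
have := h1 (ratr q); rewrite (ltW tq) q2 => /(_ isT) k1.
have := h2 (ratr q); rewrite (ltW tq) q3 => /(_ isT) k2.
have := frobD (X1 t w - X1 (ratr q) w) (X1 (ratr q) w - X2 t w).
by rewrite subrKA frobB h// in k1 *; lra.
Qed.

(** Countably many radii and rational times leave a single null set. Off it, each path is bounded on
    [0, t + 1], so some radius keeps both alive there, and right continuity passes from rationals to
    t. *)
Lemma indistinguishable : (forall (n : nat) (q : R), 0 <= q ->
    {ae P, forall w, alive X1 n q w -> alive X2 n q w -> X1 q w = X2 q w}) ->
  {ae P, forall w, forall t, 0 <= t -> X1 t w = X2 t w}.
Proof.
move=> h.
(* The rationals are enumerated by m, so that the null sets are united over natural numbers. *)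
have : {ae P, forall w, forall (n m : nat) (q : rat), unpickle m = Some q -> 0 <= (ratr q : R) ->
    alive X1 n (ratr q) w -> alive X2 n (ratr q) w -> X1 (ratr q) w = X2 (ratr q) w}.
  apply/ae_foralln => n; apply/ae_foralln => m.
  case e : (unpickle m) => [q|]; last by apply: aeW.
  have [q0|q0] := leP 0 (ratr q : R); last first.
    by apply: aeW => w _ [<-] q1; have := lt_le_trans q0 q1; rewrite ltxx.
  by apply: filterS (h n _ q0) => w hw _ [<-].
apply: filterS => w hw t t0; apply: right_continuous_eq => // q tq q1.
have t1 : 0 <= t + 1 by rewrite addr_ge0.
have [n1 b1] := cadlag_bounded (cX1 w) t1; have [n2 b2] := cadlag_bounded (cX2 w) t1.
have q0 : 0 <= (ratr q : R) by rewrite (le_trans t0)// ltW.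
apply: (hw (maxn n1 n2) (pickle q) q) => //; first exact: pickleK.
- move=> s /andP[s0 sq]; apply: le_trans (b1 s _) _; last by rewrite ler_nat leq_maxl.
  by rewrite s0 (le_trans sq)// ltW.
- move=> s /andP[s0 sq]; apply: le_trans (b2 s _) _; last by rewrite ler_nat leq_maxr.
  by rewrite s0 (le_trans sq)// ltW.
Qed.

End indistinguishability.

(** * Conclusion of the uniqueness proof *)

Lemma probability1_ae (R : realType) (dT : measure_display) (T : measurableType dT) (P : probability T R)
    (A : set T) : measurable A -> P A = 1%E -> {ae P, forall w, A w}.
Proof.
move=> mA PA; exists (~` A); split => //; first exact: measurableC.
by rewrite probability_setC// PA subee.
Qed.

Theorem theorem2p6 (R : realType) (d : nat) (hd : (2 <= d)%N)
    (dU : measure_display) (U : measurableType dU)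
    (nu : {sigma_finite_measure set U -> \bar R})
    (b : 'cV[R]_d -> 'cV[R]_d) (sigma : 'cV[R]_d -> 'M[R]_d)
    (c : 'cV[R]_d -> U -> 'cV[R]_d)
    (b_cont : continuous b) (sigma_cont : continuous sigma)
    (c_meas : forall i : 'I_d,
      measurable_fun setT (fun xu : borelRd R d * U => c xu.1 xu.2 i 0))
    (c_cont : forall u : U, continuous (fun x => c x u))
    (c_sq_fin : forall x, (int_sq nu (c x) < +oo)%E)
    (c_sq_cont : continuous (fun x => fine (int_sq nu (c x))))
    (H1 : exists (kappa : R) (zeta : R -> R),
      [/\ 0 < kappa /\ (forall r, 0 <= r -> 1 <= zeta r),
          nondecreasing_on_nonneg zeta,
          is_C1_on_nonneg zeta,
          (\int[@lebesgue_measure R]_(r in `[0%R, +oo[)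
             ((r * zeta r + 1)^-1)%:E = +oo)%E &
          forall x : 'cV[R]_d,
            ((2 * dotp x (b x) + frob (sigma x) ^+ 2)%:E + int_sq nu (c x) <=
             (kappa * (frob x ^+ 2 * zeta (frob x ^+ 2) + 1))%:E)%E])
    (H2 : exists (delta0 : R) (rho : R -> R),
      [/\ 0 < delta0 /\ (forall r, 0 <= r -> 0 <= rho r),
          nondecreasing_on_nonneg rho /\ concave_on_nonneg rho,
          forall r, 0 < r ->
            0 < rho r /\ rho r <= (1 + r) ^+ 2 * rho (r / (1 + r)),
          forall e : R, 0 < e ->
            (\int[@lebesgue_measure R]_(r in `]0%R, e[)
               ((rho r)^-1)%:E = +oo)%E &
          forall M : R, 0 < M -> exists2 kappaM : R, 0 < kappaM &
            forall x z : 'cV[R]_d,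
              Num.max (frob x) (frob z) <= M -> frob (x - z) <= delta0 ->
              ((2 * dotp (x - z) (b x - b z)
                  + frob (sigma x - sigma z) ^+ 2)%:E
                 + int_sq nu (fun u => (c x u - c z u)%R) <=
               (kappaM * rho (frob (x - z) ^+ 2))%:E)%E]) :
  pathwise_uniqueness nu b sigma c.
Proof.
move=> dT T P F W p X1 X2 [FS Fle _ Fcomplete] BW pp WN.
move=> [aX1 cX1 [MW1 [MN1 [iW1 iN1 e1]]]] [aX2 cX2 [MW2 [MN2 [iW2 iN2 e2]]]] X0.
have [delta0 [rho [[delta0_gt0 rho_ge0] [rho_mono rho_conc] rho_pos rho_int rho_mod]]] := H2.
have {}rho_pos r : 0 < r -> 0 < rho r by move=> /rho_pos[].
have eq0 : {ae P, forall w, X1 0 w = X2 0 w}.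
  have mX (X : R -> T -> 'cV[R]_d) i : adapted F X -> measurable_fun setT (fun w => X 0 w i 0).
    by move=> aX; exact: (measurable_wrt_cmeas FS (lexx 0) (aX 0 (lexx 0))).
  apply: probability1_ae X0.
  rewrite (_ : mkset _ = \bigcap_(i in [set: 'I_d]) [set w | X1 0 w i 0 = X2 0 w i 0]); last first.
    apply/seteqP; split => w /=; first by move=> e i _ /=; rewrite e.
    by move=> h; apply/matrixP => i j; rewrite ord1; exact: h.
  apply: fin_bigcap_measurable => // i _.
  rewrite (_ : mkset _ = setT `&` (fun w => X1 0 w i 0 - X2 0 w i 0) @^-1` [set 0]).
    exact: (measurable_funB (mX X1 i aX1) (mX X2 i aX2) measurableT (measurable_set1 0)).
  by apply/seteqP; split => w /= => [->|[_ /eqP]]; rewrite ?subrr// subr_eq0 => /eqP.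
have main_eq (n : nat) (q : R) : 0 <= q ->
    {ae P, forall w, alive X1 n q w -> alive X2 n q w -> X1 q w = X2 q w}.
  move=> q0; apply: (mean_sq_gap_eq0 FS Fle aX1 aX2 cX1 cX2 q0).
  have [K K0 hK] := coefficient_bounds b_cont sigma_cont c_sq_fin c_sq_cont n%:R.
  (* The radius is enlarged by 1 because the local condition asks for a positive one and n may be
     0. *)
  have n0 : 0 < n%:R + 1 :> R by rewrite ltr_wpDl.
  have [kappa kappa0 hkappa] := rho_mod _ n0.
  have [k k0 hk] : exists2 k : R, 0 < k & forall x z : 'cV[R]_d, frob x <= n%:R -> frob z <= n%:R ->
     ((2 * dotp (x - z) (b x - b z) + frob (sigma x - sigma z) ^+ 2)%:E
        + int_sq nu (fun u => (c x u - c z u)%R) <= (k * rho (frob (x - z) ^+ 2))%:E)%E.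
    apply: (modulus_on_ball b_cont sigma_cont c_meas c_sq_fin c_sq_cont delta0_gt0 kappa0 rho_ge0 rho_mono rho_pos).
    move=> x z xz; apply: hkappa; apply: le_trans xz _; by rewrite lerDl.
  apply: (@bihari R (mean_sq_gap P X1 X2 n) rho k ((2 * n%:R) ^+ 2)) => //.
  - exact: (mean_sq_gap0 FS Fle n aX1 aX2 cX1 cX2 eq0).
  - by move=> r _; exact: mean_sq_gap_ge0.
  - by move=> r r0; exact: (mean_sq_gap_le P FS Fle n aX1 aX2 cX1 cX2 r0).
  move=> eps s t Fs eps0 s0 st hF; apply/ler_addgt0Pr => e e0.
  (* Small enough for the term eta * 8 K (t - s) of the integral inequality to be at most e, which
     is arbitrary. *)
  pose eta := Num.min 1 (e / (8 * K * (t - s) + 1)).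
  have D0 : 0 < 8 * K * (t - s) + 1.
    by rewrite ltr_wpDl// !mulr_ge0 ?(ltW K0)// subr_ge0.
  have eta0 : 0 < eta by rewrite lt_min ltr01 divr_gt0.
  have eta1 : eta <= 1 by rewrite ge_min lexx.
  have etae : eta * (8 * K * (t - s) + 1) <= e by rewrite -ler_pdivlMr// ge_min lexx orbT.
  have A0 : 0 <= k * rho eps by rewrite mulr_ge0 ?rho_ge0// ltW.
  have growth (x z : 'cV[R]_d) : frob x <= n%:R -> frob z <= n%:R ->
     ((2 * dotp (x - z) (b x - b z) + frob (sigma x - sigma z) ^+ 2)%:E
        + int_sq nu (fun u => (c x u - c z u)%R) <= (k * rho eps * (1 + frob (x - z) ^+ 2 / eps))%:E)%E.
    move=> xn zn; apply: le_trans (hk x z xn zn) _; rewrite lee_fin -mulrA ler_wpM2l ?(ltW k0)//.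
    by apply: concave_growth => //; exact: sqr_ge0.
  have e1n : {ae P, forall w, forall t : R, 0 <= t -> X1 (stopped_at X1 n t w) w =
     X1 0 w + \col_i (\int[@lebesgue_measure R]_(r in `[0%R, stopped_at X1 n t w]) (b (X1 r w) i 0))%R
       + MW1 n t w + MN1 n t w} by apply: filterS e1 => w; exact.
  have e2n : {ae P, forall w, forall t : R, 0 <= t -> X2 (stopped_at X2 n t w) w =
     X2 0 w + \col_i (\int[@lebesgue_measure R]_(r in `[0%R, stopped_at X2 n t w]) (b (X2 r w) i 0))%R
       + MW2 n t w + MN2 n t w} by apply: filterS e2 => w; exact.
  have := mean_sq_gap_inequality FS Fle BW pp WN b_cont sigma_cont c_meas c_cont aX1 aX2 cX1 cX2
    (iW1 n) (iW2 n) (iN1 n) (iN2 n) K0 hK e1n e2n A0 eps0 eta0 eta1 growth s0 st hF.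
  move/le_trans; apply; rewrite mulrDl addrA lerD2l; apply: le_trans etae.
  by rewrite -!mulrA ler_wpM2l ?(ltW eta0)// lerDl.
set G := [set w | _].
(* Equality at all times is an uncountable intersection; it is an event because its complement is
   negligible and the filtration is complete. *)
have nG : P.-negligible (~` G) by exact: (indistinguishable cX1 cX2 main_eq).
have mG : measurable G.
  rewrite -[G]setCK; apply: measurableC.
  by have [_] := FS 0 (lexx 0); apply; exact: Fcomplete.
have /eqP : (1 - P G = 0)%E.
  by rewrite -(probability_setC P mG); exact: (negligibleP P (measurableC mG)).1 nG.
by rewrite sube_eq ?fin_num_measure// add0e => /eqP/esym.
Qed.
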